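(* Let $\mathbb{K}$ be an algebraically closed field and let $G$ be a connected graph. Then there exist an integer $n$ and a reduced, arithmetically Cohen--Macaulay projective curve $C_G\subset\mathbb{P}^n$ over $\mathbb{K}$ such that: the dual graph of $C_G$ is $G$; the Castelnuovo--Mumford regularity of $C_G\subset\mathbb{P}^n$ is at most $3$; every irreducible component of $C_G$ is a rational normal curve in its linear span; every singular point of $C_G$ has multiplicity $2$; and $C_G$ is locally a complete intersection.
   Context: All graphs are finite and simple (no loops, no multiple edges) and have at least two vertices. Let $S=\mathbb{K}[x_0,\dots,x_n]$ with irrelevant ideal $\mathfrak{m}$. For a projective scheme $X\subset\mathbb{P}^n$ let $\mathscr{I}_X\subset\mathscr{O}_{\mathbb{P}^n}$ be its ideal sheaf and $I_X\subset S$ the unique saturated homogeneous ideal with $X=\mathrm{Proj}(S/I_X)$. The (Castelnuovo--Mumford) regularity $\mathrm{reg}\,X$ is the least integer $k$ such that $H^i(\mathscr{I}_X(k-i))=0$ for all $i\ge 1$; equivalently $\mathrm{reg}\,X=\mathrm{reg}\,I_X$, where for a finitely generated graded $S$-module $M$, $\mathrm{reg}\,M=\max\{i+j: H^i_{\mathfrak{m}}(M)_j\ne 0\}$. $X\subset\mathbb{P}^n$ is arithmetically Cohen--Macaulay if $S/I_X$ is a Cohen--Macaulay ring. If $X_1,\dots,X_s$ are the irreducible components of $X$ (taken with reduced structure), the dual graph $G(X)$ has vertex set $\{1,\dots,s\}$, and $\{i,j\}$ (with $i\neq j$) is an edge if and only if $\dim(X_i\cap X_j)=\dim X-1$. *)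

(* Defs.v *)
(* MathComp, with multinomials for polynomial rings and the classical layer of
   MathComp-Analysis (boolp, classical_sets) for ideals as sets. *)
From HB Require Import structures.
From mathcomp Require Import all_boot all_order all_algebra.
From mathcomp Require Import mpoly.
From mathcomp Require Import boolp classical_sets.

Set Implicit Arguments.
Unset Strict Implicit.
Unset Printing Implicit Defensive.

Import Order.TTheory GRing.Theory Num.Theory.
Local Open Scope ring_scope.

(* Commutative algebra of a quotient R / J is phrased in R throughout: primes,
   ideals and submodules of R / J are those of R that contain J. *)

Definition is_max (Q : nat -> Prop) (d : nat) : Prop :=
  Q d /\ forall k, Q k -> (k <= d)%N.

(* [longest_chain Q d]: d is the supremum, attained, of the lengths of strict
   chains c_0 < c_1 < ... < c_d of sets satisfying Q. *)
Definition longest_chain (T : Type) (Q : set T -> Prop) : nat -> Prop :=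
  is_max (fun d => exists c : nat -> set T,
    (forall i, (i <= d)%N -> Q (c i)) /\
    (forall i, (i < d)%N -> (c i `<` c i.+1)%classic)).

Definition is_ideal (R : comNzRingType) (J : set R) : Prop :=
  [/\ J 0, forall a b, J a -> J b -> J (a + b) & forall r a, J a -> J (r * a)].

Definition is_prime (R : comNzRingType) (P : set R) : Prop :=
  [/\ is_ideal P, ~ P 1 & forall a b, P (a * b) -> P a \/ P b].

Definition is_maximal (R : comNzRingType) (M : set R) : Prop :=
  [/\ is_ideal M, ~ M 1
    & forall N : set R, is_ideal N -> ~ N 1 -> (M `<=` N)%classic -> N = M].

Definition is_radical (R : comNzRingType) (J : set R) : Prop :=
  forall (a : R) (k : nat), J (a ^+ k) -> J a.

Definition ideal_gen (R : comNzRingType) (G : set R) : set R :=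
  smallest (@is_ideal R) G.

Definition ideal_add (R : comNzRingType) (I J : set R) : set R :=
  ideal_gen (I `|` J)%classic.

Definition ideal_mul (R : comNzRingType) (I J : set R) : set R :=
  ideal_gen (fun x => exists a b, [/\ I a, J b & x = a * b]).

Fixpoint ideal_pow (R : comNzRingType) (I : set R) (k : nat) : set R :=
  if k is k'.+1 then ideal_mul I (ideal_pow I k') else setT.

(* J + (s_0, ..., s_(m-1)) *)
Definition ideal_adjoin (R : comNzRingType) (J : set R) (s : seq R) : set R :=
  ideal_gen (J `|` [set` s])%classic.

(* Krull dimension of R / J *)
Definition krull_dim (R : comNzRingType) (J : set R) : nat -> Prop :=
  longest_chain (fun P => is_prime P /\ (J `<=` P)%classic).

(* Codimension (height) of the prime M / J of R / J *)
Definition height (R : comNzRingType) (J M : set R) : nat -> Prop :=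
  longest_chain
    (fun P => [/\ is_prime P, (J `<=` P)%classic & (P `<=` M)%classic]).

(* Length of the R-module R / J *)
Definition module_length (R : comNzRingType) (J : set R) : nat -> Prop :=
  longest_chain (fun N => is_ideal N /\ (J `<=` N)%classic).

(* s is a regular sequence on R / J *)
Definition regular_seq (R : comNzRingType) (J : set R) (s : seq R) : Prop :=
  ~ ideal_adjoin J s 1 /\
  forall i, (i < size s)%N -> forall a,
    ideal_adjoin J (take i s) (s`_i * a) -> ideal_adjoin J (take i s) a.

(* Length of the longest regular sequence on R / J lying in M *)
Definition depth (R : comNzRingType) (J M : set R) : nat -> Prop :=
  is_max (fun d => exists s : seq R,
    [/\ size s = d, forall x, x \in s -> M x & regular_seq J s]).

(* R / J is a Cohen-Macaulay ring (R noetherian): depth and codimension agree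
   at every maximal ideal, as in Eisenbud, Commutative Algebra, 18.2. *)
Definition cohen_macaulay (R : comNzRingType) (J : set R) : Prop :=
  forall M : set R, is_maximal M -> (J `<=` M)%classic ->
    exists d, depth J M d /\ height J M d.

(* The maximal ideal, when R is local *)
Definition nonunits (R : comNzRingType) : set R :=
  fun x => ~ exists y, x * y = 1.
Arguments nonunits R : clear implicits.

(* For R noetherian local and J proper: R / J is a regular local ring *)
Definition regular_local (R : comNzRingType) (J : set R) : Prop :=
  exists (d : nat) (s : seq R),
    [/\ krull_dim J d, size s = d & ideal_adjoin J s = nonunits R].

(* For R noetherian local with maximal ideal m, and J proper: the
   Hilbert-Samuel multiplicity of A = R / J is e, that is, length(A / m^k A) is,
   for k large, a polynomial in k whose coefficient in degree d = dim A
   is e / d! *)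
Definition has_multiplicity (R : comNzRingType) (J : set R) (e : nat) : Prop :=
  exists (d : nat) (q : {poly rat}),
    [/\ krull_dim J d, (size q <= d.+1)%N, q`_d = e%:R / (d`!)%:R
      & exists k0 : nat, forall k, (k0 <= k)%N ->
          exists2 l : nat,
            module_length (ideal_add J (ideal_pow (nonunits R) k)) l
            & l%:R = q.[k%:R]].

(* J is generated by a regular sequence of R *)
Definition complete_intersection_ideal (R : comNzRingType) (J : set R) : Prop :=
  exists s : seq R,
    regular_seq [set 0]%classic s /\ J = ideal_adjoin [set 0]%classic s.

(* Closed subschemes of P^n are represented by their saturated homogeneous
   ideals in K[x_0, ..., x_n]. *)

Definition is_homogeneous (K : fieldType) (n : nat)
    (I : set {mpoly K[n.+1]}) : Prop :=
  is_ideal I /\ forall f d, I f -> I (pihomog mdeg d f).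

Definition is_saturated (K : fieldType) (n : nat)
    (I : set {mpoly K[n.+1]}) : Prop :=
  forall f, (exists N : nat, forall m : 'X_{1..n.+1}, mdeg m = N ->
    I ('X_[m] * f)) -> I f.

Definition projective_scheme (K : fieldType) (n : nat)
    (I : set {mpoly K[n.+1]}) : Prop :=
  is_homogeneous I /\ is_saturated I.

(* The points of the scheme P^n, closed or not *)
Definition relevant_prime (K : fieldType) (n : nat)
    (P : set {mpoly K[n.+1]}) : Prop :=
  [/\ is_prime P, is_homogeneous P & exists i, ~ P 'X_i].

(* Dimension of Proj (S / I) as a topological space; it makes sense for any
   homogeneous ideal I, and no d satisfies it if the scheme is empty. *)
Definition proj_dim (K : fieldType) (n : nat)
    (I : set {mpoly K[n.+1]}) : nat -> Prop :=
  longest_chain (fun P => relevant_prime P /\ (I `<=` P)%classic).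

Definition irreducible_component (K : fieldType) (n : nat)
    (I P : set {mpoly K[n.+1]}) : Prop :=
  [/\ relevant_prime P, (I `<=` P)%classic
    & forall Q : set {mpoly K[n.+1]}, relevant_prime Q -> (I `<=` Q)%classic ->
        (Q `<=` P)%classic -> Q = P].

Definition is_curve (K : fieldType) (n : nat)
    (I : set {mpoly K[n.+1]}) : Prop :=
  proj_dim I 1 /\ forall P, irreducible_component I P -> proj_dim P 1.

(* The ideal P1 + P2 cuts out the intersection of V(P1) and V(P2). *)
Definition meet_in_codim1 (K : fieldType) (n : nat)
    (I P1 P2 : set {mpoly K[n.+1]}) : Prop :=
  exists d, proj_dim I d.+1 /\ proj_dim (ideal_add P1 P2) d.

(* The dual graph of the scheme is isomorphic to the graph (V, e). *)
Definition dual_graph_is (K : fieldType) (n : nat)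
    (I : set {mpoly K[n.+1]}) (V : finType) (e : rel V) : Prop :=
  exists comp : V -> set {mpoly K[n.+1]},
    [/\ injective comp,
        forall P, irreducible_component I P <-> exists v, comp v = P
      & forall v w, v != w -> (e v w <-> meet_in_codim1 I (comp v) (comp w))].

(* Cech cohomology of the twisted ideal sheaf for the covering of P^n by the
   D(x_i). For sigma nonempty, the sections of the k-th twist over
   D(prod_(i in sigma) x_i) are the elements of degree k of the localization of
   I at prod_(i in sigma) x_i, viewed in the fraction field of S. *)
Definition ideal_sheaf_section (K : fieldType) (n : nat)
    (I : set {mpoly K[n.+1]}) (k : int) (sigma : {set 'I_n.+1})
    (x : {fraction {mpoly K[n.+1]}}) : Prop :=
  exists (N d : nat) (a : {mpoly K[n.+1]}),
    [/\ I a, a \is d.-homog, d%:Z = k + (N * #|sigma|)%N%:Z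
      & x = tofrac a / tofrac (\prod_(i in sigma) 'X_i ^+ N)].

Definition cech_cochain (K : fieldType) (n : nat)
    (I : set {mpoly K[n.+1]}) (k : int) (q : nat)
    (c : {set 'I_n.+1} -> {fraction {mpoly K[n.+1]}}) : Prop :=
  forall sigma : {set 'I_n.+1}, #|sigma| = q.+1 ->
    ideal_sheaf_section I k sigma (c sigma).

Definition cech_diff (K : fieldType) (n : nat)
    (c : {set 'I_n.+1} -> {fraction {mpoly K[n.+1]}})
    (tau : {set 'I_n.+1}) : {fraction {mpoly K[n.+1]}} :=
  \sum_(i in tau) (-1) ^+ #|[set j in tau | (j < i)%N]| * c (tau :\ i).

(* H^(q+1) of the k-th twist of the ideal sheaf vanishes. *)
Definition cohomology_vanishes (K : fieldType) (n : nat)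
    (I : set {mpoly K[n.+1]}) (k : int) (q : nat) : Prop :=
  forall c, cech_cochain I k q.+1 c ->
    (forall tau : {set 'I_n.+1}, #|tau| = q.+3 -> cech_diff c tau = 0) ->
    exists2 b, cech_cochain I k q b
      & forall sigma : {set 'I_n.+1}, #|sigma| = q.+2 ->
          c sigma = cech_diff b sigma.

Definition is_regular_at (K : fieldType) (n : nat)
    (I : set {mpoly K[n.+1]}) (k : int) : Prop :=
  forall q : nat, cohomology_vanishes I (k - q.+1%:Z) q.

Definition has_regularity (K : fieldType) (n : nat)
    (I : set {mpoly K[n.+1]}) (r : int) : Prop :=
  is_regular_at I r /\ forall k, is_regular_at I k -> r <= k.

(* Closed points, for K algebraically closed, as nonzero coordinate vectors *)
Definition peval (K : fieldType) (n : nat) (p : 'rV[K]_n.+1)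
    (f : {mpoly K[n.+1]}) : K := f.@[fun i => p 0 i].

Definition on_scheme (K : fieldType) (n : nat)
    (I : set {mpoly K[n.+1]}) (p : 'rV[K]_n.+1) : Prop :=
  p != 0 /\ forall f, I f -> peval p f = 0.

(* The local ring of P^n at p: fractions a / b of forms of the same degree
   with b(p) <> 0. *)
Definition in_local_ring (K : fieldType) (n : nat) (p : 'rV[K]_n.+1) :
    {pred {fraction {mpoly K[n.+1]}}} :=
  fun x => `[< exists (d : nat) (a b : {mpoly K[n.+1]}),
    [/\ a \is d.-homog, b \is d.-homog, peval p b != 0
      & x = tofrac a / tofrac b] >].

Lemma in_local_ring_closed (K : fieldType) (n : nat) (p : 'rV[K]_n.+1) :
  subring_closed (in_local_ring p).
Proof.
have nz (b : {mpoly K[n.+1]}) : peval p b != 0 -> tofrac b != 0.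
  apply: contraNneq => /eqP; rewrite tofrac_eq0 => /eqP ->.
  by rewrite /peval meval0.
have pM (a b : {mpoly K[n.+1]}) :
  peval p a != 0 -> peval p b != 0 -> peval p (a * b) != 0.
  by move=> pa pb; rewrite /peval mevalM mulf_neq0.
split.
- apply/asboolP; exists 0%N, 1, 1; split; rewrite ?dhomog1 //.
    by rewrite /peval meval1 oner_eq0.
  by rewrite tofrac1 divr1.
- move=> x y /asboolP[d [a [b [ha hb pb ->]]]].
  move=> /asboolP[d' [a' [b' [ha' hb' pb' ->]]]].
  apply/asboolP; exists (d + d')%N, (a * b' - a' * b), (b * b'); split.
  + by apply: rpredB; last rewrite addnC; apply: dhomogM.
  + by rewrite dhomogM.
  + exact: pM.
  + by rewrite -mulNr addf_div ?nz // mulNr tofracB !tofracM.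
- move=> x y /asboolP[d [a [b [ha hb pb ->]]]].
  move=> /asboolP[d' [a' [b' [ha' hb' pb' ->]]]].
  apply/asboolP; exists (d + d')%N, (a * a'), (b * b').
  by split; rewrite ?dhomogM ?pM // !tofracM mulf_div.
Qed.

HB.instance Definition _ (K : fieldType) (n : nat) (p : 'rV[K]_n.+1) :=
  GRing.isSubringClosed.Build _ (in_local_ring p) (in_local_ring_closed p).

Definition local_ring (K : fieldType) (n : nat) (p : 'rV[K]_n.+1) : Type :=
  {x : {fraction {mpoly K[n.+1]}} | x \in in_local_ring p}.

HB.instance Definition _ (K : fieldType) (n : nat) (p : 'rV[K]_n.+1) :=
  SubChoice.on (local_ring p).
HB.instance Definition _ (K : fieldType) (n : nat) (p : 'rV[K]_n.+1) :=
  [SubChoice_isSubComNzRing of local_ring p by <:].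

(* Stalk at p of the ideal sheaf; the local ring of the scheme at p is the
   quotient of [local_ring p] by it. *)
Definition local_ideal (K : fieldType) (n : nat)
    (I : set {mpoly K[n.+1]}) (p : 'rV[K]_n.+1) : set (local_ring p) :=
  fun x => exists (d : nat) (a b : {mpoly K[n.+1]}),
    [/\ I a, a \is d.-homog, b \is d.-homog & peval p b != 0] /\
    val x = tofrac a / tofrac b.
Arguments local_ideal [K n] I p _.

Definition singular_point (K : fieldType) (n : nat)
    (I : set {mpoly K[n.+1]}) (p : 'rV[K]_n.+1) : Prop :=
  on_scheme I p /\ ~ regular_local (local_ideal I p).

Definition locally_complete_intersection (K : fieldType) (n : nat)
    (I : set {mpoly K[n.+1]}) : Prop :=
  forall p, on_scheme I p -> complete_intersection_ideal (local_ideal I p).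

Definition veronese (K : fieldType) (r : nat) (s t : K) : 'rV[K]_r.+1 :=
  \row_(i < r.+1) (s ^+ (r - i) * t ^+ i).

(* The row space of A is the smallest linear subspace containing the scheme's
   closed points. *)
Definition linear_span_is (K : fieldType) (n m : nat)
    (P : set {mpoly K[n.+1]}) (A : 'M[K]_(m, n.+1)) : Prop :=
  forall (l : nat) (U : 'M[K]_(l, n.+1)),
    (A <= U)%MS <-> (forall p, on_scheme P p -> (p <= U)%MS).

(* V(P) is a rational normal curve in its linear span: for a suitable basis of
   the span (the rows of A), giving homogeneous coordinates on it, V(P) is
   { (s^r : s^(r-1) t : ... : t^r) }. *)
Definition rational_normal_in_span (K : fieldType) (n : nat)
    (P : set {mpoly K[n.+1]}) : Prop :=
  exists (r : nat) (A : 'M[K]_(r.+1, n.+1)),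
    [/\ (0 < r)%N, row_free A, linear_span_is P A
      & forall p, on_scheme P p <-> exists s t c : K,
          [/\ (s, t) != (0, 0), c != 0 & p = c *: (veronese r s t *m A)]].

(* Main.v *)
Require Import Defs.
From HB Require Import structures.
From mathcomp Require Import all_boot all_order all_algebra.
From mathcomp Require Import mpoly.
From mathcomp Require Import boolp classical_sets.
From mathcomp Require Import zify ring.

Set Implicit Arguments.
Unset Strict Implicit.
Unset Printing Implicit Defensive.

Import Order.TTheory GRing.Theory Num.Theory.
Local Open Scope ring_scope.

(** Put a variable Y_v on each vertex and X_x on each edge, and choose distinct
    scalars a_x. With p_v := prod_(x at v) (t - a_x), the component of v is the
    rational normal curve, of degree deg v, parametrized by
      Y_v |-> p_v,   X_x |-> p_v / (t - a_x) for x at v,   0 otherwise;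
    at t = a_x it passes through the coordinate point of X_x, which is where it
    meets the component of the other end of x.

    Forms of degree k restrict onto all polynomials of degree <= k deg v on a
    component, and families of forms agreeing at the nodes glue to a form on the
    curve. Hence the Hilbert function grows linearly, which bounds all chains of
    primes, and (sum_x X_x, sum_v Y_v) restricts to (p_v', p_v) on the components,
    which yields a regular sequence at every maximal ideal. For the regularity,
    Cech cochains of S are contracted one Laurent monomial at a time; on the curve
    the intersections of two or more charts lie in single components, where
    cochains are polynomials in t and 1 / p_v, and only principal parts at the
    nodes and gluing remain.

    At a point with Y_v <> 0 the relations
      ((a_x - a_x') X_x + Y_v) X_x' = Y_v X_x,   Y_v X_i = 0 (i not at v)
    solve for all variables except Y_v and X_x, so the curve is smooth there. At
    the node X_x joining v and w they solve for all variables except X_x, Y_v, Y_w,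
    and one more equation, Y_v Y_w = 0, remains. *)

(** * Ideals and polynomials *)

(** The polynomials p_v and p_v / (t - a_x) form a basis of those of degree at most deg v, so a
    component spans a coordinate subspace and has its nodes at coordinate points. As the graph is
    simple, the subspaces of two components share at most the point of a common edge. Hence a form
    on one component, extended by ignoring the other variables, is felt on another component only
    through its value at that node. This makes gluing explicit, and with it projective normality.

    The bound 3 comes from H^1 of O(1) on the curve: twisting O(deg v) on the projective line down
    by the deg v nodes of v leaves O, which still has no H^1.

    Dimension and depth range over arbitrary chains and sequences. One count handles both: along
    three steps, each given by a non-zero-divisor, the monomials in the three elements would be
    independent in too large a number. In the local rings, the equations solved so far generate a
    prime ideal, which makes the next one a non-zero-divisor. *)

Section Ideals.

Context {R : comNzRingType}.
Implicit Types (I J P : set R) (s : seq R).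

Lemma ideal0 J : is_ideal J -> J 0. Proof. by case. Qed.
Lemma idealD J a b : is_ideal J -> J a -> J b -> J (a + b).
Proof. by case=> _ + _; apply. Qed.
Lemma idealMl J r a : is_ideal J -> J a -> J (r * a).
Proof. by case=> _ _; apply. Qed.
Lemma idealMr J r a : is_ideal J -> J a -> J (a * r).
Proof. by rewrite mulrC; apply: idealMl. Qed.
Lemma idealN J a : is_ideal J -> J a -> J (- a).
Proof. by move=> hJ Ja; rewrite -mulN1r; apply: idealMl. Qed.
Lemma idealB J a b : is_ideal J -> J a -> J b -> J (a - b).
Proof. by move=> hJ Ja Jb; apply: idealD => //; apply: idealN. Qed.
Lemma ideal_sum J (A : Type) (r : seq A) (Q : pred A) (F : A -> R) :
  is_ideal J -> (forall i, Q i -> J (F i)) -> J (\sum_(i <- r | Q i) F i).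
Proof.
by move=> hJ hF; apply: big_ind => //; [exact: ideal0 | move=> *; exact: idealD].
Qed.

Lemma prime_ideal P : is_prime P -> is_ideal P. Proof. by case. Qed.

Lemma prime_prod P (A : finType) (F : A -> R) :
  is_prime P -> P (\prod_i F i) -> exists i, P (F i).
Proof.
move=> hP; have [_ P1 PM] := hP.
suff H (r : seq A) : P (\prod_(i <- r) F i) -> exists i, P (F i) by apply: H.
elim: r => [|i r IH]; first by rewrite big_nil.
by rewrite big_cons => /PM[|//]; exists i.
Qed.

Lemma prime_exp P a k : is_prime P -> P (a ^+ k) -> P a.
Proof.
move=> [_ P1 PM]; elim: k => [|k IH]; first by rewrite expr0.
by rewrite exprS => /PM[].
Qed.

Lemma ideal_gen_ideal (G : set R) : is_ideal (ideal_gen G).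
Proof.
split=> [J [hJ _]|a b Ga Gb J hJ|r a Ga J hJ]; first exact: ideal0.
  by apply: idealD; [case: hJ | exact: Ga | exact: Gb].
by apply: idealMl; [case: hJ | exact: Ga].
Qed.

Lemma ideal_gen_sub (G : set R) a : G a -> ideal_gen G a.
Proof. by move=> Ga J [_]; apply. Qed.

Lemma ideal_gen_min (G J : set R) : is_ideal J -> (G `<=` J)%classic ->
  (ideal_gen G `<=` J)%classic.
Proof. by move=> hJ sGJ a; apply. Qed.

Lemma ideal_adjoin_ideal J s : is_ideal (ideal_adjoin J s).
Proof. exact: ideal_gen_ideal. Qed.

Lemma ideal_adjoin_sub J s a : J a -> ideal_adjoin J s a.
Proof. by move=> Ja; apply: ideal_gen_sub; left. Qed.

Lemma ideal_adjoin_mem J s a : a \in s -> ideal_adjoin J s a.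
Proof. by move=> sa; apply: ideal_gen_sub; right. Qed.

Lemma ideal_adjoin_min J s I : is_ideal I -> (J `<=` I)%classic ->
  (forall a, a \in s -> I a) -> (ideal_adjoin J s `<=` I)%classic.
Proof. by move=> hI sJI ssI; apply: ideal_gen_min => // a [/sJI|/ssI]. Qed.

Lemma ideal_adjoin_nil J : is_ideal J -> ideal_adjoin J [::] = J.
Proof.
move=> hJ; apply/seteqP; split; first exact: ideal_adjoin_min.
by move=> a; apply: ideal_adjoin_sub.
Qed.

Lemma ideal_adjoin_rcons J s x a :
  ideal_adjoin J (rcons s x) a <-> exists u, ideal_adjoin J s (a - u * x).
Proof.
have hI := ideal_adjoin_ideal J s.
split; last first.
  move=> [u hu]; rewrite -(subrK (u * x) a).
  apply: (idealD (ideal_adjoin_ideal _ _)).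
  - apply: ideal_adjoin_min hu; [exact: ideal_adjoin_ideal| |].
      by move=> b; apply: ideal_adjoin_sub.
    by move=> b bs; apply: ideal_adjoin_mem; rewrite mem_rcons inE bs orbT.
  have [_ _ hM] := ideal_adjoin_ideal J (rcons s x).
  by apply: hM; apply: ideal_adjoin_mem; rewrite mem_rcons inE eqxx.
apply: (ideal_adjoin_min (I := fun a => exists u, ideal_adjoin J s (a - u * x))).
- split.
  + by exists 0; rewrite mul0r subrr; apply: ideal0.
  + move=> b c [u hu] [v hv]; exists (u + v); rewrite mulrDl opprD addrACA.
    exact: (idealD hI).
  + by move=> r b [u hu]; exists (r * u); rewrite -mulrA -mulrBr; case: hI => _ _; apply.
- by move=> b Jb; exists 0; rewrite mul0r subr0; apply: ideal_adjoin_sub.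
- move=> b; rewrite mem_rcons inE => /orP[/eqP->|sb].
    by exists 1; rewrite mul1r subrr; apply: ideal0.
  by exists 0; rewrite mul0r subr0; apply: ideal_adjoin_mem.
Qed.

Lemma ideal_add_ideal I J : is_ideal (ideal_add I J).
Proof. exact: ideal_gen_ideal. Qed.

End Ideals.

Lemma kernel_ideal (R S : comNzRingType) (h : {rmorphism R -> S}) :
  is_ideal (fun a => h a = 0).
Proof.
split; first exact: rmorph0; first by move=> a b ha hb; rewrite rmorphD ha hb addr0.
by move=> r a ha; rewrite rmorphM ha mulr0.
Qed.

Lemma kernel_prime (R : comNzRingType) (S : idomainType) (h : {rmorphism R -> S}) :
  is_prime (fun a => h a = 0).
Proof.
split; first exact: kernel_ideal.
  by rewrite rmorph1 => /eqP; rewrite oner_eq0.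
by move=> a b; rewrite rmorphM => /eqP; rewrite mulf_eq0 => /orP[]/eqP; [left|right].
Qed.

Lemma is_max_uniq (Q : nat -> Prop) d d' : is_max Q d -> is_max Q d' -> d = d'.
Proof.
by move=> [Qd hd] [Qd' hd']; apply/eqP; rewrite eqn_leq hd // hd'.
Qed.

(** * Homomorphisms out of polynomial rings, and homogeneous parts *)

Section MPolyHom.

Lemma mpoly_ring_ind (R : comNzRingType) n (Q : {mpoly R[n]} -> Prop) :
  (forall c, Q c%:MP) -> (forall i, Q 'X_i) ->
  (forall f g, Q f -> Q g -> Q (f + g)) ->
  (forall f g, Q f -> Q g -> Q (f * g)) -> forall f, Q f.
Proof.
move=> QC QX QD QM f; rewrite (mpolyE f).
apply: big_ind => //; first by rewrite -mpolyC0; apply: QC.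
move=> m _; rewrite -mul_mpolyC; apply: (QM _ _) => //.
rewrite mpolyXE_id; apply: big_ind => [||i _]; first by rewrite -mpolyC1; apply: QC.
  exact: QM. elim: (m i) => [|k IH]; first by rewrite expr0 -mpolyC1; apply: QC.
by rewrite exprS; apply: QM.
Qed.

Lemma mpoly_hom_ext (R S : comNzRingType) n (h1 h2 : {rmorphism {mpoly R[n]} -> S}) :
  (forall c, h1 c%:MP = h2 c%:MP) -> (forall i, h1 'X_i = h2 'X_i) -> h1 =1 h2.
Proof.
move=> hC hX; elim/mpoly_ring_ind => // f g hf hg; first by rewrite !rmorphD hf hg.
by rewrite !rmorphM hf hg.
Qed.

Lemma mmapXU n (R S : comNzRingType) (f : {rmorphism R -> S}) (h : 'I_n -> S) i :
  mmap f h 'X_i = h i.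
Proof. by rewrite mmapX mmap1U. Qed.

Lemma mmap_hom n (R S T : comNzRingType) (f : {rmorphism R -> S}) (h : 'I_n -> S)
    (g : {rmorphism S -> T}) p :
  g (mmap f h p) = mmap (g \o f) (g \o h) p.
Proof.
apply: (mpoly_hom_ext (h1 := g \o mmap f h) (h2 := mmap (g \o f) (g \o h))).
  by move=> c; rewrite /= !mmapC.
by move=> i; rewrite /= !mmapXU.
Qed.

Lemma mmap_ext n (R S : comNzRingType) (f f' : R -> S) (h h' : 'I_n -> S) p :
  f =1 f' -> h =1 h' -> mmap f h p = mmap f' h' p.
Proof.
by move=> ef eh; apply: eq_bigr => m _; rewrite ef; congr (_ * _); apply: eq_bigr => i _;
  rewrite eh.
Qed.

Lemma mmap_homog_scale n (R S : comNzRingType) (f : {rmorphism R -> S})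
    (h : 'I_n -> S) c k p :
  p \is k.-homog -> mmap f (fun i => c * h i) p = c ^+ k * mmap f h p.
Proof.
move=> hp; rewrite /mmap big_distrr /= [LHS]big_seq [RHS]big_seq.
apply: eq_bigr => m mp; rewrite mulrCA; congr (_ * _).
rewrite /mmap1 (eq_bigr (fun i => c ^+ m i * h i ^+ m i)); last first.
  by move=> i _; rewrite exprMn.
rewrite big_split /=; congr (_ * _).
by rewrite -(dhomog_mf hp mp) /= mdegE prodrXr.
Qed.

(** With a degree predicate this is [pihomog]; in the Cech complex the predicate singles out the
    monomials to be contracted with a given variable. *)
Definition mproj (R : nzRingType) n (P : pred 'X_{1..n}) (f : {mpoly R[n]}) :=
  \sum_(m <- msupp f | P m) f@_m *: 'X_[m].

Lemma mcoeff_mproj (R : nzRingType) n (P : pred 'X_{1..n}) (f : {mpoly R[n]}) m :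
  (mproj P f)@_m = if P m then f@_m else 0.
Proof.
rewrite /mproj raddf_sum /=.
have -> : (\sum_(j <- msupp f | P j) (f@_j *: 'X_[j])@_m) =
          \sum_(j <- msupp f) (if P m && (j == m) then f@_m else 0).
  rewrite big_mkcond; apply: eq_bigr => j _.
  case: (eqVneq j m) => [->|ne].
    by rewrite andbT; case: ifP; rewrite ?mcoeffZ ?mcoeffX ?eqxx ?mulr1.
  by rewrite andbF; case: ifP => //; rewrite mcoeffZ mcoeffX (negbTE ne) mulr0.
case: (P m) => /=; last by rewrite big1.
case: (boolP (m \in msupp f)) => hm.
  rewrite (bigD1_seq m) ?msupp_uniq //= eqxx big1 ?addr0 // => j ne.
  by rewrite (negbTE ne).
by rewrite big1 ?(memN_msupp_eq0 hm) // => j _; case: ifP.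
Qed.

Lemma mproj_additive (R : nzRingType) n (P : pred 'X_{1..n}) :
  additive (@mproj R n P).
Proof.
move=> f g; apply/mpolyP => m; rewrite mcoeffB !mcoeff_mproj mcoeffB.
by case: (P m); rewrite ?subrr.
Qed.

HB.instance Definition _ (R : nzRingType) n (P : pred 'X_{1..n}) :=
  GRing.isAdditive.Build {mpoly R[n]} {mpoly R[n]} (mproj P) (mproj_additive P).

Lemma mcoeff_pihomog (R : nzRingType) n (f : {mpoly R[n]}) d m :
  (pihomog mdeg d f)@_m = if mdeg m == d then f@_m else 0.
Proof. by rewrite pihomogE -[LHS]/((mproj (fun m => mdeg m == d) f)@_m) mcoeff_mproj. Qed.

Lemma pihomogM_homog (R : nzRingType) n (f g : {mpoly R[n]}) c d :
  g \is c.-homog -> pihomog mdeg (d + c) (f * g) = pihomog mdeg d f * g.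
Proof.
move=> hg.
pose B := (maxn (msize f) d.+1)%N.
rewrite {1}(pihomog_partitionE (leq_maxl (msize f) d.+1) : f = _).
rewrite mulr_suml raddf_sum /=.
have dB : (d < B)%N by rewrite /B leq_max ltnSn orbT.
rewrite (bigD1 (Ordinal dB)) //= big1 ?addr0.
  by rewrite pihomog_dE // dhomogM // pihomogP.
move=> i ne.
have hi : pihomog mdeg i f * g \is (i + c).-homog by rewrite dhomogM // pihomogP.
apply: pihomog_ne0 hi.
by rewrite eqn_add2r; apply: contraNneq ne => E; apply/eqP/val_inj.
Qed.

Lemma dhomogXU (R : nzRingType) n (i : 'I_n) : ('X_i : {mpoly R[n]}) \is 1.-homog.
Proof. by rewrite dhomogX /= mdeg1. Qed.

Lemma dhomogM1 (R : nzRingType) n (f g : {mpoly R[n]}) k :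
  f \is k.-homog -> g \is 1.-homog -> f * g \is k.+1.-homog.
Proof. by rewrite -[k.+1]addn1; apply: dhomogM. Qed.

Lemma dhomog0_const (R : nzRingType) n (f : {mpoly R[n]}) :
  f \is 0.-homog -> f = (f@_0%MM)%:MP.
Proof.
move=> hf; apply: msize1_polyC; case: (eqVneq f 0) => [->|nz]; first by rewrite msize0.
by rewrite -(mlead_deg nz) (dhomog_mf hf) // mlead_supp.
Qed.

End MPolyHom.

(* The ideal of the cone over a point z with coordinates in an extension of K;
   the variable of {poly R} records the degree. *)
Section Cone.

Variables (K : fieldType) (R : idomainType) (iota : {rmorphism K -> R}).
Variables (n : nat) (z : 'I_n.+1 -> R).
Local Notation S := {mpoly K[n.+1]}.

Definition cone_map : S -> {poly R} := mmap (polyC \o iota) (fun i => z i *: 'X).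

HB.instance Definition _ := GRing.RMorphism.copy cone_map
  (mmap (polyC \o iota) (fun i => z i *: 'X)).

Definition cone_ideal (f : S) : Prop := cone_map f = 0.

Lemma coef_cone_map f k : (cone_map f)`_k = mmap iota z (pihomog mdeg k f).
Proof.
rewrite pihomogE raddf_sum [in LHS](mpolyE f) raddf_sum coef_sum /= big_mkcond /=.
rewrite [RHS]big_mkcond /=; apply: eq_bigr => m _.
have -> : cone_map (f@_m *: 'X_[m]) = mmap iota z (f@_m *: 'X_[m]) *: 'X^(mdeg m).
  rewrite /cone_map !mmapZ !mmapX /= mul_polyC -scalerA; congr (_ *: _).
  rewrite /mmap1 mdegE -prodrXr -scaler_prod.
  by apply: eq_bigr => i _; rewrite exprZn.
by rewrite coefZ coefXn eq_sym; case: eqP => _; rewrite ?mulr1 ?mulr0.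
Qed.

Lemma cone_idealP f :
  cone_ideal f <-> forall k, mmap iota z (pihomog mdeg k f) = 0.
Proof.
split=> [h k|h]; first by rewrite -coef_cone_map h coef0.
by apply/polyP => k; rewrite coef_cone_map h coef0.
Qed.

Lemma cone_ideal_homog f k : f \is k.-homog -> cone_ideal f <-> mmap iota z f = 0.
Proof.
move=> hf; rewrite cone_idealP; split=> [/(_ k)|h j]; first by rewrite pihomog_dE.
case: (eqVneq k j) => [<-|ne]; first by rewrite pihomog_dE.
by rewrite (pihomog_ne0 ne hf) rmorph0.
Qed.

Lemma cone_prime : is_prime cone_ideal.
Proof. exact: (kernel_prime cone_map). Qed.

Lemma cone_homogeneous : is_homogeneous cone_ideal.
Proof.
split=> [|f d /cone_idealP hf]; first by have [] := cone_prime.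
by apply/(cone_ideal_homog (pihomogP _ d f)); apply: hf.
Qed.

Lemma cone_relevant i : z i != 0 -> relevant_prime cone_ideal.
Proof.
move=> hz; split; [exact: cone_prime | exact: cone_homogeneous|exists i].
rewrite (cone_ideal_homog (dhomogXU _ i)) mmapXU.
by move/eqP; rewrite (negbTE hz).
Qed.

End Cone.

Lemma homogeneous_sub (K : fieldType) n (J P : set {mpoly K[n.+1]}) :
  is_homogeneous J -> is_ideal P ->
  (forall f d, f \is d.-homog -> J f -> P f) -> (J `<=` P)%classic.
Proof.
move=> [_ hJ] hP h f Jf; rewrite (pihomog_partitionE (leqnn (msize f))).
by apply: ideal_sum => // i _; apply: (h _ i); [exact: pihomogP | exact: hJ].
Qed.

(** * Growth of the Hilbert function as a bound on dimension and depth *)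

Section Growth.

Variables (K : fieldType) (n : nat).
Local Notation S := {mpoly K[n]}.
Implicit Types (J I : set S).

Definition indep J (A : finType) (u : A -> S) : Prop :=
  forall c : A -> K, J (\sum_i c i *: u i) -> forall i, c i = 0.

(** In a relation the terms with f ^ 0 lie in J', since the others are multiples of f, so their
    coefficients vanish. What remains is f times a shorter relation, and f cancels modulo J. *)
Lemma indep_step J J' (A : finType) (u : A -> S) (f : S) N :
  is_ideal J -> is_ideal J' -> (J `<=` J')%classic -> J' f ->
  (forall a, J (f * a) -> J a) -> indep J' u ->
  indep J (fun q : 'I_N * A => f ^+ q.1 * u q.2).
Proof.
move=> hJ hJ' sJ J'f nzd hu c.
have -> : \sum_i c i *: (f ^+ i.1 * u i.2) =
    \sum_(j < N) f ^+ j * \sum_i c (j, i) *: u i.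
  rewrite (eq_bigr (fun q => c (q.1, q.2) *: (f ^+ q.1 * u q.2))); last by case.
  rewrite -(pair_bigA _ (fun j i => c (j, i) *: (f ^+ j * u i))) /=.
  by apply: eq_bigr => j _; rewrite mulr_sumr; apply: eq_bigr => i _; rewrite scalerAr.
move=> h [j i]; move: j i.
elim: N c h => [|N IH] c h; first by case.
move: h; rewrite big_ord_recl expr0 mul1r.
set F0 := \sum_i c (ord0, i) *: u i.
set T := \sum_(_ < N) _.
have ET : T = f * \sum_(j < N) f ^+ j * \sum_i c (lift ord0 j, i) *: u i.
  by rewrite mulr_sumr; apply: eq_bigr => j _; rewrite exprS mulrA.
move=> h.
have h0 i : c (ord0, i) = 0.
  apply: (hu (fun i => c (ord0, i))); rewrite -/F0 -(addrK T F0).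
  apply: idealB => //; first exact: sJ.
  by rewrite ET; apply: idealMr.
have F00 : F0 = 0 by rewrite /F0 big1 // => i _; rewrite h0 scale0r.
move: h; rewrite F00 add0r ET => /nzd h.
have {}IH := IH (fun q => c (lift ord0 q.1, q.2)) h.
by move=> j i; case: (unliftP ord0 j) => [j'|] ->; [exact: (IH j' i) | exact: h0].
Qed.

(** The polynomials of degree at most B span a space of dimension O(B^2) modulo I, as for the affine
    cone over a curve. *)
Definition quadratic_growth I : Prop :=
  exists C : nat, forall (B : nat) (A : finType) (u : A -> S),
    (forall i, (msize (u i) <= B.+1)%N) -> indep I u -> (#|A| <= C * B.+1 ^ 2)%N.

Lemma msizeM_le1 (f g : S) a b :
  (msize f <= a.+1)%N -> (msize g <= b.+1)%N -> (msize (f * g) <= (a + b).+1)%N.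
Proof.
move=> hf hg; case: (eqVneq f 0) => [->|f0]; first by rewrite mul0r msize0.
case: (eqVneq g 0) => [->|g0]; first by rewrite mulr0 msize0.
rewrite msizeM //; have := leq_add hf hg; move: (mmeasure _ f) (mmeasure _ g); lia.
Qed.

Lemma msizeX_le1 (f : S) a k : (msize f <= a.+1)%N -> (msize (f ^+ k) <= (k * a).+1)%N.
Proof.
move=> hf; elim: k => [|k IH]; first by rewrite expr0 msize1.
by rewrite exprS mulSn; apply: msizeM_le1.
Qed.

(* Monomials in f 0, f 1, f 2 of bounded degree are linearly independent modulo I,
   and there are too many of them. *)
Lemma no_chain3 I (J : nat -> set S) (f : nat -> S) :
  quadratic_growth I -> (I `<=` J 0)%classic ->
  (forall i, (i <= 3)%N -> is_ideal (J i)) ->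
  (forall i, (i < 3)%N -> (J i `<=` J i.+1)%classic) ->
  (forall i, (i < 3)%N -> J i.+1 (f i)) ->
  (forall i a, (i < 3)%N -> J i (f i * a) -> J i a) ->
  J 3 1.
Proof.
move=> [C hC] sI hJ sJ Jf nzd; apply: contrapT => J31.
pose c := (maxn (msize (f 0)) (maxn (msize (f 1)) (msize (f 2)))).+1.
have fc i : (i < 3)%N -> (msize (f i) <= c.+1)%N.
  by case: i => [|[|[|//]]] _; rewrite /c -ltnS !ltnS !leqW // !leq_max leqnn ?orbT.
(* The N^3 products have degree at most 3 N c, so independence would give N^3 <= C (3 N c + 1)^2 <=
   16 C c^2 N^2. *)
pose N := (16 * C * c ^ 2).+1.
have i3 : indep (J 3) (fun _ : unit => 1).
  move=> d; rewrite (bigD1 tt) //= big1; last by case.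
  rewrite addr0 => h []; apply/eqP; apply: contrapT => /negP nz; apply: J31.
  rewrite -(scale1r (1 : S)) -(mulVf nz) -scalerA -mul_mpolyC.
  by apply: idealMl h; exact: hJ.
have i2 := indep_step (N := N) (hJ 2%N isT) (hJ 3%N isT) (sJ 2%N isT) (Jf 2%N isT)
  (fun a => nzd 2%N a isT) i3.
have i1 := indep_step (N := N) (hJ 1%N isT) (hJ 2%N isT) (sJ 1%N isT) (Jf 1%N isT)
  (fun a => nzd 1%N a isT) i2.
have i0 := indep_step (N := N) (hJ 0%N isT) (hJ 1%N isT) (sJ 0%N isT) (Jf 0%N isT)
  (fun a => nzd 0%N a isT) i1.
have iI : indep I (fun q : 'I_N * ('I_N * ('I_N * unit)) =>
    f 0 ^+ q.1 * (f 1 ^+ q.2.1 * (f 2 ^+ q.2.2.1 * 1))).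
  by move=> d hd; apply: i0; apply: sI.
have := hC (N * c + (N * c + N * c))%N _ _ _ iI.
have bX i (j : 'I_N) : (i < 3)%N -> (msize (f i ^+ j) <= (N * c).+1)%N.
  move=> i3'; apply: leq_trans (msizeX_le1 _ (fc i i3')) _.
  by rewrite ltnS leq_mul2r ltnW ?orbT.
move=> /(_ _)/wrap[]; first by move=> [q1 [q2 [q3 []]]] /=; rewrite mulr1 !msizeM_le1 // bX.
rewrite !card_prod card_unit card_ord muln1.
rewrite leqNgt => /negP; apply.
have Nc : (0 < N * c)%N by rewrite muln_gt0.
have := leq_pmul2l (m := N * N) (n1 := N) (n2 := (16 * C * c ^ 2).+1).
move: (Nc); rewrite /N; nia.
Qed.

End Growth.

(** * The curve attached to a graph *)

(* The variables are indexed by the vertices and the edges of a graph, via [idx];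
   [pos] places the edges at distinct points of the affine line. *)
Record incidence (K : closedFieldType) (n : nat) := Incidence {
  vert : finType;
  edge : finType;
  inc : edge -> vert -> bool;
  pos : edge -> K;
  idx : vert + edge -> 'I_n.+1;
  kind : 'I_n.+1 -> vert + edge;
  idxK : cancel idx kind;
  kindK : cancel kind idx;
  pos_inj : injective pos;
  inc_ends : forall x, exists v w,
    [/\ v != w, inc x v, inc x w & forall u, inc x u -> u = v \/ u = w];
  inc_simple : forall x x' v w, v != w ->
    inc x v -> inc x w -> inc x' v -> inc x' w -> x = x';
  inc_pos : forall v, exists x, inc x v;
  inc_conn : forall (T : Type) (c : vert -> T),
    (forall x v w, inc x v -> inc x w -> c v = c w) -> forall v w, c v = c w
}.

Section Curve.

Context {K : closedFieldType} {n : nat} (G : incidence K n).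
Local Notation S := {mpoly K[n.+1]}.
Local Notation V := (vert G).
Local Notation E := (edge G).
Implicit Types (v w : V) (x : E) (f g : S).

Definition Y v : 'I_n.+1 := idx (inl v : V + E).
Definition X x : 'I_n.+1 := idx (inr x : V + E).

Lemma Y_inj : injective Y.
Proof. by move=> v w /(can_inj (@idxK _ _ G)) []. Qed.
Lemma X_inj : injective X.
Proof. by move=> v w /(can_inj (@idxK _ _ G)) []. Qed.
Lemma XY x v : (X x == Y v) = false.
Proof. by apply/eqP => /(can_inj (@idxK _ _ G)). Qed.

Lemma var_cases i : (exists v, i = Y v) \/ (exists x, i = X x).
Proof.
by rewrite -(@kindK _ _ G i); case: (kind G i) => [v|x]; [left; exists v | right; exists x].
Qed.

Definition deg v : nat := #|[pred x | inc x v]|.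

Definition py v : {poly K} := \prod_(x | inc x v) ('X - (pos x)%:P).
Definition px v x : {poly K} :=
  \prod_(x' | inc x' v && (x' != x)) ('X - (pos x')%:P).

(** The coordinates of the linear span of the component of v: the others vanish on it. *)
Definition star v (i : 'I_n.+1) : bool :=
  match kind G i with inl w => w == v | inr x => inc x v end.

Definition zeta v (i : 'I_n.+1) : {poly K} :=
  match kind G i with
  | inl w => if w == v then py v else 0
  | inr x => if inc x v then px v x else 0
  end.

Definition phi v : S -> {poly K} := mmap polyC (zeta v).
HB.instance Definition _ v := GRing.RMorphism.copy (phi v) (mmap polyC (zeta v)).

(** The kernel of [phi v] itself forgets degrees and is not homogeneous. On forms the two agree, by
    [comp_idealP]. *)
Definition comp_ideal v : set S := cone_ideal polyC (zeta v).

Definition curve_ideal : set S := fun f => forall v, comp_ideal v f.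

Lemma starY v w : star v (Y w) = (w == v).
Proof. by rewrite /star idxK. Qed.
Lemma starX v x : star v (X x) = inc x v.
Proof. by rewrite /star idxK. Qed.
Lemma zetaY v : zeta v (Y v) = py v.
Proof. by rewrite /zeta idxK eqxx. Qed.
Lemma zetaX v x : inc x v -> zeta v (X x) = px v x.
Proof. by rewrite /zeta idxK => ->. Qed.
Lemma zeta0 v i : ~~ star v i -> zeta v i = 0.
Proof. by rewrite /zeta /star; case: (kind G i) => [w|x] /negbTE ->. Qed.

Lemma deg_gt0 v : (0 < deg v)%N.
Proof. by have [x hx] := inc_pos v; apply/card_gt0P; exists x. Qed.

Lemma py_px v x : inc x v -> py v = ('X - (pos x)%:P) * px v x.
Proof. by move=> hx; rewrite /py (bigD1 x). Qed.

Lemma py_monic v : py v \is monic.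
Proof. by rewrite monic_prod // => x _; exact: monicXsubC. Qed.
Lemma px_monic v x : px v x \is monic.
Proof. by rewrite monic_prod // => x' _; exact: monicXsubC. Qed.
Lemma py_neq0 v : py v != 0. Proof. exact/monic_neq0/py_monic. Qed.
Lemma px_neq0 v x : px v x != 0. Proof. exact/monic_neq0/px_monic. Qed.

Lemma size_py v : size (py v) = (deg v).+1.
Proof.
have -> : py v = \prod_(x <- enum [pred x | inc x v]) ('X - (pos x)%:P).
  by rewrite big_enum.
by rewrite size_prod_XsubC -cardE.
Qed.

Lemma size_px v x : inc x v -> size (px v x) = deg v.
Proof.
move=> hx; have := size_py v; rewrite (py_px hx) size_Mmonic ?px_monic ?polyXsubC_eq0 //.
by rewrite size_XsubC /= => -[].
Qed.

Lemma py_root v x : inc x v -> (py v).[pos x] = 0.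
Proof. by move=> hx; rewrite (py_px hx) hornerM !hornerE subrr mul0r. Qed.

Lemma px_root v x x' : inc x' v -> x' != x -> (px v x).[pos x'] = 0.
Proof.
by move=> h ne; rewrite /px (bigD1 x') ?h //= hornerM !hornerE subrr mul0r.
Qed.

Lemma px_node v x : (px v x).[pos x] != 0.
Proof.
rewrite /px horner_prod; apply/prodf_neq0 => x' /andP[_ ne].
by rewrite !hornerE subr_eq0; apply: contra ne => /eqP /pos_inj ->.
Qed.

Lemma zeta_neq0 v i : star v i -> zeta v i != 0.
Proof.
rewrite /star /zeta; case: (kind G i) => [w|x] ->; [exact: py_neq0 | exact: px_neq0].
Qed.

Lemma size_zeta v i : (size (zeta v i) <= (deg v).+1)%N.
Proof.
rewrite /zeta; case: (kind G i) => [w|x]; case: ifP => h; rewrite ?size_poly0 //.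
  by rewrite size_py.
by rewrite size_px.
Qed.

(** Only [py v] has full degree, so at t = infinity the component passes through the coordinate
    point of [Y v]. *)
Lemma coef_zeta v i : (zeta v i)`_(deg v) = (i == Y v)%:R.
Proof.
have [[w ->]|[x ->]] := var_cases i; last first.
  rewrite XY; case: (boolP (inc x v)) => h; last by rewrite zeta0 ?starX // coef0.
  by rewrite zetaX // nth_default // size_px.
rewrite (inj_eq Y_inj); case: (eqVneq w v) => [->|h].
  by rewrite zetaY; have /monicP := py_monic v; rewrite /lead_coef size_py.
by rewrite zeta0 ?starY // coef0.
Qed.

Definition node x (i : 'I_n.+1) : K := (i == X x)%:R.

Lemma zeta_node v x i : inc x v -> (zeta v i).[pos x] = (px v x).[pos x] * node x i.
Proof.
rewrite /node; move=> hx; have [[w ->]|[x' ->]] := var_cases i.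
  rewrite eq_sym XY mulr0; case: (eqVneq w v) => [->|h].
    by rewrite zetaY py_root.
  by rewrite zeta0 ?starY // horner0.
rewrite (inj_eq X_inj); case: (eqVneq x' x) => [->|ne].
  by rewrite zetaX // mulr1.
rewrite mulr0; case: (boolP (inc x' v)) => h; last by rewrite zeta0 ?starX // horner0.
by rewrite zetaX // px_root // eq_sym.
Qed.

Lemma horner_phi v f t : (phi v f).[t] = f.@[fun i => (zeta v i).[t]].
Proof.
rewrite -[LHS]/(horner_eval t (phi v f)) /phi mmap_hom; apply: mmap_ext => // c.
by rewrite /= /horner_eval hornerC.
Qed.

Lemma phi_node v x f k : inc x v -> f \is k.-homog ->
  (phi v f).[pos x] = (px v x).[pos x] ^+ k * f.@[node x].
Proof.
move=> hx hf; rewrite horner_phi -(mmap_homog_scale idfun (node x) _ hf).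
by apply: mmap_ext => // i; apply: zeta_node.
Qed.

Lemma coefM_top (p q : {poly K}) a b : (size p <= a.+1)%N -> (size q <= b.+1)%N ->
  (size (p * q)%R <= (a + b).+1)%N /\ (p * q)`_(a + b) = p`_a * q`_b.
Proof.
move=> hp hq; split.
  by apply: leq_trans (size_polyMleq _ _) _; move: (size p) (size q) hp hq; lia.
have ha : (a < (a + b).+1)%N by rewrite ltnS leq_addr.
rewrite coefM (bigD1 (Ordinal ha)) //= addKn big1 ?addr0 // => i ne.
have {}ne : (i : nat) != a by apply: contra ne => /eqP e; apply/eqP/val_inj.
case: (ltngtP i a) => h; last by rewrite h eqxx in ne.
  by rewrite [q`_ _]nth_default ?mulr0 //; apply: leq_trans hq _; lia.
by rewrite [p`_ _]nth_default ?mul0r //; apply: leq_trans hp _.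
Qed.

(** The coefficient of t^(k deg v) is the value of f at the point t = infinity. *)
Lemma phi_top v f k : f \is k.-homog ->
  (size (phi v f) <= (k * deg v).+1)%N /\
  (phi v f)`_(k * deg v) = f.@[fun i => (i == Y v)%:R].
Proof.
move=> hf.
have mono (m : 'X_{1..n.+1}) : mdeg m = k ->
    (size (mmap1 (zeta v) m) <= (k * deg v).+1)%N /\
    (mmap1 (zeta v) m)`_(k * deg v) = mmap1 (fun i => (i == Y v)%:R : K) m.
  move=> <-; rewrite mdegE /mmap1 big_distrl /=.
  have powers i : (size (zeta v i ^+ m i) <= (m i * deg v).+1)%N /\
      (zeta v i ^+ m i)`_(m i * deg v) = ((i == Y v)%:R : K) ^+ m i.
    elim: (m i) => [|j [IH1 IH2]]; first by rewrite !expr0 size_poly1 mul0n coef1.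
    have [h1 h2] := coefM_top (size_zeta v i) IH1.
    by rewrite !exprS mulSn; split; rewrite ?h2 ?IH2 ?coef_zeta.
  elim/big_rec3: _ => [|i a p b _ [IH1 IH2]]; first by rewrite size_poly1 coef1.
  have [h1 h2] := powers i; have [h3 h4] := coefM_top h1 IH1.
  by split=> //; rewrite h4 h2 IH2.
rewrite /phi /meval /mmap; split.
  apply: (leq_trans (size_sum _ _ _)); apply/bigmax_leqP_seq => m mf _.
  rewrite mul_polyC; apply: (leq_trans (size_scale_leq _ _)).
  by have [] := mono m (dhomog_mf hf mf).
rewrite coef_sum [LHS]big_seq [RHS]big_seq; apply: eq_bigr => m mf.
by rewrite coefCM; have [_ ->] := mono m (dhomog_mf hf mf).
Qed.

Lemma size_phi v f k : f \is k.-homog -> (size (phi v f) <= (k * deg v).+1)%N.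
Proof. by move=> /(phi_top v) []. Qed.

(** Lagrange interpolation at the nodes of v: both sides have degree below deg v and agree at deg v
    distinct points. *)
Lemma lagrange v (c : {poly K}) : (size c <= deg v)%N ->
  c = \sum_(x | inc x v) (c.[pos x] / (px v x).[pos x]) *: px v x.
Proof.
move=> hc; apply/eqP; rewrite -subr_eq0; apply/eqP.
set d := _ - _.
pose rs := [seq pos x | x <- enum [pred x | inc x v]].
apply: (@roots_geq_poly_eq0 _ d rs).
- apply/allP => _ /mapP[x hx ->]; rewrite mem_enum inE in hx.
  rewrite /root /d hornerD hornerN horner_sum (bigD1 x) //= big1.
    by rewrite addr0 hornerZ divfK ?px_node // subrr.
  move=> x' /andP[_ ne]; have r0 : (px v x').[pos x] = 0.
    by apply: px_root => //; rewrite eq_sym.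
  by rewrite hornerZ r0 mulr0.
- by rewrite map_inj_uniq ?enum_uniq //; apply: pos_inj.
- rewrite size_map -cardE -/(deg v).
  apply: leq_trans (size_polyD _ _) _; rewrite geq_max hc size_polyN.
  apply: (leq_trans (size_sum _ _ _)); apply/bigmax_leqP => x hx.
  by apply: (leq_trans (size_scale_leq _ _)); rewrite size_px.
Qed.

(** Division by [py v] lowers the degree by deg v: the quotient is lifted by induction and
    multiplied by Y v. The remainder is interpolated by the X x, times a form that restricts to
    1. *)
Lemma phi_surj v k (c : {poly K}) : (size c <= (k * deg v).+1)%N ->
  exists2 f, f \is k.-homog & phi v f = c.
Proof.
elim: k c => [|k IH] c hc.
  exists (c`_0)%:MP; first by rewrite -[X in X \is _]mulr1 mul_mpolyC rpredZ ?dhomog1.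
  by rewrite /phi mmapC [RHS]size1_polyC.
have [g hg phig] : exists2 g, g \is k.-homog & phi v g = 1.
  by apply: IH; rewrite size_poly1.
have [f1 hf1 phif1] : exists2 f, f \is k.-homog & phi v f = c %/ py v.
  apply: IH; rewrite size_divp ?py_neq0 // size_py /=.
  by move: hc; rewrite mulSn; move: (size c); lia.
have hr : (size (c %% py v)%R <= deg v)%N by rewrite -ltnS -size_py ltn_modp py_neq0.
pose l : S := \sum_(x | inc x v)
  ((c %% py v).[pos x] / (px v x).[pos x]) *: 'X_(X x).
exists (f1 * 'X_(Y v) + g * l).
  rewrite rpredD // dhomogM1 ?dhomogXU //.
  by apply: rpred_sum => x _; rewrite rpredZ ?dhomogXU.
rewrite rmorphD !rmorphM /= phif1 phig mul1r /phi mmapXU zetaY.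
rewrite [RHS](divp_eq c (py v)); congr (_ + _).
rewrite [RHS](lagrange hr) raddf_sum; apply: eq_bigr => x hx /=.
by rewrite mmapZ mmapXU zetaX // mul_polyC.
Qed.

(** A form on the span of the component of v, extended along the coordinate projection. *)
Definition restrict v : S -> S :=
  mmap (@mpolyC n.+1 K) (fun i => if star v i then 'X_i else 0).
HB.instance Definition _ v := GRing.RMorphism.copy (restrict v)
  (mmap (@mpolyC n.+1 K) (fun i => if star v i then 'X_i else 0)).

Lemma mmap_homog (h : 'I_n.+1 -> S) f k :
  (forall i, h i \is 1.-homog) -> f \is k.-homog ->
  mmap (@mpolyC n.+1 K) h f \is k.-homog.
Proof.
move=> hh hf; rewrite /mmap big_seq; apply: rpred_sum => m mf.
rewrite mul_mpolyC rpredZ // -(dhomog_mf hf mf) /= mdegE /mmap1.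
elim/big_rec2: _ => [|i a p _ IH]; first exact: dhomog1.
by apply: dhomogM => //; have := dhomogMn (m i) (hh i); rewrite mul1n.
Qed.

Lemma restrict_homog v f k : f \is k.-homog -> restrict v f \is k.-homog.
Proof.
by apply: mmap_homog => i; case: ifP => _; rewrite ?dhomogXU ?rpred0.
Qed.

Lemma phi_restrict v w f :
  phi w (restrict v f) = mmap polyC (fun i => if star v i then zeta w i else 0) f.
Proof.
rewrite /restrict /phi (mmap_hom _ _ (mmap polyC (zeta w))); apply: mmap_ext => [c|i] /=.
  by rewrite mmapC.
by case: ifP => _; rewrite ?mmapXU ?rmorph0.
Qed.

Lemma phi_restrict_id v f : phi v (restrict v f) = phi v f.
Proof.
rewrite phi_restrict; apply: mmap_ext => // i.
by case: (boolP (star v i)) => // /zeta0 ->.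
Qed.

(** By simplicity the stars of v and w share at most one variable, X x for a common edge x, and only
    the power of that variable survives. The degree is positive because a constant survives every
    restriction. *)
Lemma phi_restrict_neq v w f k : v != w -> f \is k.+1.-homog ->
  phi w (restrict v f) =
  \sum_(x | inc x v && inc x w) f.@[node x] *: px w x ^+ k.+1.
Proof.
move=> ne hf; rewrite phi_restrict.
have no i : star v i -> star w i -> exists x, [/\ i = X x, inc x v & inc x w].
  have [[u ->]|[x ->]] := var_cases i; last by rewrite !starX; exists x.
  by rewrite !starY => /eqP ->; rewrite (negbTE ne).
have [x /andP[hv hw]|none] := pickP [pred x | inc x v && inc x w]; last first.
  rewrite big_pred0 // -[RHS](mul0r (mmap polyC (zeta w) f)).
  rewrite -[X in X * _](expr0n {poly K} k.+1) -mmap_homog_scale //; apply: mmap_ext => // i; rewrite mul0r.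
  case: ifP => // sv; case: (boolP (star w i)) => [sw|/zeta0 //].
  by have [x [_ h1 h2]] := no i sv sw; have /= := none x; rewrite h1 h2.
rewrite (big_pred1 x) => [|x' /=]; last first.
  apply/andP/eqP => [[h1 h2]|->//].
  by apply: (inc_simple ne).
have -> : f.@[node x] *: px w x ^+ k.+1 =
    px w x ^+ k.+1 * mmap polyC (fun i => (node x i)%:P) f.
  rewrite -mul_polyC mulrC; congr (_ * _).
  by rewrite /meval (mmap_hom _ _ polyC).
rewrite -mmap_homog_scale //; apply: mmap_ext => // i; rewrite /node.
case: (eqVneq i (X x)) => [->|nx]; first by rewrite starX hv zetaX // mulr1.
rewrite mulr0; case: ifP => // sv; case: (boolP (star w i)) => [sw|/zeta0 //].
have [x' [e h1 h2]] := no i sv sw.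
by case/eqP: nx; rewrite e (inc_simple ne h1 h2 hv hw).
Qed.

Lemma other_end x w : inc x w ->
  exists2 u, u != w & forall v, (v != w) && inc x v = (v == u).
Proof.
have [v1 [v2 [ne h1 h2 hu]]] := inc_ends x.
move=> /hu[->|->]; [exists v2|exists v1] => //; rewrite 1?eq_sym // => v.
  apply/andP/eqP => [[nv /hu[e|//]]|->]; last by rewrite eq_sym.
  by rewrite e eqxx in nv.
apply/andP/eqP => [[nv /hu[//|e]]|->//].
by rewrite e eqxx in nv.
Qed.

(* The sum of the restrictions overcounts each node once. *)
Lemma glue k (g : V -> S) : (forall v, g v \is k.-homog) ->
  (forall x v w, inc x v -> inc x w -> (g v).@[node x] = (g w).@[node x]) ->
  exists2 f, f \is k.-homog & forall v, phi v f = phi v (g v).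
Proof.
(* In degree 0 the forms are constants, and they agree because the graph is connected. *)
move=> hg hn; case: k hg => [|k] hg.
  have cst v := dhomog0_const (hg v).
  have same : forall v w, (g v)@_0%MM = (g w)@_0%MM.
    apply: (inc_conn (c := fun v => (g v)@_0%MM)) => x v w h1 h2.
    by have := hn x v w h1 h2; rewrite [g v]cst [g w]cst !mevalC -!cst.
  have [v0|noV] := pickP (fun _ : V => true).
    by move=> _; exists (g v0) => // v; rewrite [g v]cst [g v0]cst (same v v0).
  by exists 0; [exact: rpred0 | move=> v; have := noV v].
have end1 x : exists v, inc x v by have [v [w [_ h _ _]]] := inc_ends x; exists v.
pose c x := (g (xchoose (end1 x))).@[node x].
have cE x v : inc x v -> (g v).@[node x] = c x.
  by move=> h; apply: (hn x) => //; exact: (xchooseP (end1 x)).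
exists (\sum_v restrict v (g v) - \sum_x c x *: 'X_(X x) ^+ k.+1).
  apply: rpredB; first by apply: rpred_sum => v _; exact: restrict_homog.
  apply: rpred_sum => x _; rewrite rpredZ //.
  by have := dhomogMn k.+1 (dhomogXU K (X x)); rewrite mul1n.
move=> w; rewrite rmorphB !(rmorph_sum (phi w)) /= (bigD1 w) //= phi_restrict_id -addrA.
rewrite -[RHS]addr0; congr (_ + _); apply/eqP; rewrite subr_eq0; apply/eqP.
under eq_bigr => v ne do rewrite (phi_restrict_neq ne (hg v)).
rewrite (exchange_big_dep (fun x => inc x w)) /=; last by move=> v x _ /andP[].
rewrite [RHS](bigID (fun x => inc x w)) /= [X in _ = _ + X]big1 ?addr0; last first.
  by move=> x h; rewrite /phi mmapZ rmorphXn /= mmapXU zeta0 ?starX // expr0n mulr0.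
apply: eq_bigr => x hx; have [u ne hu] := other_end hx.
rewrite (big_pred1 u) => [|v]; last by rewrite hx andbT hu.
have hxu : inc x u by have := hu u; rewrite eqxx => /andP[].
by rewrite /phi mmapZ rmorphXn /= mmapXU zetaX // cE // mul_polyC.
Qed.

Lemma comp_idealP v f k : f \is k.-homog -> comp_ideal v f <-> phi v f = 0.
Proof. exact: cone_ideal_homog. Qed.

Lemma comp_prime v : is_prime (comp_ideal v).
Proof. exact: cone_prime. Qed.
Lemma comp_homog v : is_homogeneous (comp_ideal v).
Proof. exact: cone_homogeneous. Qed.

Lemma curve_is_ideal : is_ideal curve_ideal.
Proof.
split=> [v|f g hf hg v|r f hf v]; have hv := prime_ideal (comp_prime v).
- exact: ideal0.
- exact: (idealD hv).
- exact: (idealMl _ hv).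
Qed.

Lemma curve_sub v : (curve_ideal `<=` comp_ideal v)%classic.
Proof. by move=> f; apply. Qed.

Lemma curve_homog : is_homogeneous curve_ideal.
Proof.
split=> [|f d hf v]; first exact: curve_is_ideal.
by have [_ h] := comp_homog v; apply: h.
Qed.

Lemma curve_idealP f k : f \is k.-homog -> curve_ideal f <-> forall v, phi v f = 0.
Proof. by move=> hf; split=> h v; apply/(comp_idealP v hf); apply: h. Qed.

(** Otherwise, multiplying one element outside P from each component ideal gives an element of their
    intersection outside P. *)
Lemma prime_over_curve P : is_prime P -> (curve_ideal `<=` P)%classic ->
  exists v, (comp_ideal v `<=` P)%classic.
Proof.
move=> hP sI; apply: contrapT => none.
have out v : exists f, comp_ideal v f /\ ~ P f.
  apply: contrapT => h; apply: none; exists v => f hf; apply: contrapT => nf.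
  by apply: h; exists f.
have [F hF] := choice out.
have /(prime_prod hP)[v] : P (\prod_v F v).
  apply: sI => v; rewrite (bigD1 v) //=.
  by apply: (idealMr _ (prime_ideal (comp_prime v))); case: (hF v).
by case: (hF v).
Qed.

Lemma comp_idealX v i : comp_ideal v 'X_i <-> ~~ star v i.
Proof.
rewrite (comp_idealP v (dhomogXU _ i)) /phi mmapXU; split=> [h|/zeta0 //].
by apply/negP => /zeta_neq0; rewrite h eqxx.
Qed.

Lemma comp_relevant v : relevant_prime (comp_ideal v).
Proof. by apply: (@cone_relevant _ _ _ _ _ (Y v)); rewrite zetaY py_neq0. Qed.

(** Modulo the curve, a polynomial of degree at most B is determined by the coefficients of t^l in
    its part of degree k on each component, with k <= B and l <= k deg v. These are O(B^2) linear
    conditions. *)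
Lemma curve_growth : quadratic_growth curve_ideal.
Proof.
pose D := (\max_v deg v).+1.
exists (#|V| * D)%N => B A u hu hi; rewrite leqNgt; apply/negP => hA.
pose T : finType := (V * ('I_B.+1 * 'I_(B.+1 * D)))%type.
have hT : (#|T| < #|A|)%N.
  by apply: leq_ltn_trans hA; rewrite !card_prod !card_ord; lia.
pose M : 'M[K]_(#|A|, #|T|) := \matrix_(i < #|A|, j < #|T|)
  let q : T := enum_val j in
  ((cone_map polyC (zeta q.1) (u (enum_val i)))`_(q.2.1))`_(q.2.2).
have : kermx M != 0.
  by rewrite kermx_eq0 /row_free neq_ltn (leq_ltn_trans (rank_leq_col M) hT).
case/rowV0Pn => c /sub_kermxP cM c0.
case/eqP: c0; apply/rowP => i; rewrite mxE -(enum_valK i).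
apply: (hi (fun a => c 0 (enum_rank a))) => v.
have deg2 (f : S) k l : (msize f <= B.+1)%N -> ~~ ((k < B.+1) && (l < B.+1 * D))%N ->
    ((cone_map polyC (zeta v) f)`_k)`_l = 0.
  move=> hf h; rewrite coef_cone_map; case: (ltnP k B.+1) => hk; last first.
    rewrite (_ : pihomog mdeg k f = 0) ?rmorph0 ?coef0 //.
    apply/mpolyP => m; rewrite mcoeff_pihomog mcoeff0; case: eqP => // e.
    by apply/memN_msupp_eq0/msize_mdeg_ge; rewrite e (leq_trans hf).
  rewrite hk -leqNgt /= in h; apply: nth_default; apply: leq_trans h.
  apply: leq_trans (size_phi v (pihomogP _ k f)) _.
  have : (deg v < D)%N by rewrite ltnS (leq_bigmax v).
  by move: hk; nia.
have cmZ a f : cone_map polyC (zeta v) (a *: f) = a%:P *: cone_map polyC (zeta v) f.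
  by rewrite /cone_map mmapZ /= mul_polyC.
apply/polyP => k; apply/polyP => l; rewrite raddf_sum coef0 coef_sum coef0 coef_sum /=.
have [h|h] := boolP ((k < B.+1) && (l < B.+1 * D))%N; last first.
  by rewrite big1 // => a _; rewrite cmZ coefZ coefCM deg2 ?mulr0.
have [hk hl] := andP h.
have := congr1 (fun N : 'rV_ _ => N 0 (enum_rank (v, (Ordinal hk, Ordinal hl)) : 'I_#|T|)) cM.
rewrite !mxE => e0; rewrite -[RHS]e0 (reindex (@enum_val A A)) /=; last first.
  by exists enum_rank => a _; rewrite ?enum_valK ?enum_rankK.
by apply: eq_bigr => a _; rewrite !mxE enum_rankK /= cmZ coefZ coefCM enum_valK.
Qed.

End Curve.

(** * Maximal ideals and chains of primes *)

Section MaximalIdeals.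

Context {R : comNzRingType}.
Implicit Types (M N : set R).

Lemma maximal_inv M a : is_maximal M -> ~ M a -> exists m r, M m /\ 1 = m + r * a.
Proof.
move=> [hM M1 Mmax] Ma; apply: contrapT => none; apply: Ma.
rewrite -(Mmax (ideal_adjoin M [:: a])); first by apply: ideal_adjoin_mem; rewrite inE.
- exact: ideal_adjoin_ideal.
- move=> /(ideal_adjoin_rcons M [::])[u]; rewrite ideal_adjoin_nil // => hu.
  by apply: none; exists (1 - u * a), u; rewrite subrK.
- by move=> b; apply: ideal_adjoin_sub.
Qed.

Lemma maximal_prime M : is_maximal M -> is_prime M.
Proof.
move=> hM; have [iM M1 _] := hM; split=> // a b Mab; apply: contrapT => /not_orP[Ma Mb].
have [m [r [Mm e]]] := maximal_inv hM Ma.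
apply: Mb; rewrite -[b]mul1r e mulrDl -mulrA; apply: (idealD iM).
  exact: (idealMr _ iM).
exact: (idealMl _ iM).
Qed.

End MaximalIdeals.

(** It suffices that h be surjective modulo M: the quotient of R by the preimage is then the field S
    / M. *)
Lemma maximal_preim (R S : comNzRingType) (h : {rmorphism R -> S}) (M : set S) :
  is_maximal M -> (forall s, exists r, M (s - h r)) -> is_maximal (fun r => M (h r)).
Proof.
move=> hM surj; have [iM M1 _] := hM; split.
- split=> [|a b Ma Mb|r a Ma]; first by rewrite rmorph0; apply: ideal0.
    by rewrite rmorphD; apply: (idealD iM).
  by rewrite rmorphM; apply: (idealMl _ iM).
- by rewrite rmorph1.
- move=> N iN N1 sN; apply/seteqP; split=> // a Na; apply: contrapT => Ma.
  have [m [r [Mm e]]] := maximal_inv hM Ma.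
  have [r' hr'] := surj r.
  apply: N1; rewrite -(subrK (r' * a) 1); apply: (idealD iN); last exact: (idealMl _ iN).
  apply: sN; rewrite rmorphB rmorph1 rmorphM e -addrA -mulrBl.
  by apply: (idealD iM) => //; apply: (idealMr _ iM).
Qed.

(** * The Nullstellensatz for polynomials in two variables *)

Section Nullstellensatz.

Variable K : closedFieldType.
Local Notation B := {poly {poly K}}.

Lemma exists_root (p : {poly K}) : (1 < size p)%N -> exists t, p.[t] = 0.
Proof.
move=> h; have /closed_rootP[t /rootP ht] : size p != 1%N by rewrite neq_ltn h orbT.
by exists t.
Qed.

(** A root of the nonconstant polynomial p X + 1 cannot be a root of p. *)
Lemma exists_nonroot (p : {poly K}) : p != 0 -> exists t, p.[t] != 0.
Proof.
move=> p0; have [|t] := @exists_root (p * 'X + 1).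
  by rewrite -polyC1 size_MXaddC (negbTE p0) /= ltnS size_poly_gt0.
rewrite !hornerE => e; exists t; apply/eqP => h; move: e.
by rewrite h mul0r add0r => /eqP; rewrite oner_eq0.
Qed.

(* A prime of R containing a nonzero polynomial in an element a contains a - t
   for some scalar t. *)
Lemma prime_linear (R : comNzRingType) (P : set R) (h : {rmorphism {poly K} -> R}) c :
  is_prime P -> c != 0 -> P (h c) -> exists t, P (h ('X - t%:P)).
Proof.
move=> hP; have [iP P1 PM] := hP.
elim: (size c) {-2}c (leqnn (size c)) => {c}[|s IH] c hs c0 Pc.
  by move: hs; rewrite leqn0 size_poly_eq0 (negbTE c0).
have [hc|hc] := leqP (size c) 1.
  case: P1; move: c0 Pc; rewrite (size1_polyC hc) polyC_eq0 => c0 Pc.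
  by rewrite -(rmorph1 h) -polyC1 -(mulVf c0) polyCM rmorphM; apply: (idealMl _ iP).
have [t /rootP/factor_theorem[q e]] := exists_root hc.
move: Pc; rewrite e rmorphM => /PM[Pq|]; last by exists t.
have q0 : q != 0 by apply: contra_neq c0 => q0; rewrite e q0 mul0r.
apply: (IH q) => //; move: hs; rewrite e size_Mmonic ?monicXsubC // size_XsubC.
by rewrite addn2.
Qed.

(** If N contains a nonzero polynomial in the inner variable, that variable is a scalar modulo N,
    and then so is the outer one. Otherwise an element h of least degree in the outer variable
    divides all of N up to powers of its leading coefficient, and specializing where that
    coefficient is nonzero gives a contradiction. *)
Lemma nullstellensatz2 (N : set B) : is_maximal N ->
  exists t l, forall g, N g -> g.[l%:P].[t] = 0.
Proof.
move=> hN; have hP := maximal_prime hN; have [iN N1 _] := hN.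
have [[c [c0 Nc]]|none] := pselect (exists c : {poly K}, c != 0 /\ N c%:P).
  have [t Nt] := prime_linear (h := polyC) hP c0 Nc.
  have red0 (g : B) : N (g - map_poly (fun p => p.[t]%:P) g).
    have -> : g - map_poly (fun p => p.[t]%:P) g =
        \sum_(i < size g) (g`_i - (g`_i).[t]%:P)%:P * 'X^i.
      rewrite map_polyE -[in X in X - _](coefK g) poly_def.
      rewrite (_ : Poly _ = \poly_(i < size g) (g`_i).[t]%:P); last first.
        apply/polyP => i; rewrite coef_Poly coef_poly; case: ltnP => hi.
          by rewrite (nth_map 0).
        by rewrite nth_default // size_map.
      rewrite poly_def -sumrB; apply: eq_bigr => i _.
      by rewrite -mul_polyC -[in X in _ - X]mul_polyC -mulrBl polyCB.
    apply: ideal_sum => // i _; apply: (idealMr _ iN).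
    have /factor_theorem[q ->] : root (g`_i - (g`_i).[t]%:P) t.
      by rewrite /root !hornerE subrr.
    by rewrite polyCM; apply: (idealMl _ iN).
  have red (g : B) : N (g - map_poly (polyC \o horner_eval t) g) by exact: red0.
  have [[d [d0 Nd]]|none] := pselect (exists d : {poly K}, d != 0 /\ N (map_poly polyC d)).
    have [l Nl] := prime_linear (h := map_poly polyC) hP d0 Nd.
    exists t, l => g Ng; apply: contrapT => /eqP nz; apply: N1.
    have Nl' : N ('X - l%:P%:P) by move: Nl; rewrite rmorphB /= map_polyX map_polyC.
    have Ngl : N (g.[l%:P])%:P.
      have /factor_theorem[q e] : root (g - (g.[l%:P])%:P) l%:P.
        by rewrite /root !hornerE subrr.
      rewrite -(subKr g (g.[l%:P])%:P); apply: (idealB iN) => //.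
      by rewrite e; apply: (idealMl _ iN).
    have := red (g.[l%:P])%:P; rewrite map_polyC /= => h.
    have {}h : N (g.[l%:P].[t])%:P%:P.
      by rewrite -(subKr (g.[l%:P])%:P (_%:P)); apply: (idealB iN).
    rewrite -[1](_ : (g.[l%:P].[t])^-1%:P%:P * (g.[l%:P].[t])%:P%:P = 1).
      exact: (idealMl _ iN).
    by rewrite -!polyCM mulVf.
  (* A nonzero polynomial in the outer variable alone must be found in N: it is 'X, or else the
     reduction of 1 - r 'X, whose constant coefficient is 1. *)
  have [NX|NX] := pselect (N 'X).
    case: none; exists 'X; split; first by rewrite polyX_eq0.
    by rewrite map_polyX.
  have [m [r [Nm e]]] := maximal_inv hN NX.
  pose ev (p : {poly K}) : K := p.[t].
  have := red (1 - r * 'X); rewrite (_ : 1 - r * 'X = m); last by rewrite e addrK.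
  move=> h; case: none; exists (map_poly (horner_eval t) m); split.
    rewrite (_ : m = 1 - r * 'X); last by rewrite e addrK.
    rewrite rmorphB rmorph1 rmorphM /= map_polyX subr_eq0; apply/eqP => e1.
    have := congr1 (fun p : {poly K} => p`_0) e1.
    by rewrite coef1 coefMX => /eqP; rewrite oner_eq0.
  rewrite -map_poly_comp -(subKr m (map_poly _ m)); exact: (idealB iN).
have [[h [h0 Nh]]|none'] := pselect (exists h, h != 0 /\ N h); last first.
  have N0 g : N g -> g = 0.
    by move=> Ng; apply/eqP; apply: contrapT => /negP g0; apply: none'; exists g.
  have [NX|NX] := pselect (N 'X).
    by have /eqP := N0 _ NX; rewrite polyX_eq0.
  have [m [r [/N0 -> e1]]] := maximal_inv hN NX.
  have := congr1 (fun p : B => p`_0) e1.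
  by rewrite add0r coef1 coefMX => /eqP; rewrite oner_eq0.
have {h h0 Nh} [h [h0 Nh hmin]] : exists h, [/\ h != 0, N h &
    forall g, N g -> (size g < size h)%N -> g = 0].
  move: h0 Nh; elim: (size h) {-2}h (leqnn (size h)) => {h}[|s IH] h hs h0 Nh.
    by move: hs; rewrite leqn0 size_poly_eq0 (negbTE h0).
  have [[g [g0 Ng sg]]|none2] := pselect (exists g, [/\ g != 0, N g & (size g < size h)%N]).
    by apply: (IH g) => //; rewrite -ltnS (leq_trans sg).
  exists h; split=> // g Ng sg; apply/eqP; apply: contrapT => /negP g0.
  by apply: none2; exists g.
have sh : (1 < size h)%N.
  rewrite ltnNge; apply/negP => /size1_polyC e; apply: none; exists h`_0.
  by rewrite -e; split=> //; rewrite -polyC_eq0 -e.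
have c0 : lead_coef h != 0 by rewrite lead_coef_eq0.
have [t ht] := exists_nonroot c0.
have nt : ~ N ('X - t%:P)%:P.
  by move=> h1; apply: none; exists ('X - t%:P); rewrite polyXsubC_eq0.
(* Pseudo-dividing m by h and evaluating the inner variable at t expresses a nonzero scalar as a
   multiple of a polynomial of positive degree. *)
have [m [r [Nm e]]] := maximal_inv hN nt.
have hd := Pdiv.Idomain.divp_eq m h.
set k := Pdiv.Idomain.scalp m h in hd.
have m0 : Pdiv.Idomain.modp m h = 0.
  apply: hmin; last by rewrite Pdiv.Idomain.ltn_modp.
  rewrite -[X in N X](addKr (Pdiv.Idomain.divp m h * h)) -hd -mul_polyC addrC.
  by apply: (idealB iN); apply: (idealMl _ iN).
rewrite m0 addr0 in hd.
have e1 : (lead_coef h ^+ k)%:P = Pdiv.Idomain.divp m h * h +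
    (lead_coef h ^+ k)%:P * r * ('X - t%:P)%:P.
  by rewrite -hd -mul_polyC -mulrA -mulrDr -e mulr1.
have := congr1 (map_poly (horner_eval t)) e1.
rewrite rmorphD !rmorphM /= !map_polyC /= [horner_eval t ('X - _)]hornerXsubC subrr.
rewrite polyC0 mulr0 addr0 {1}/horner_eval horner_exp => e2.
pose T := map_poly (horner_eval t).
have sT : size (T h) = size h by rewrite /T size_map_poly_id0.
have := congr1 (fun p : {poly K} => size p) e2.
rewrite size_polyC expf_eq0 (negbTE ht) andbF /= -/(T _) -/(T _) => e3.
have q0 : T (Pdiv.Idomain.divp m h) != 0.
  by apply/eqP => q0; move: e3; rewrite q0 mul0r size_poly0.
have h0' : T h != 0 by rewrite -size_poly_eq0 sT -lt0n ltnW.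
move: e3; rewrite size_mul // sT; move: q0; rewrite -size_poly_eq0.
by move: sh; move: (size _) (size _); lia.
Qed.

End Nullstellensatz.

(** * Ideals of points and lines; bounds on chains of primes *)

Section Points.

Context {K : closedFieldType} {n : nat}.
Local Notation S := {mpoly K[n.+1]}.

Definition point_ideal (q : 'I_n.+1 -> K) : set S := fun f => f.@[q] = 0.
(** The line through q and the origin: for q nonzero, the homogeneous prime of the projective point
    q. *)
Definition line_ideal (q : 'I_n.+1 -> K) : set S := cone_ideal idfun q.

Lemma point_maximal q : is_maximal (point_ideal q).
Proof.
split; first exact: (kernel_ideal (meval q)).
  by rewrite /point_ideal meval1 => /eqP; rewrite oner_eq0.
move=> N iN N1 sN; apply/seteqP; split=> // f Nf; apply: contrapT => /eqP nz; apply: N1.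
have h : N (f.@[q])%:MP.
  rewrite -(subKr f (f.@[q])%:MP); apply: (idealB iN) => //; apply: sN.
  by rewrite /point_ideal mevalB mevalC subrr.
rewrite -mpolyC1 -(mulVf nz) mpolyCM; exact: (idealMl _ iN).
Qed.

Lemma point_prime q : is_prime (point_ideal q).
Proof. exact: (kernel_prime (meval q)). Qed.

Lemma maximal_point M q : is_maximal M -> (M `<=` point_ideal q)%classic ->
  M = point_ideal q.
Proof.
move=> [_ _ Mmax] sM; apply/esym/Mmax => //.
  exact: (kernel_ideal (meval q)).
by rewrite /point_ideal meval1 => /eqP; rewrite oner_eq0.
Qed.

Lemma line_idealP q f : line_ideal q f <-> forall k, (pihomog mdeg k f).@[q] = 0.
Proof. exact: cone_idealP. Qed.

Lemma line_sub_point q : (line_ideal q `<=` point_ideal q)%classic.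
Proof.
move=> f /line_idealP hf; rewrite /point_ideal (pihomog_partitionE (leqnn (msize f))).
by rewrite (raddf_sum (meval q)) big1 // => i _; apply: hf.
Qed.

Lemma homog_sub_line (P : set S) q : is_homogeneous P ->
  (P `<=` point_ideal q)%classic -> (P `<=` line_ideal q)%classic.
Proof.
by move=> [_ hP] sP f Pf; apply/line_idealP => k; apply: sP; apply: hP.
Qed.

Lemma line_prime q : is_prime (line_ideal q). Proof. exact: cone_prime. Qed.
Lemma line_homog q : is_homogeneous (line_ideal q). Proof. exact: cone_homogeneous. Qed.

Lemma line_relevant q i : q i != 0 -> relevant_prime (line_ideal q).
Proof. exact: cone_relevant. Qed.

(** An element of c i.+1 outside the prime c i is a non-zero-divisor modulo c i, so [no_chain3]
    applies. *)
Lemma prime_chain_le2 (I : set S) (c : nat -> set S) : quadratic_growth I ->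
  (I `<=` c 0)%classic -> (forall i, (i <= 3)%N -> is_prime (c i)) ->
  (forall i, (i < 3)%N -> (c i `<` c i.+1)%classic) -> False.
Proof.
move=> hI sI hc lt.
have ex i : exists f, (i < 3)%N -> c i.+1 f /\ ~ c i f.
  case: (ltnP i 3) => hi; last by exists 0.
  have [_ ns] := lt i hi; apply: contrapT => none; apply: ns => f cf.
  by apply: contrapT => ncf; apply: none; exists f.
have [f hf] := choice ex.
have [_ h _] := hc 3 isT; apply: h.
apply: (no_chain3 (f := f) hI sI) => i.
- by move=> /hc /prime_ideal.
- by move=> /lt [].
- by move=> /hf [].
- move=> a hi; have [_ _ h] := hc i (ltnW hi); move=> /h [|//].
  by have [] := hf i hi.
Qed.

Lemma prime_chain_bound (I : set S) (c : nat -> set S) k : quadratic_growth I ->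
  (forall i, (i <= k)%N -> is_prime (c i) /\ (I `<=` c i)%classic) ->
  (forall i, (i < k)%N -> (c i `<` c i.+1)%classic) -> (k <= 2)%N.
Proof.
move=> hI hc lt; rewrite leqNgt; apply/negP => h3.
apply: (prime_chain_le2 (c := c) hI).
- by have [] := hc 0 isT.
- by move=> i hi; have [] := hc i (leq_trans hi h3).
- by move=> i hi; apply: lt; apply: leq_trans h3.
Qed.

(** The degree 0 part of an element of P is a scalar in P, hence zero. *)
Lemma homog_prime_irrelevant (P : set S) : is_prime P -> is_homogeneous P ->
  (P `<=` point_ideal (fun _ => 0%R))%classic.
Proof.
move=> [iP P1 _] [_ hP] f Pf.
have h0 : f.@[fun _ => 0%R] = f@_0%MM.
  rewrite mevalE; case: (boolP (0%MM \in msupp f)) => h.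
    rewrite (bigD1_seq 0%MM) ?msupp_uniq //= big1 ?mulr1 => [|i _]; last by rewrite mnm0E.
    rewrite big1 ?addr0 // => m ne; rewrite (_ : \prod_i _ = 0) ?mulr0 //.
    have [i hi] : exists i, m i != 0%N.
      apply: contrapT => none; case/eqP: ne; apply/mnmP => i; rewrite mnm0E.
      by apply/eqP; apply: contrapT => /negP hi; apply: none; exists i.
    by rewrite (bigD1 i) //= expr0n (negbTE hi) mul0r.
  rewrite (memN_msupp_eq0 h) big_seq big1 // => m hm.
  rewrite (_ : \prod_i _ = 0) ?mulr0 //.
  have [i hi] : exists i, m i != 0%N.
    apply: contrapT => none; case/negP: h; rewrite (_ : 0%MM = m) //.
    apply/mnmP => i; rewrite mnm0E.
    by apply/esym/eqP; apply: contrapT => /negP hi; apply: none; exists i.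
  by rewrite (bigD1 i) //= expr0n (negbTE hi) mul0r.
rewrite /point_ideal h0; apply: contrapT => /eqP nz; apply: P1.
have := hP f 0%N Pf; rewrite [pihomog _ _ _]dhomog0_const ?pihomogP //.
rewrite mcoeff_pihomog mdeg0 eqxx => h.
by rewrite -mpolyC1 -(mulVf nz) mpolyCM; apply: (idealMl _ iP).
Qed.

(** The irrelevant ideal can be added on top of a chain of relevant primes, so the bound is one less
    than for all primes. *)
Lemma relevant_chain_bound (I : set S) (c : nat -> set S) k : quadratic_growth I ->
  (forall i, (i <= k)%N -> relevant_prime (c i) /\ (I `<=` c i)%classic) ->
  (forall i, (i < k)%N -> (c i `<` c i.+1)%classic) -> (k <= 1)%N.
Proof.
move=> hI hc lt; rewrite leqNgt; apply/negP => h2.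
apply: (prime_chain_le2 (c := fun i => if (i <= 2)%N then c i
  else point_ideal (fun _ => 0%R)) hI).
- by have [] := hc 0 isT.
- move=> i _; case: ifP => hi; last exact: point_prime.
  by have [[]] := hc i (leq_trans hi h2).
- move=> i hi; rewrite -ltnS hi; case: (ltnP i 2) => hi2.
    by apply: lt; apply: leq_trans h2.
  have -> : i = 2 by lia.
  have [[P1 P2 [j hj]] _] := hc 2 h2; split; first exact: homog_prime_irrelevant.
  by move=> h; apply: hj; apply: h; rewrite /point_ideal mevalXU.
Qed.

End Points.

(** * Points and components *)

Lemma mmap_congr_mod (R A : comNzRingType) n (J : set A) (iota : {rmorphism R -> A})
    (h h' : 'I_n -> A) f :
  is_ideal J -> (forall i, J (h i - h' i)) -> J (mmap iota h f - mmap iota h' f).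
Proof.
move=> hJ hX; elim/mpoly_ring_ind: f => [c|i|f g hf hg|f g hf hg].
- by rewrite !mmapC subrr; apply: ideal0.
- by rewrite !mmapXU.
- by rewrite !rmorphD /= opprD addrACA; apply: (idealD hJ).
- rewrite !rmorphM /= -(subrK (mmap iota h' f * mmap iota h g)
    (mmap iota h f * mmap iota h g)) -addrA -mulrBl -mulrBr.
  by apply: (idealD hJ); [apply: (idealMr _ hJ) | apply: (idealMl _ hJ)].
Qed.

Lemma mmap_congr (R : comNzRingType) n (J : set {mpoly R[n]}) (h : 'I_n -> {mpoly R[n]}) f :
  is_ideal J -> (forall i, J ('X_i - h i)) -> J (f - mmap (@mpolyC n R) h f).
Proof.
move=> hJ hX; have {1}<- : mmap (@mpolyC n R) (fun i => 'X_i) f = f.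
  apply: (mpoly_hom_ext (h1 := mmap (@mpolyC n R) (fun i => 'X_i)) (h2 := idfun)).
    by move=> c; rewrite /= mmapC.
  by move=> i; rewrite /= mmapXU.
exact: mmap_congr_mod.
Qed.

Lemma cone_map_homog (K : fieldType) (R : idomainType) (iota : {rmorphism K -> R}) n
    (z : 'I_n.+1 -> R) f k :
  f \is k.-homog -> cone_map iota z f = mmap iota z f *: 'X^k.
Proof.
move=> hf; apply/polyP => j; rewrite coef_cone_map coefZ coefXn.
case: (eqVneq j k) => [->|ne]; first by rewrite pihomog_dE // mulr1.
by rewrite (pihomog_ne0 _ hf) 1?eq_sym // rmorph0 mulr0.
Qed.

Lemma homog1_sum (R : nzRingType) n (f : {mpoly R[n]}) : f \is 1.-homog ->
  f = \sum_i f@_U_(i) *: 'X_i.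
Proof.
move=> hf; apply/mpolyP => m; rewrite raddf_sum /=.
under eq_bigr do rewrite mcoeffZ mcoeffX.
have [/mdeg1P[i /eqP ->]|h] := boolP (mdeg m == 1%N).
  rewrite (bigD1 i) //= eqxx mulr1 big1 ?addr0 // => j ne.
  by rewrite eq_mnm1 (negbTE ne) mulr0.
rewrite (dhomog_nemf_coeff hf h) big1 // => i _; case: eqP => [e|]; last by rewrite mulr0.
by rewrite -e mdeg1 in h.
Qed.

Section CurvePoints.

Context {K : closedFieldType} {n : nat} (G : incidence K n).
Local Notation S := {mpoly K[n.+1]}.
Local Notation V := (vert G).
Local Notation E := (edge G).
Implicit Types (v w : V) (x : E) (f g : S) (q : 'I_n.+1 -> K).

(** The closed points of the affine cone over the component; the second family is the line over t =
    infinity. *)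
Definition cone_point v q : Prop :=
  (exists t l, q = fun i => l * (zeta v i).[t]) \/
  (exists b, q = fun i => b * (i == Y v)%:R).

Lemma horner_cone_map v f t l :
  (cone_map polyC (zeta v) f).[l%:P].[t] = f.@[fun i => l * (zeta v i).[t]].
Proof.
rewrite -[LHS]/((horner_eval t \o horner_eval l%:P) (cone_map polyC (zeta v) f)).
rewrite /cone_map mmap_hom; apply: mmap_ext => [c|i] /=.
  by rewrite /horner_eval !hornerC.
by rewrite /horner_eval hornerZ hornerX hornerM hornerC mulrC.
Qed.

Lemma cone_point_vanish v q : cone_point v q -> (comp_ideal v `<=` point_ideal q)%classic.
Proof.
move=> hq; apply: (homogeneous_sub (comp_homog v)) => [|f k hf].
  exact: (kernel_ideal (meval q)).
move=> /(comp_idealP v hf) h; rewrite /point_ideal.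
case: hq => [[t [l ->]]|[b ->]].
  by rewrite /meval (mmap_homog_scale idfun _ _ hf) -/(meval _ _) -horner_phi h horner0 mulr0.
rewrite /meval (mmap_homog_scale idfun _ _ hf) -/(meval _ _).
by have [_ <-] := phi_top v hf; rewrite h coef0 mulr0.
Qed.

(** As [px v x] has degree deg v - 1, its k-th power leaves room for degree k in t. Thus inverting X
    x turns the coordinate ring of the cone into a localization of the polynomials in t and the
    degree variable. *)
Lemma cone_map_lift v x (g : {poly {poly K}}) : inc x v -> exists k f,
  cone_map polyC (zeta v) f = cone_map polyC (zeta v) 'X_(X x) ^+ k * g.
Proof.
move=> hx; pose k := \max_(j < size g) size (g`_j)%R.
have ex j : exists f, (j < size g)%N ->
    f \is (j + k).-homog /\ phi v f = px v x ^+ k * g`_j.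
  case: (ltnP j (size g)) => hj; last by exists 0.
  have [|f hf ef] := @phi_surj _ _ _ v (j + k) (px v x ^+ k * g`_j); last by exists f.
  apply: leq_trans (size_polyMleq _ _) _.
  have h1 : (size (g`_j)%R <= k)%N by exact: (leq_bigmax (Ordinal hj)).
  have := size_poly_exp_leq (px v x) k; rewrite size_px // => h2.
  apply: (@leq_trans ((deg v).-1 * k + k).+1).
    by move: (size _) (size _) h1 h2 => a b; lia.
  have := deg_gt0 v; rewrite ltnS mulnDl; case: (deg v) => // d _ /=; nia.
have [F hF] := choice ex.
exists k, (\sum_(j < size g) F j).
rewrite (rmorph_sum (cone_map polyC (zeta v))) /= (cone_map_homog _ _ (dhomogXU K (X x))).
rewrite mmapXU zetaX // expr1 exprZn -[in RHS](coefK g) poly_def mulr_sumr.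
apply: eq_bigr => j _; have [h1 h2] := hF j (ltn_ord j).
by rewrite (cone_map_homog _ _ h1) -/(phi v _) h2 -!mul_polyC exprD polyCM; ring.
Qed.

(** If some X x at v lies outside M, then M extends to the polynomials in t and the degree variable
    by [cone_map_lift]. Otherwise M contains every variable but Y v, and its point lies over t =
    infinity. Both cases end with [nullstellensatz2]. *)
Lemma maximal_over_comp v M : is_maximal M -> (comp_ideal v `<=` M)%classic ->
  exists2 q, M = point_ideal q & cone_point v q.
Proof.
move=> hM sM; have [iM M1 _] := hM; have hP := maximal_prime hM.
have [[x [hx nx]]|none] := pselect (exists x, inc x v /\ ~ M 'X_(X x)); last first.
  (* The outer variable goes to Y v and the inner one to 0, which is surjective modulo M. *)
  pose h : {rmorphism {poly {poly K}} -> S} :=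
    horner_eval 'X_(Y v) \o map_poly (@mpolyC n.+1 K \o horner_eval 0).
  pose z i : {poly {poly K}} := if i == Y v then 'X else 0.
  have hz f : M (f - h (mmap (polyC \o polyC) z f)).
    rewrite mmap_hom; have := mmap_congr (J := M) (h := h \o z) f iM.
    move=> H; rewrite (mmap_ext (f' := @mpolyC n.+1 K) (h' := h \o z)) //; last first.
      by move=> c; rewrite /= map_polyC /= /horner_eval hornerC /= hornerC.
    apply: H => i; rewrite /z /=.
    case: (eqVneq i (Y v)) => [->|ne].
      by rewrite map_polyX /horner_eval hornerX subrr; apply: ideal0.
    rewrite rmorph0 /horner_eval horner0 subr0.
    case: (boolP (star v i)) => hi; last by apply: sM; apply/comp_idealX.
    have [[w e]|[x e]] := var_cases G i; move: hi; rewrite e.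
      by rewrite starY => /eqP e'; rewrite e e' eqxx in ne.
    by rewrite starX => hx; apply: contrapT => nM; apply: none; exists x.
  have hN : is_maximal (fun r => M (h r)).
    by apply: (maximal_preim (h := h)) => // f; exists (mmap (polyC \o polyC) z f).
  have [t [l hl]] := nullstellensatz2 hN.
  exists (fun i => l * (i == Y v)%:R); last by right; exists l.
  apply: (maximal_point hM) => f Mf; rewrite /point_ideal.
  have /hl : M (h (mmap (polyC \o polyC) z f)).
    by rewrite -(subKr f (h _)); apply: (idealB iM).
  rewrite -[X in X = 0]/((horner_eval t \o horner_eval l%:P) (mmap _ z f)) mmap_hom => <-.
  apply: mmap_ext => [c|i]; rewrite /= /z /horner_eval ?hornerC //.
  by case: eqP; rewrite ?hornerX ?hornerC ?mulr1 ?horner0 ?mulr0.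
pose Phi : {rmorphism S -> {poly {poly K}}} := cone_map polyC (zeta v).
pose P : {poly {poly K}} := Phi 'X_(X x).
(* The contraction to the polynomial ring of the extension of M to the localization at X x; it is
   proper because X x is outside M. *)
pose M' (g : {poly {poly K}}) := exists k f, M f /\ Phi f = P ^+ k * g.
have nX k : ~ M ('X_(X x) ^+ k) by move/(prime_exp hP).
have MPhi f g : Phi f = Phi g -> M f -> M g.
  move=> e Mf; rewrite -(subKr f g); apply: (idealB iM) => //; apply: sM.
  by rewrite /comp_ideal /cone_ideal -[cone_map _ _ _]/(Phi _) rmorphB e subrr.
have iM' : is_ideal M'.
  split.
  - by exists 0%N, 0; split; [exact: ideal0 | rewrite rmorph0 mulr0].
  - move=> a b [k [f [Mf ef]]] [k' [f' [Mf' ef']]].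
    exists (k' + k)%N, ('X_(X x) ^+ k' * f + 'X_(X x) ^+ k * f').
    split; first by apply: (idealD iM); apply: (idealMl _ iM).
    rewrite rmorphD !rmorphM !rmorphXn /= ef ef' -/P mulrDr exprD mulrA.
    by congr (_ + _); rewrite mulrA [P ^+ k * _]mulrC.
  - move=> r a [k [f [Mf ef]]]; have [k' [f' ef']] := cone_map_lift r hx.
    exists (k' + k)%N, (f' * f); split; first exact: (idealMl _ iM).
    rewrite rmorphM ef /= -[X in X * _]/(cone_map _ _ f') ef' exprD.
    by rewrite -!mulrA; congr (_ * _); rewrite mulrCA.
have hM' : is_maximal M'.
  split=> //.
    move=> [k [f [Mf ef]]]; apply: (nX k); apply: MPhi Mf.
    by rewrite ef mulr1 rmorphXn.
  move=> N iN N1 sN; apply/seteqP; split=> // g Ng.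
  have [k [f ef]] := cone_map_lift g hx.
  exists k, f; split=> //; apply: contrapT => Mf; apply: N1.
  have [m [r [Mm e]]] := maximal_inv hM Mf.
  rewrite -(rmorph1 Phi) e rmorphD rmorphM; apply: (idealD iN).
    by apply: sN; exists 0%N, m; rewrite expr0 mul1r.
  by rewrite [Phi f]ef; apply: (idealMl _ iN); apply: (idealMl _ iN).
have [t [l hl]] := nullstellensatz2 hM'.
exists (fun i => l * (zeta v i).[t]); last by left; exists t, l.
apply: (maximal_point hM) => f Mf; rewrite /point_ideal -horner_cone_map.
by apply: hl; exists 0%N, f; rewrite expr0 mul1r.
Qed.

Lemma point_ideal_inj q q' : point_ideal q = point_ideal q' -> q = q'.
Proof.
move=> e; apply/funext => i.
have : point_ideal q ('X_i - (q i)%:MP).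
  by rewrite /point_ideal mevalB mevalXU mevalC subrr.
by rewrite e /point_ideal mevalB mevalXU mevalC => /eqP; rewrite subr_eq0 => /eqP.
Qed.

Lemma comp_pointP v q : (comp_ideal v `<=` point_ideal q)%classic <-> cone_point v q.
Proof.
split=> [h|]; last exact: cone_point_vanish.
by have [q' /point_ideal_inj -> ] := maximal_over_comp (point_maximal q) h.
Qed.

Lemma node_cone_point v x : inc x v -> cone_point v (node x).
Proof.
move=> hx; left; exists (pos x), ((px v x).[pos x])^-1; apply/funext => i.
by rewrite zeta_node // mulrA mulVf ?mul1r // px_node.
Qed.

(** A nonzero linear form in X x and Y v vanishing at q is not zero on the component, where these
    variables restrict to polynomials of different degrees. If q vanishes in both, Y v is such a
    form. *)
Lemma comp_lt_line v q : cone_point v q -> (comp_ideal v `<` line_ideal q)%classic.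
Proof.
move=> hq; split.
  by apply: homog_sub_line; [exact: comp_homog | apply/comp_pointP].
have [x hx] := inc_pos v => s.
have hom : q (X x) *: 'X_(Y v) - q (Y v) *: 'X_(X x) \is [in K[n.+1], 1.-homog].
  by rewrite rpredB // rpredZ // dhomogXU.
have phiE : phi v (q (X x) *: 'X_(Y v) - q (Y v) *: 'X_(X x)) =
    q (X x) *: py v - q (Y v) *: px v x.
  by rewrite rmorphB /= /phi !mmapZ !mmapXU zetaY zetaX // !mul_polyC.
have /s : line_ideal q (q (X x) *: 'X_(Y v) - q (Y v) *: 'X_(X x)).
  apply/(cone_ideal_homog _ _ hom); rewrite -/(meval _ _) mevalB !mevalZ !mevalXU.
  by rewrite mulrC subrr.
move=> /(comp_idealP v hom); rewrite phiE => e.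
have qX : q (X x) = 0.
  have := congr1 (fun p : {poly K} => p`_(deg v)) e.
  rewrite coefB !coefZ -zetaY -(zetaX hx) !coef_zeta eqxx XY mulr1 mulr0 subr0.
  by rewrite coef0.
have qY : q (Y v) = 0.
  move: e; rewrite qX scale0r sub0r => /eqP; rewrite oppr_eq0 scaler_eq0.
  by rewrite (negbTE (px_neq0 v x)) orbF => /eqP.
have /s : line_ideal q 'X_(Y v).
  by apply/(cone_ideal_homog _ _ (dhomogXU K (Y v))); rewrite mmapXU.
by move/comp_idealX; rewrite starY eqxx.
Qed.

Lemma proj_dim1 J v : (curve_ideal G `<=` J)%classic -> (J `<=` comp_ideal v)%classic ->
  proj_dim J 1.
Proof.
move=> sI sJ; split; last first.
  move=> k [c [hc lt]]; apply: (relevant_chain_bound (curve_growth G)) lt.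
  by move=> i /hc [h1 h2]; split=> //; apply: subset_trans sI h2.
have [x hx] := inc_pos v; have hq := node_cone_point hx.
have hl := comp_lt_line hq.
exists (fun i => if i == 0%N then comp_ideal v else line_ideal (node x)); split.
  move=> i _; case: ifP => _; first by split; [exact: comp_relevant|].
  split; last by apply: subset_trans sJ _; case: hl.
  by apply: (line_relevant (i := X x)); rewrite /node eqxx oner_eq0.
by case.
Qed.

Lemma comp_incl v w : (comp_ideal v `<=` comp_ideal w)%classic -> v = w.
Proof.
move=> s; apply/eqP; apply: contrapT => /negP ne.
have /s/comp_idealX : comp_ideal v 'X_(Y w) by apply/comp_idealX; rewrite starY eq_sym.
by rewrite starY eqxx.
Qed.

Lemma curve_componentP P : irreducible_component (curve_ideal G) P <-> exists v : V, comp_ideal v = P.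
Proof.
split.
  move=> [[hP _ _] sI hmin]; have [v sv] := prime_over_curve hP sI.
  by exists v; apply: hmin sv; [exact: comp_relevant | exact: curve_sub].
move=> [v <-]; split; [exact: comp_relevant | exact: curve_sub|].
move=> Q [hQ _ _] sI sQ; have [w sw] := prime_over_curve hQ sI.
apply/seteqP; split=> //.
by have e := comp_incl (subset_trans sw sQ); rewrite -e.
Qed.

Lemma curve_is_curve (v0 : V) : is_curve (curve_ideal G).
Proof.
split=> [|P /curve_componentP[v <-]].
  exact: (proj_dim1 (v := v0) _ (@curve_sub _ _ _ v0)).
exact: (proj_dim1 (v := v) (@curve_sub _ _ _ v)).
Qed.

(** Modulo the other variables a form of degree k is a scalar multiple of X x ^ k, and no power of X
    x lies in P. *)
Lemma node_prime P x : relevant_prime P -> (forall i, i != X x -> P 'X_i) ->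
  P = line_ideal (node x).
Proof.
move=> [hP hom [i0 hi0]] hX; have iP := prime_ideal hP.
have nX : ~ P 'X_(X x).
  by move=> h; apply: hi0; case: (eqVneq i0 (X x)) => [->|/hX].
have red f k : f \is k.-homog -> P (f - f.@[node x] *: 'X_(X x) ^+ k).
  move=> hf; have -> : f.@[node x] *: 'X_(X x) ^+ k =
      mmap (@mpolyC n.+1 K) (fun i => 'X_(X x) * (node x i)%:MP) f.
    rewrite (mmap_homog_scale _ _ _ hf) -mul_mpolyC mulrC; congr (_ * _).
    by rewrite /meval (mmap_hom _ _ (@mpolyC n.+1 K)).
  apply: mmap_congr => // i; rewrite /node.
  case: (eqVneq i (X x)) => [->|/hX h]; first by rewrite mulr1 subrr; apply: ideal0.
  by rewrite mpolyC0 mulr0 subr0.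
apply/seteqP; split.
  apply: (homogeneous_sub hom) => [|f k hf Pf].
    exact/prime_ideal/line_prime.
  apply/(cone_ideal_homog _ _ hf); apply/eqP; apply: contrapT => /negP nz; apply: nX.
  apply: (@prime_exp _ P _ k) => //.
  rewrite -[X in P X](scale1r) -(mulVf nz) -scalerA -mul_mpolyC; apply: (idealMl _ iP).
  rewrite -(subKr f (_ *: _)); apply: (idealB iP) => //; exact: red.
apply: (homogeneous_sub (line_homog _)) => // f k hf /(cone_ideal_homog _ _ hf) h.
by have := red f k hf; rewrite [f.@[_]]h scale0r subr0.
Qed.

(** The sum of the ideals contains every variable outside the common part of the stars. With a
    common edge x this is all but X x, and [node_prime] leaves a single relevant prime; without one
    it is all of them, and no relevant prime remains. *)
Lemma curve_meet v w : v != w ->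
  (exists x, inc x v && inc x w) <-> meet_in_codim1 (curve_ideal G) (comp_ideal v) (comp_ideal w).
Proof.
move=> ne; have iv := prime_ideal (comp_prime v); have iw := prime_ideal (comp_prime w).
have subv : (comp_ideal v `<=` ideal_add (comp_ideal v) (comp_ideal w))%classic.
  by move=> f hf; apply: ideal_gen_sub; left.
have subw : (comp_ideal w `<=` ideal_add (comp_ideal v) (comp_ideal w))%classic.
  by move=> f hf; apply: ideal_gen_sub; right.
have pI : proj_dim (curve_ideal G) 1 by apply: (proj_dim1 (v := v) _ (@curve_sub _ _ _ v)).
split.
  move=> [x /andP[hv hw]]; exists 0%N; split=> //; split.
    exists (fun=> line_ideal (node x)); split=> // i _; split.
      by apply: (line_relevant (i := X x)); rewrite /node eqxx oner_eq0.
    apply: ideal_gen_min; first exact/prime_ideal/line_prime.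
    have [s1 _] := comp_lt_line (node_cone_point hv).
    have [s2 _] := comp_lt_line (node_cone_point hw).
    by move=> f [/s1|/s2].
  move=> k [c [hc lt]]; rewrite leqNgt; apply/negP => hk.
  have cE i : (i <= k)%N -> c i = line_ideal (node x).
    move=> hi; have [hr hs] := hc i hi; apply: node_prime => // j hj; apply: hs.
    case: (boolP (star v j)) => sv; last by apply: subv; apply/comp_idealX.
    apply: subw; apply/comp_idealX; apply/negP => sw.
    move: sv sw hj; have [[u ->]|[x' ->]] := var_cases G j.
      by rewrite !starY => /eqP ->; rewrite (negbTE ne).
    rewrite !starX (inj_eq (@X_inj _ _ G)) => h1 h2.
    by rewrite (inc_simple ne h1 h2 hv hw) eqxx.
  by have [_] := lt 0 hk; rewrite (cE 0) // (cE 1) // => /(_ (fun _ h => h)).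
move=> [d [pd]]; have [<-] := is_max_uniq pI pd.
move=> [[c [hc _]] _]; have [[hP _ [i hi]] s] := hc 0 isT.
apply: contrapT => none; apply: hi; apply: s.
case: (boolP (star v i)) => sv; last by apply: subv; apply/comp_idealX.
apply: subw; apply/comp_idealX; apply/negP => sw; apply: none.
move: sv sw; have [[u ->]|[x' ->]] := var_cases G i.
  by rewrite !starY => /eqP ->; rewrite (negbTE ne).
by rewrite !starX => h1 h2; exists x'; rewrite h1.
Qed.

(** The rows are the points that turn (1, t, ..., t^(deg v)) into the parametrization [zeta v]. *)
Definition coef_mx v : 'M[K]_((deg v).+1, n.+1) := \matrix_(i, j) (zeta v j)`_i.

(** Each t^i is the restriction of a linear form by [phi_surj]; the coefficients of these forms give
    a right inverse. *)
Lemma coef_mx_free v : row_free (coef_mx v).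
Proof.
apply/row_freeP.
have ex (i : 'I_(deg v).+1) : exists f : S, f \is 1.-homog /\ phi v f = 'X^i.
  have [|f hf ef] := @phi_surj _ _ _ v 1 'X^i; last by exists f.
  by rewrite size_polyXn mul1n.
have [F hF] := choice ex.
exists (\matrix_(j, i) (F i)@_U_(j)); apply/matrixP => i i'; rewrite !mxE.
have [h1 h2] := hF i'.
rewrite -[RHS](_ : (phi v (F i'))`_i = _); last by rewrite h2 coefXn.
rewrite [in RHS](homog1_sum h1) (rmorph_sum (phi v)) coef_sum; apply: eq_bigr => j _.
by rewrite !mxE /= /phi mmapZ mmapXU mul_polyC coefZ mulrC.
Qed.

Lemma veronese_coef v s t j : (veronese (deg v) s t *m coef_mx v) 0 j =
  if s == 0 then t ^+ deg v * (j == Y v)%:R else s ^+ deg v * (zeta v j).[t / s].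
Proof.
rewrite mxE; under eq_bigr do rewrite !mxE.
case: eqP => [->|/eqP s0].
  rewrite (bigD1 ord_max) //= subnn expr0 mul1r coef_zeta big1 ?addr0 // => i ne.
  have hi : (i < deg v)%N.
    rewrite ltn_neqAle -ltnS ltn_ord andbT; apply: contra ne => /eqP e; apply/eqP.
    exact: val_inj.
  by rewrite expr0n subn_eq0 leqNgt hi !mul0r.
rewrite (horner_coef_wide _ (size_zeta v j)) mulr_sumr; apply: eq_bigr => i _.
have hi : (i <= deg v)%N by rewrite -ltnS.
have -> : s ^+ deg v = s ^+ (deg v - i) * s ^+ i by rewrite -exprD subnK.
have si : s ^+ i != 0 by rewrite expf_neq0.
by rewrite expr_div_n; field.
Qed.

Lemma comp_rational_normal v : rational_normal_in_span (comp_ideal v).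
Proof.
have ptP p : on_scheme (comp_ideal v) p <-> exists s t c : K,
    [/\ (s, t) != (0, 0), c != 0 & p = c *: (veronese (deg v) s t *m coef_mx v)].
  split.
    move=> [p0 /comp_pointP [[t [l e]]|[b e]]].
      have pE : p = l *: (veronese (deg v) 1 t *m coef_mx v).
        apply/rowP => j; rewrite mxE veronese_coef oner_eq0 expr1n mul1r divr1.
        by have /= := congr1 (fun q => q j) e.
      exists 1, t, l; split=> //; first by rewrite xpair_eqE oner_eq0.
      by apply: contra_neq p0 => l0; rewrite pE l0 scale0r.
    have pE : p = b *: (veronese (deg v) 0 1 *m coef_mx v).
      apply/rowP => j; rewrite mxE veronese_coef eqxx expr1n mul1r.
      by have /= := congr1 (fun q => q j) e.
    exists 0, 1, b; split=> //; first by rewrite xpair_eqE oner_eq0 andbF.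
    by apply: contra_neq p0 => l0; rewrite pE l0 scale0r.
  move=> [s [t [c [st c0 e]]]]; split.
    rewrite e scaler_eq0 (negbTE c0) /= -(mul0mx _ (coef_mx v)).
    rewrite (inj_eq (row_free_inj (coef_mx_free v))).
    apply: contra st => /eqP e0; rewrite xpair_eqE.
    have := congr1 (fun A : 'rV_ _ => A 0 ord0) e0.
    have := congr1 (fun A : 'rV_ _ => A 0 ord_max) e0.
    rewrite !mxE /= subnn subn0 !expr0 mul1r mulr1 => /eqP.
    by rewrite expf_eq0 => /andP[_ ->] /eqP; rewrite expf_eq0 => /andP[_ ->].
  apply/comp_pointP; case: (eqVneq s 0) => [s0|s0].
    right; exists (c * t ^+ deg v); apply/funext => j.
    by rewrite e mxE veronese_coef s0 eqxx mulrA.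
  left; exists (t / s), (c * s ^+ deg v); apply/funext => j.
  by rewrite e mxE veronese_coef (negbTE s0) mulrA.
exists (deg v), (coef_mx v); split; [exact: deg_gt0 | exact: coef_mx_free | |exact: ptP].
move=> l U; split.
  move=> sA p /ptP[s [t [c [_ _ ->]]]]; apply: scalemx_sub.
  exact: (submx_trans (submxMl _ _)).
move=> sp; rewrite submxE; apply/eqP/matrixP => i j; rewrite [RHS]mxE.
set B := coef_mx v *m cokermx U.
(* Column j of B as a polynomial in t. Its value at t is a coordinate of a point of the curve times
   [cokermx U], which is zero as the point lies in U. *)
pose P : {poly K} := \poly_(k < (deg v).+1) B (inord k) j.
suff : P = 0 by move/(congr1 (fun p : {poly K} => p`_i)); rewrite coef_poly ltn_ord coef0 inord_val.
apply/eqP; apply: contrapT => /negP /exists_nonroot [t]; case/eqP.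
have : on_scheme (comp_ideal v) (veronese (deg v) 1 t *m coef_mx v).
  by apply/ptP; exists 1, t, 1; rewrite scale1r oner_eq0 xpair_eqE oner_eq0.
move/sp; rewrite submxE -mulmxA -/B => /eqP e.
have := congr1 (fun A : 'rV_ _ => A 0 j) e; rewrite !mxE => e0.
rewrite /P horner_poly -[RHS]e0; apply: eq_bigr => k _.
by rewrite [veronese _ _ _ _ _]mxE expr1n mul1r inord_val mulrC.
Qed.

End CurvePoints.

(** * The Cohen-Macaulay property *)

Section CohenMacaulay.

Context {K : closedFieldType} {n : nat} (G : incidence K n).
Local Notation S := {mpoly K[n.+1]}.
Local Notation V := (vert G).
Local Notation E := (edge G).
Local Notation I := (curve_ideal G).
Implicit Types (v w : V) (x : E) (f g h u : S) (q : 'I_n.+1 -> K).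

Definition theta1 : S := \sum_(x : E) 'X_(X x).
Definition theta2 : S := \sum_(v : V) 'X_(Y v).
(** The derivative of [py v], coprime to it as the roots are simple. *)
Definition px_sum v : {poly K} := \sum_(x | inc x v) px v x.

Lemma theta1_homog : theta1 \is 1.-homog.
Proof. by apply: rpred_sum => x _; apply: dhomogXU. Qed.
Lemma theta2_homog : theta2 \is 1.-homog.
Proof. by apply: rpred_sum => x _; apply: dhomogXU. Qed.

Lemma phi_theta1 v : phi v theta1 = px_sum v.
Proof.
rewrite /theta1 (rmorph_sum (phi v)) /= /px_sum [RHS]big_mkcond.
apply: eq_bigr => x _; rewrite /phi mmapXU.
by case: ifP => h; [rewrite zetaX | rewrite zeta0 // starX h].
Qed.

Lemma phi_theta2 v : phi v theta2 = py v.
Proof.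
rewrite /theta2 (rmorph_sum (phi v)) /= (bigD1 v) //= /phi mmapXU zetaY big1 ?addr0 //.
by move=> w ne; rewrite mmapXU zeta0 // starY.
Qed.

Lemma px_sum_node v x : inc x v -> (px_sum v).[pos x] = (px v x).[pos x].
Proof.
move=> hx; rewrite horner_sum (bigD1 x) //= big1 ?addr0 // => x' /andP[_ ne].
by apply: px_root => //; rewrite eq_sym.
Qed.

Lemma coprime_px_sum_py v : coprimep (px_sum v) (py v).
Proof.
apply: (big_ind (fun p => coprimep (px_sum v) p)).
- exact: coprimep1.
- by move=> p r hp hr; rewrite coprimepMr hp.
- by move=> x hx; rewrite coprimep_XsubC /root px_sum_node // px_node.
Qed.

Lemma px_sum_neq0 v : px_sum v != 0.
Proof.
have [x hx] := inc_pos v; apply/eqP => e.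
by have := px_node v x; rewrite -px_sum_node // e horner0 eqxx.
Qed.

(** On each component coprimality gives a common quotient U v of g by [px_sum v] and of h by [py v],
    of a degree that lifts to a form of degree k - 1. At a node [px_sum v] takes the value of
    [px v x], the scale in [phi_node], so each lifted form takes there the value of g, and the forms
    glue. *)
Lemma theta_syzygy k g h : g \is k.-homog -> h \is k.-homog ->
  I (g * theta2 - h * theta1) ->
  exists u, [/\ (msize u <= k)%N, I (g - u * theta1) & I (h - u * theta2)].
Proof.
move=> hg hh hI.
have hom : g * theta2 - h * theta1 \is k.+1.-homog.
  by rewrite rpredB ?dhomogM1 ?theta1_homog ?theta2_homog.
have {hI} e v : phi v g * py v = phi v h * px_sum v.
  have /(_ v) := (curve_idealP G hom).1 hI.
  by rewrite rmorphB !rmorphM /= phi_theta1 phi_theta2 => /eqP; rewrite subr_eq0 => /eqP.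
have dv v : py v %| phi v h.
  have := coprime_px_sum_py v; rewrite coprimep_sym => c.
  by rewrite -(Gauss_dvdpl _ c) -e dvdp_mull.
pose U v := phi v h %/ py v.
have hU v : phi v h = U v * py v by rewrite divpK.
have gU v : phi v g = U v * px_sum v.
  by apply: (mulIf (py_neq0 v)); rewrite e hU; ring.
case: k hg hh hom => [|k] hg hh hom.
  have h0 v : U v = 0.
    apply: divp_small; rewrite size_py; apply: leq_ltn_trans (size_phi v hh) _.
    by rewrite mul0n ltnS deg_gt0.
  exists 0; split; first by rewrite msize0.
    by rewrite mul0r subr0; apply/(curve_idealP G hg) => v; rewrite gU h0 mul0r.
  by rewrite mul0r subr0; apply/(curve_idealP G hh) => v; rewrite hU h0 mul0r.
have ex v : exists f, f \is k.-homog /\ phi v f = U v.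
  have [|f hf ef] := @phi_surj _ _ _ v k (U v); last by exists f.
  rewrite size_divp ?py_neq0 // size_py /=; have := size_phi v hh.
  by rewrite mulSn; move: (size _); lia.
have [F hF] := choice ex.
have nodeF v x : inc x v -> (F v).@[node x] = g.@[node x].
  move=> hx; have [h1 h2] := hF v.
  apply: (@mulfI _ ((px v x).[pos x] ^+ k.+1)); first by rewrite expf_neq0 // px_node.
  rewrite -(phi_node hx hg) gU -h2 hornerM (phi_node hx h1) px_sum_node // exprS.
  by ring.
have [u hu phiu] : exists2 u, u \is k.-homog & forall v, phi v u = phi v (F v).
  apply: glue => [v|x v w hv hw]; first by case: (hF v).
  by rewrite !nodeF.
have {}phiu v : phi v u = U v by rewrite phiu; case: (hF v).
exists u; split.
- case: (eqVneq u 0) => [->|u0]; first by rewrite msize0.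
  by rewrite -(mlead_deg u0) (dhomog_mf hu) // mlead_supp.
- have hom1 : g - u * theta1 \is k.+1.-homog by rewrite rpredB // dhomogM1 // theta1_homog.
  apply/(curve_idealP G hom1) => v.
  by rewrite rmorphB rmorphM /= phi_theta1 gU phiu subrr.
- have hom1 : h - u * theta2 \is k.+1.-homog by rewrite rpredB // dhomogM1 // theta2_homog.
  apply/(curve_idealP G hom1) => v.
  by rewrite rmorphB rmorphM /= phi_theta2 hU phiu subrr.
Qed.

Lemma pihomog_gt f k : (msize f <= k)%N -> pihomog mdeg k f = 0.
Proof.
move=> hf; apply/mpolyP => m; rewrite mcoeff_pihomog mcoeff0; case: eqP => // e.
by apply/memN_msupp_eq0/msize_mdeg_ge; rewrite e.
Qed.

Lemma msize_drop_top f k : (msize f <= k.+1)%N -> (msize (f - pihomog mdeg k f) <= k)%N.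
Proof.
move=> hf; rewrite msizeE; apply/bigmax_leqP_seq => m hm _.
rewrite mcoeff_msupp mcoeffB mcoeff_pihomog in hm.
have : (mdeg m < k.+1)%N.
  apply: leq_trans hf; apply: msize_mdeg_lt; rewrite mcoeff_msupp.
  by apply: contra hm => /eqP ->; rewrite if_same subrr.
by rewrite ltnS leq_eqVlt => /orP[e|//]; rewrite e subrr eqxx in hm.
Qed.

(* Reduction to the homogeneous case by looking at the terms of highest degree. *)
Lemma theta_syzygy_affine (al be : K) k g h : (msize g <= k)%N -> (msize h <= k)%N ->
  I (g * (theta2 - be%:MP) - h * (theta1 - al%:MP)) ->
  exists u, I (g - u * (theta1 - al%:MP)).
Proof.
have iI := curve_is_ideal G.
elim: k g h => [|k IH] g h hg hh hI.
  move: hg; rewrite leqn0 msize_poly_eq0 => /eqP ->.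
  by exists 0; rewrite mul0r subrr; apply: ideal0.
have homs f : pihomog mdeg k f \is k.-homog by exact: pihomogP.
pose gk := pihomog mdeg k g; pose hk := pihomog mdeg k h.
have [|u [su h1 h2]] := theta_syzygy (homs g) (homs h).
  have [_ /(_ _ k.+1 hI)] := curve_homog G.
  have top f t : t \is 1.-homog -> pihomog mdeg k.+1 (f * t) = pihomog mdeg k f * t.
    by move=> ht; rewrite -(pihomogM_homog _ _ ht) addn1.
  have low f c : (msize f <= k.+1)%N -> pihomog mdeg k.+1 (f * c%:MP) = 0.
    by move=> hf; rewrite mulrC mul_mpolyC linearZ /= pihomog_gt // scaler0.
  rewrite !mulrBr !raddfB /= !low // !(top _ _ theta1_homog) !(top _ _ theta2_homog).
  by rewrite oppr0 addr0 subr0.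
(* Subtracting u (theta1 - al) from g and u (theta2 - be) from h preserves the relation and cancels
   the top parts modulo I. *)
have [|||u' hu'] := IH (g - gk + al *: u) (h - hk + be *: u).
- rewrite (leq_trans (msizeD_le _ _)) // geq_max msize_drop_top //=.
  exact: leq_trans (msizeZ_le _ _) su.
- rewrite (leq_trans (msizeD_le _ _)) // geq_max msize_drop_top //=.
  exact: leq_trans (msizeZ_le _ _) su.
- have -> : (g - gk + al *: u) * (theta2 - be%:MP) - (h - hk + be *: u) * (theta1 - al%:MP) =
    (g * (theta2 - be%:MP) - h * (theta1 - al%:MP)) -
    (theta2 - be%:MP) * (gk - u * theta1) + (theta1 - al%:MP) * (hk - u * theta2).
    by rewrite -!mul_mpolyC; ring.
  apply: (idealD iI); last exact: (idealMl _ iI).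
  by apply: (idealB iI) => //; apply: (idealMl _ iI).
exists (u + u').
have -> : g - (u + u') * (theta1 - al%:MP) =
    (g - gk + al *: u - u' * (theta1 - al%:MP)) + (gk - u * theta1).
  by rewrite -!mul_mpolyC; ring.
exact: (idealD iI).
Qed.

(** The first element lies in no component ideal, since its degree 1 part restricts to the nonzero
    [px_sum w]; the second is handled by [theta_syzygy_affine]. The constants make both vanish at
    q. *)
Lemma theta_regular v q : cone_point v q ->
  regular_seq I [:: theta1 - (theta1.@[q])%:MP; theta2 - (theta2.@[q])%:MP].
Proof.
move=> hq; have iI := curve_is_ideal G; split.
  move=> h; have : point_ideal q 1.
    apply: ideal_adjoin_min h; first exact: (kernel_ideal (meval q)).
      by move=> f /(_ v); apply: (cone_point_vanish hq).
    by move=> f; rewrite !inE => /orP[]/eqP->; rewrite /point_ideal mevalB mevalC subrr.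
  by rewrite /point_ideal meval1 => /eqP; rewrite oner_eq0.
case=> [|[|//]] _ a /=.
  rewrite ideal_adjoin_nil // => h w; have [_ _ hP] := comp_prime w.
  have /hP [/cone_idealP/(_ 1%N)|//] := h w.
  rewrite raddfB /= (pihomog_dE theta1_homog).
  rewrite [pihomog _ _ _%:MP]pihomog_gt ?msizeC ?subr0; last by case: eqP.
  by rewrite -/(phi w _) phi_theta1 => /eqP; rewrite (negbTE (px_sum_neq0 w)).
move=> /(ideal_adjoin_rcons I [::])[u]; rewrite ideal_adjoin_nil // => hu.
apply/(ideal_adjoin_rcons I [::]).
have [|||w hw] := @theta_syzygy_affine (theta1.@[q]) (theta2.@[q])
  (maxn (msize a) (msize u)) a u.
- exact: leq_maxl.
- exact: leq_maxr.
- by rewrite mulrC.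
by exists w; rewrite ideal_adjoin_nil.
Qed.

(** The ideals generated by initial segments of s form a chain as in [no_chain3]. *)
Lemma depth_le2 (J : set S) s : quadratic_growth J -> is_ideal J ->
  regular_seq J s -> (size s <= 2)%N.
Proof.
move=> hJ iJ [s1 reg]; rewrite leqNgt; apply/negP => h3; apply: s1.
have h : ideal_adjoin J (take 3 s) 1.
  apply: (no_chain3 (J := fun i => ideal_adjoin J (take i s)) (f := fun i => s`_i) hJ).
  - by move=> f hf; apply: ideal_adjoin_sub.
  - by move=> i _; apply: ideal_adjoin_ideal.
  - move=> i hi; apply: ideal_adjoin_min; first exact: ideal_adjoin_ideal.
      by move=> f; apply: ideal_adjoin_sub.
    move=> f hf; apply: ideal_adjoin_mem.
    by rewrite (take_nth 0 (leq_trans hi h3)) mem_rcons inE hf orbT.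
  - move=> i hi; apply: ideal_adjoin_mem.
    by rewrite (take_nth 0) ?mem_rcons ?inE ?eqxx // (leq_trans hi).
  - by move=> i a hi; apply: reg; apply: leq_trans h3.
apply: ideal_adjoin_min h; first exact: ideal_adjoin_ideal.
  by move=> f; apply: ideal_adjoin_sub.
by move=> f /mem_take; apply: ideal_adjoin_mem.
Qed.

(** At the vertex q = 0 the line ideal of q is the point ideal itself, so the line over a node is
    taken instead. *)
Lemma line_lt_point v q : cone_point v q -> exists2 q', cone_point v q' &
  (line_ideal q' `<` point_ideal q)%classic.
Proof.
move=> hq; have [[i qi]|none] := pselect (exists i, q i != 0).
  exists q => //; split; first exact: line_sub_point.
  move=> /(_ ('X_i - (q i)%:MP)); rewrite /point_ideal mevalB mevalXU mevalC subrr.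
  move=> /(_ erefl) /line_idealP /(_ 0%N).
  rewrite raddfB /= (pihomog_ne0 (d := 1)) ?dhomogXU //.
  rewrite pihomog_dE; last by rewrite -[_%:MP]mulr1 mul_mpolyC rpredZ // dhomog1.
  by rewrite sub0r mevalN mevalC => /eqP; rewrite oppr_eq0 (negbTE qi).
have q0 : q = fun _ => 0%R.
  apply/funext => i; apply/eqP; apply: contrapT => /negP h; apply: none; by exists i.
have [x hx] := inc_pos v; exists (node x); first exact: node_cone_point.
rewrite q0; split; first exact: (homog_prime_irrelevant (line_prime _) (line_homog _)).
move=> /(_ 'X_(X x)); rewrite {1}/point_ideal mevalXU => /(_ erefl).
move=> /(cone_ideal_homog _ _ (dhomogXU K (X x))); rewrite mmapXU /node eqxx.
by move/eqP; rewrite oner_eq0.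
Qed.

Lemma curve_cohen_macaulay : cohen_macaulay I.
Proof.
move=> M hM sM; have hP := maximal_prime hM.
have [v sv] := prime_over_curve hP sM.
have [q qE hq] := maximal_over_comp hM sv.
exists 2; split; split.
- exists [:: theta1 - (theta1.@[q])%:MP; theta2 - (theta2.@[q])%:MP]; split=> //.
    by move=> f; rewrite qE !inE => /orP[]/eqP->; rewrite /point_ideal mevalB mevalC subrr.
  exact: theta_regular hq.
- by move=> k [s [<- _ /depth_le2]]; apply; [exact: curve_growth | exact: curve_is_ideal].
- have [q' hq' lt] := line_lt_point hq; have lt' := comp_lt_line hq'.
  exists (fun i => if i == 0%N then comp_ideal v else
    if i == 1%N then line_ideal q' else M); split.
    have sI := @curve_sub _ _ G v.
    case=> [|[|[|//]]] _ /=; split=> //; try exact: comp_prime; try exact: line_prime.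
      by apply: subset_trans sI _; case: lt'.
    by rewrite qE; case: lt.
  by case=> [|[|//]] _ //=; rewrite qE.
- move=> k [c [hc lt]]; apply: (prime_chain_bound (curve_growth G)) lt.
  by move=> i /hc [].
Qed.

End CohenMacaulay.

(** * Cech cohomology of the structure sheaf *)

Section FractionExtension.

Variables (S : idomainType) (L : fieldType) (h : {rmorphism S -> L}).
Implicit Types (x y : {fraction S}).

Definition fdom x := exists ab : S * S,
  h ab.2 != 0 /\ x = tofrac ab.1 / tofrac ab.2.

(** The extension of h to the localization of S at its kernel, with value 0 elsewhere. It is
    independent of the chosen fraction by [fext_frac]. *)
Definition fext x : L :=
  if pselect (fdom x) is left e then
    h (projT1 (cid e)).1 / h (projT1 (cid e)).2 else 0.

Lemma hom_neq0 (b : S) : h b != 0 -> tofrac b != 0.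
Proof. by apply: contraNneq => /eqP; rewrite tofrac_eq0 => /eqP ->; rewrite rmorph0. Qed.

Lemma fdom_frac a b : h b != 0 -> fdom (tofrac a / tofrac b).
Proof. by move=> hb; exists (a, b). Qed.

Lemma fdom_tofrac a : fdom (tofrac a).
Proof. by exists (a, 1); rewrite rmorph1 oner_eq0 tofrac1 divr1. Qed.

Lemma fext_frac a b : h b != 0 -> fext (tofrac a / tofrac b) = h a / h b.
Proof.
move=> hb; rewrite /fext; case: pselect => [e|]; last by case; exact: fdom_frac.
case: cid => -[a' b'] /= [hb' e']; apply/eqP.
rewrite eqr_div // -!rmorphM; apply/eqP; congr (h _); apply/eqP.
by rewrite -tofrac_eq !tofracM -eqr_div ?hom_neq0 // e'.
Qed.

Lemma fext_tofrac a : fext (tofrac a) = h a.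
Proof.
have := @fext_frac a 1; rewrite tofrac1 rmorph1 !divr1; apply; exact: oner_neq0.
Qed.

Lemma fext0 : fext 0 = 0.
Proof. by rewrite -tofrac0 fext_tofrac rmorph0. Qed.

Lemma fextD x y : fdom x -> fdom y -> fdom (x + y) /\ fext (x + y) = fext x + fext y.
Proof.
move=> [[a b] [/= hb ->]] [[c d] [/= hd ->]].
have hbd : h (b * d) != 0 by rewrite rmorphM mulf_neq0.
have e : tofrac a / tofrac b + tofrac c / tofrac d =
    tofrac (a * d + c * b) / tofrac (b * d) :> {fraction S}.
  by rewrite addf_div ?hom_neq0 // tofracD !tofracM.
rewrite e; split; first exact: fdom_frac.
by rewrite !fext_frac // addf_div // rmorphD !rmorphM.
Qed.

Lemma fextM x y : fdom x -> fdom y -> fdom (x * y) /\ fext (x * y) = fext x * fext y.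
Proof.
move=> [[a b] [/= hb ->]] [[c d] [/= hd ->]].
have hbd : h (b * d) != 0 by rewrite rmorphM mulf_neq0.
have e : tofrac a / tofrac b * (tofrac c / tofrac d) =
    tofrac (a * c) / tofrac (b * d) :> {fraction S}.
  by rewrite mulf_div !tofracM.
rewrite e; split; first exact: fdom_frac.
by rewrite !fext_frac // mulf_div !rmorphM.
Qed.

Lemma fextMsign k x : fdom x ->
  fdom ((-1) ^+ k * x) /\ fext ((-1) ^+ k * x) = (-1) ^+ k * fext x.
Proof.
move=> hx; rewrite -[-1]/(- 1 : {fraction S}) -tofrac1 -tofracN -tofracXn.
have [h1 ->] := fextM (fdom_tofrac ((-1) ^+ k)) hx.
by split=> //; rewrite fext_tofrac rmorphXn rmorphN rmorph1.
Qed.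

Lemma fextB x y : fdom x -> fdom y -> fdom (x - y) /\ fext (x - y) = fext x - fext y.
Proof.
move=> hx hy; have := fextMsign 1 hy; rewrite expr1 !mulN1r => -[h1 h2].
by have [h3 ->] := fextD hx h1; rewrite h2.
Qed.

Lemma fext_sum (A : Type) (r : seq A) (P : pred A) (F : A -> {fraction S}) :
  (forall i, P i -> fdom (F i)) ->
  fdom (\sum_(i <- r | P i) F i) /\
  fext (\sum_(i <- r | P i) F i) = \sum_(i <- r | P i) fext (F i).
Proof.
move=> hF; elim: r => [|i r [IH1 IH2]].
  by rewrite !big_nil fext0; split=> //; rewrite -tofrac0; apply: fdom_tofrac.
rewrite !big_cons; case: ifP => // Pi.
by have [h1 ->] := fextD (hF i Pi) IH1; rewrite IH2.
Qed.

End FractionExtension.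

(** * Cech differentials and contracting homotopies *)

Section CechComplex.

Variables (n : nat) (R : comNzRingType).
Implicit Types (c e : {set 'I_n.+1} -> R) (s t : {set 'I_n.+1}) (i j : 'I_n.+1).

Definition sg i t : R := (-1) ^+ #|[set j in t | (j < i)%N]|.

Definition cdiff c t : R := \sum_(i in t) sg i t * c (t :\ i).

(** A weighted contraction: the p i are meant to add up to the identity, and the part selected by p
    i is contracted with the index i. *)
Definition chom (p : 'I_n.+1 -> R -> R) c s : R :=
  \sum_(i | i \notin s) sg i (i |: s) * p i (c (i |: s)).

Lemma sg_sqr i t : sg i t * sg i t = 1.
Proof. by rewrite /sg -expr2 sqrr_sign. Qed.

Lemma sg_swap i j t : i != j -> i \in t -> j \in t ->
  sg j (t :\ i) * sg i (t :\ j) = - (sg i t * sg j t).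
Proof.
have main (a b : 'I_n.+1) : (a < b)%N -> a \in t -> b \in t ->
    sg b (t :\ a) = - sg b t /\ sg a (t :\ b) = sg a t.
  move=> ab ha hb; split; rewrite /sg.
    have -> : [set j in t :\ a | (j < b)%N] = [set j in t | (j < b)%N] :\ a.
      by apply/setP => l; rewrite !inE andbA.
    by rewrite [in RHS](cardsD1 a) inE ha ab exprS mulN1r opprK.
  congr (_ ^+ _); apply: eq_card => l; rewrite !inE.
  by case: (eqVneq l b) => // ->; rewrite ltnNge ltnW //= andbF.
move=> ne hi hj; case: (ltngtP i j) => h; last by rewrite (val_inj h) eqxx in ne.
  by have [-> ->] := main _ _ h hi hj; rewrite mulNr mulrC.
by have [-> ->] := main _ _ h hj hi; rewrite mulrN mulrC.
Qed.

Lemma sg_anti i j t : i != j -> i \in t -> j \in t ->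
  sg i t * sg j (t :\ i) = - (sg j t * sg i (t :\ j)).
Proof.
move=> ne hi hj; have := sg_swap ne hi hj => e.
have := congr1 (fun r => sg i t * sg i (t :\ j) * r) e.
have -> : sg i t * sg i (t :\ j) * (sg j (t :\ i) * sg i (t :\ j)) =
    sg i t * sg j (t :\ i) * (sg i (t :\ j) * sg i (t :\ j)) by ring.
have -> : sg i t * sg i (t :\ j) * - (sg i t * sg j t) =
    - (sg j t * sg i (t :\ j)) * (sg i t * sg i t) by ring.
by rewrite !sg_sqr !mulr1.
Qed.

Lemma cdiff_cdiff e t : cdiff (cdiff e) t = 0.
Proof.
rewrite /cdiff.
pose f i j := sg i t * (sg j (t :\ i) * e (t :\ i :\ j)).
have -> : \sum_(i in t) sg i t * (\sum_(j in t :\ i) sg j (t :\ i) * e (t :\ i :\ j)) =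
    \sum_(i in t) \sum_(j in t | j != i) f i j.
  apply: eq_bigr => i hi; rewrite mulr_sumr; apply: eq_bigl => j.
  by rewrite !inE andbC.
have anti i j : i \in t -> j \in t -> i != j -> f j i = - f i j.
  move=> hi hj ne; rewrite /f !mulrA (sg_anti _ hj hi) 1?eq_sym // mulNr.
  by rewrite (_ : t :\ j :\ i = t :\ i :\ j) //; apply/setP => l; rewrite !inE andbCA.
have -> : \sum_(i in t) \sum_(j in t | j != i) f i j =
    \sum_(i in t) \sum_(j in t | (i < j)%N) f i j +
    \sum_(i in t) \sum_(j in t | (j < i)%N) f i j.
  rewrite -big_split; apply: eq_bigr => i _ /=.
  rewrite (bigID (fun j => (i < j)%N)) /=; congr (_ + _); apply: eq_bigl => j.
    by case: (j \in t) => //=; rewrite -val_eqE /=; case: ltngtP.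
  by case: (j \in t) => //=; rewrite -val_eqE /=; case: ltngtP.
have -> : \sum_(i in t) \sum_(j in t | (j < i)%N) f i j =
    \sum_(i in t) \sum_(j in t | (i < j)%N) f j i.
  rewrite (exchange_big_dep (mem t)) /= => [|i j _ /andP[] //].
  by apply: eq_bigr => j hj; apply: eq_bigl => i; rewrite hj.
rewrite -big_split big1 // => i hi /=.
rewrite -big_split big1 // => j /andP[hj lt] /=.
by rewrite anti ?addNr //; apply/eqP => e1; rewrite e1 ltnn in lt.
Qed.

(** On singletons a constant cochain is the differential of a cochain supported on the empty set. *)
Lemma cdiff_const (y : R) s : #|s| = 2 -> cdiff (fun=> y) s = 0.
Proof.
move=> hs; pose e0 t : R := if #|t| == 0%N then y else 0.
rewrite -[RHS](cdiff_cdiff e0 s); apply: eq_bigr => i hi; congr (_ * _).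
have /eqP/cards1P[j ->] : #|s :\ i| = 1%N by rewrite (cardsD1 i) hi in hs; case: hs.
rewrite /cdiff big_set1 /e0 finset.setDv cards0 eqxx /sg.
rewrite (_ : [set l in [set j] | (l < j)%N] = finset.set0) ?cards0 ?expr0 ?mul1r //.
by apply/setP => l; rewrite !inE; case: eqP => // ->; rewrite ltnn.
Qed.

(** Removing j from s and contracting with j again gives p j (c s). For i outside s, the cocycle
    condition on i |: s turns the mixed terms into p i (c s). *)
Lemma cdiff_chom (p : 'I_n.+1 -> {additive R -> R}) c s :
  (forall i, i \notin s -> p i (cdiff c (i |: s)) = 0) ->
  cdiff (chom p c) s = \sum_i p i (c s).
Proof.
move=> hc; rewrite /cdiff /chom.
have -> : \sum_(j in s) sg j s *
      (\sum_(i | i \notin s :\ j) sg i (i |: s :\ j) * p i (c (i |: s :\ j))) =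
    \sum_(j in s) (p j (c s) + \sum_(i | i \notin s)
      sg j s * (sg i (i |: s :\ j) * p i (c (i |: s :\ j)))).
  apply: eq_bigr => j hj; rewrite mulr_sumr (bigD1 j) ?inE ?eqxx //= finset.setD1K //.
  rewrite mulrA sg_sqr mul1r; congr (_ + _); apply: eq_bigl => i.
  by rewrite !inE; case: (eqVneq i j) => [->|]; rewrite ?hj ?andbT ?andbF.
rewrite big_split /= [RHS](bigID (mem s)) /=; congr (_ + _).
rewrite (exchange_big_dep (fun i => i \notin s)) //=; apply: eq_bigr => i hi.
have psg l t y : p i (sg l t * y) = sg l t * p i y by rewrite /sg raddfMsign.
have := hc i hi; rewrite /cdiff big_setU1 //= finset.setU1K // raddfD psg raddf_sum /=.
set T := \sum_(_ in _) _ => e; rewrite (eq_bigl (mem s)) => [|j]; last by rewrite hi andbT.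
have -> : \sum_(j in s) sg j s * (sg i (i |: s :\ j) * p i (c (i |: s :\ j))) =
   - (sg i (i |: s) * T).
  rewrite /T mulr_sumr -sumrN; apply: eq_bigr => j hj.
  have ne : i != j by apply: contraNneq hi => ->.
  have eS : i |: s :\ j = (i |: s) :\ j.
    apply/setP => l; rewrite !inE; case: (eqVneq l i) => [->|] //=; rewrite ?ne //.
  have hit : i \in i |: s by rewrite !inE eqxx.
  have hjt : j \in i |: s by rewrite !inE hj orbT.
  rewrite psg eS !mulrA -mulNr -(sg_swap ne hit hjt) finset.setU1K //.
have -> : T = - (sg i (i |: s) * p i (c s)).
  by apply/eqP; rewrite -addr_eq0 addrC e.
by rewrite mulrN opprK mulrA sg_sqr mul1r.
Qed.

End CechComplex.

(** * Sections and cochains on the standard charts of projective space *)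

Section Sections.

Variables (K : fieldType) (n : nat).
Local Notation S := {mpoly K[n.+1]}.
Local Notation F := {fraction S}.
Implicit Types (J : set S) (k : int) (s t : {set 'I_n.+1}) (x y : F).

Definition mon N s : S := \prod_(i in s) 'X_i ^+ N.

Lemma cech_diffE (c : {set 'I_n.+1} -> F) t : cech_diff c t = cdiff c t.
Proof. by []. Qed.

Lemma monD N N' s : mon (N + N') s = mon N s * mon N' s.
Proof. by rewrite /mon -big_split; apply: eq_bigr => i _; rewrite exprD. Qed.

Lemma mpolyX_neq0 (m : 'X_{1..n.+1}) : 'X_[m] != 0 :> S.
Proof. by apply/eqP => /(congr1 (mcoeff m)) /eqP; rewrite mcoeffX eqxx mcoeff0 oner_eq0. Qed.

Lemma mon_neq0 N s : mon N s != 0.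
Proof. by apply/prodf_neq0 => i _; rewrite expf_neq0 // mpolyX_neq0. Qed.

Lemma tofrac_mon_neq0 N s : tofrac (mon N s) != 0 :> F.
Proof. by rewrite tofrac_eq0 mon_neq0. Qed.

Lemma mon_homog N s : mon N s \is (N * #|s|).-homog.
Proof.
rewrite /mon -sum1_card big_distrr /=.
elim/big_rec2: _ => [|i d p _ IH]; first exact: dhomog1.
by apply: dhomogM => //; have := dhomogMn N (dhomogXU K i); rewrite mul1n muln1.
Qed.

Lemma mon_subset N s t : s \subset t -> mon N t = mon N s * mon N (t :\: s).
Proof.
move=> /finset.setIidPr e; rewrite /mon (big_setID s) /= e; congr (_ * _).
Qed.

Lemma section_raise J k s x : is_ideal J -> ideal_sheaf_section J k s x ->
  exists N0, forall N, (N0 <= N)%N -> exists a d,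
    [/\ J a, a \is d.-homog, d%:Z = k + (N * #|s|)%N%:Z
      & x = tofrac a / tofrac (mon N s)].
Proof.
move=> iJ [N0 [d [a [Ja ha hd ->]]]]; exists N0 => N leN.
exists (a * mon (N - N0) s), (d + (N - N0) * #|s|)%N; split.
- exact: (idealMr _ iJ).
- by rewrite dhomogM // mon_homog.
- by rewrite PoszD hd -addrA -PoszD -mulnDl subnKC.
- rewrite -/(mon N0 s) -{2}(subnKC leN) monD !tofracM.
  by rewrite -mulf_div divff ?mulr1 // tofrac_mon_neq0.
Qed.

Lemma sectionI J k s N a d : J a -> a \is d.-homog -> d%:Z = k + (N * #|s|)%N%:Z ->
  ideal_sheaf_section J k s (tofrac a / tofrac (mon N s)).
Proof. by move=> Ja ha hd; exists N, d, a. Qed.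

Lemma section0 J k s : is_ideal J -> s != finset.set0 -> ideal_sheaf_section J k s 0.
Proof.
move=> iJ; rewrite -card_gt0 => s0.
(* The exponent |k| makes the degree k + |k| #|s| nonnegative, as s is nonempty. *)
have := @sectionI J k s (absz k) 0 (absz (k + (absz k * #|s|)%N%:Z)) (ideal0 iJ).
rewrite tofrac0 mul0r; apply; first exact: rpred0.
apply/gez0_abs; have : (absz k <= absz k * #|s|)%N by rewrite leq_pmulr.
by move: (_ * _)%N => m; lia.
Qed.

Lemma sectionD J k s x y : is_ideal J ->
  ideal_sheaf_section J k s x -> ideal_sheaf_section J k s y ->
  ideal_sheaf_section J k s (x + y).
Proof.
move=> iJ /(section_raise iJ)[N1 h1] /(section_raise iJ)[N2 h2].
have [a [d [Ja ha hd ->]]] := h1 (maxn N1 N2) (leq_maxl _ _).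
have [b [d' [Jb hb hd' ->]]] := h2 (maxn N1 N2) (leq_maxr _ _).
rewrite -mulrDl -tofracD; apply: (sectionI (d := d)) => //; first exact: (idealD iJ).
by rewrite rpredD //; have <- : d' = d by apply/eqP; rewrite -eqz_nat hd hd'.
Qed.

Lemma sectionMsign J k s j x : is_ideal J ->
  ideal_sheaf_section J k s x -> ideal_sheaf_section J k s ((-1) ^+ j * x).
Proof.
move=> iJ [N [d [a [Ja ha hd ->]]]]; exists N, d, ((-1) ^+ j * a); split=> //.
- exact: (idealMl _ iJ).
- by rewrite -signr_odd; case: odd; rewrite ?expr0 ?mul1r // expr1 mulN1r rpredN.
- by rewrite tofracM tofracXn tofracN tofrac1 mulrA.
Qed.

Lemma sectionB J k s x y : is_ideal J ->
  ideal_sheaf_section J k s x -> ideal_sheaf_section J k s y ->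
  ideal_sheaf_section J k s (x - y).
Proof.
move=> iJ hx hy; apply: sectionD => //.
by have := sectionMsign 1 iJ hy; rewrite expr1 mulN1r.
Qed.

Lemma section_mono J k s t x : is_ideal J -> s \subset t ->
  ideal_sheaf_section J k s x -> ideal_sheaf_section J k t x.
Proof.
move=> iJ st [N [d [a [Ja ha hd ->]]]].
exists N, (d + N * #|t :\: s|)%N, (a * mon N (t :\: s)); split.
- exact: (idealMr _ iJ).
- by rewrite dhomogM // mon_homog.
- rewrite PoszD hd -addrA -PoszD -mulnDr; congr (_ + (_ * _)%N%:Z).
  by rewrite cardsD (finset.setIidPr st) subnKC // subset_leq_card.
- rewrite -!/(mon _ _) (mon_subset _ st) !tofracM -mulf_div divff ?mulr1 //.
  exact: tofrac_mon_neq0.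
Qed.

Lemma section_cdiff J k t (c : {set 'I_n.+1} -> F) : is_ideal J -> t != finset.set0 ->
  (forall i, i \in t -> ideal_sheaf_section J k (t :\ i) (c (t :\ i))) ->
  ideal_sheaf_section J k t (cech_diff c t).
Proof.
move=> iJ t0 hc; apply: big_ind; first exact: section0.
  by move=> *; apply: sectionD.
move=> i hi; apply: sectionMsign => //; apply: section_mono (hc i hi) => //.
exact: finset.subsetDl.
Qed.

Lemma cochain_uniform J k q (c : {set 'I_n.+1} -> F) : is_ideal J ->
  cech_cochain J k q c -> exists N0, forall N, (N0 <= N)%N ->
    exists a : {set 'I_n.+1} -> S, forall s, #|s| = q.+1 ->
    [/\ J (a s), exists2 d, a s \is d.-homog & d%:Z = k + (N * q.+1)%N%:Z
      & c s = tofrac (a s) / tofrac (mon N s)].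
Proof.
move=> iJ hc.
have ex s : exists N0, #|s| = q.+1 -> forall N, (N0 <= N)%N -> exists a d,
    [/\ J a, a \is d.-homog, d%:Z = k + (N * #|s|)%N%:Z
      & c s = tofrac a / tofrac (mon N s)].
  have [e|ne] := pselect (#|s| = q.+1); last by exists 0%N.
  by have [N0 h] := section_raise iJ (hc s e); exists N0.
have [N0 hN0] := choice ex.
exists (\max_s N0 s) => N leN.
have ex2 s : exists a, #|s| = q.+1 -> exists d,
    [/\ J a, a \is d.-homog, d%:Z = k + (N * #|s|)%N%:Z
      & c s = tofrac a / tofrac (mon N s)].
  have [e|ne] := pselect (#|s| = q.+1); last by exists 0.
  have [|a h] := hN0 s e N; last by exists a.
  by apply: leq_trans leN; apply: (leq_bigmax s).
have [a ha] := choice ex2; exists a => s hs.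
by have [d [h1 h2 h3 h4]] := ha s hs; split=> //; exists d => //; rewrite h3 hs.
Qed.

Lemma mon_compl_mpolyX N s : mon N (~: s) = 'X_[[multinom if i \in s then 0%N else N | i < n.+1]].
Proof.
rewrite mpolyXE_id /mon big_mkcond /=; apply: eq_bigr => i _.
by rewrite inE mnmE; case: (i \in s); rewrite ?expr0.
Qed.

Lemma div_mon N s (f : S) d : f \is d.-homog ->
  (forall m, m \in msupp f -> forall i, i \notin s -> (N <= m i)%N) ->
  exists2 g, g \is (d - N * #|~: s|).-homog & f = g * mon N (~: s).
Proof.
move=> hf hs; set M := [multinom if i \in s then 0%N else N | i < n.+1].
have hM m : m \in msupp f -> (M <= m)%MM.
  by move=> /hs h; apply/mnm_lepP => i; rewrite mnmE; case: (boolP (i \in s)) => // /h.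
have dM : mdeg M = (N * #|~: s|)%N.
  have := mon_homog N (~: s); rewrite mon_compl_mpolyX dhomogX => /eqP <- //.
exists (\sum_(m <- msupp f) f@_m *: 'X_[m - M]); last first.
  rewrite mon_compl_mpolyX mulr_suml {1}(mpolyE f) big_seq [RHS]big_seq.
  by apply: eq_bigr => m /hM hm; rewrite -scalerAl -mpolyXD submK.
rewrite big_seq; apply: rpred_sum => m hm; rewrite rpredZ // dhomogX /=.
have := congr1 (@mdeg _) (submK (hM m hm)); rewrite mdegD dM (dhomog_mf hf hm) => <-.
by rewrite addnK.
Qed.

(* Exactness of the complex for the structure sheaf: clearing denominators, each
   monomial m has an exponent m i >= N, hence no pole along x_i, and can be
   contracted with i. *)
Lemma cech_exact k q (c : {set 'I_n.+1} -> F) : (- n%:Z <= k)%R ->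
  cech_cochain setT k q.+1 c ->
  (forall t : {set 'I_n.+1}, #|t| = q.+3 -> cech_diff c t = 0) ->
  exists2 b, cech_cochain setT k q b &
    forall s : {set 'I_n.+1}, #|s| = q.+2 -> c s = cech_diff b s.
Proof.
have iT : is_ideal (setT : set S) by [].
move=> hk hc cocyc; have [N0 hN0] := cochain_uniform iT hc.
(* As k >= -n, a monomial of degree N (n + 1) + k has an exponent at least N. As moreover N > n,
   this degree is at least N n, so N-th powers of up to n variables can be divided out. *)
pose N := (N0 + n).+1; have [a ha] := hN0 N (leqW (leq_addr _ _)).
(* Numerators over the common denominator Z, so that the differential acts on polynomials. *)
pose A s := a s * mon N (~: s).
pose D := (N * n.+1)%N%:Z + k.
have D0 : (0 <= D)%R by rewrite /D /N; nia.
have DE : (`|D|%N)%:Z = D by apply: gez0_abs.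
have homA s : #|s| = q.+2 -> A s \is `|D|%N.-homog.
  move=> hs; have [_ [d h1 h2] _] := ha s hs.
  have -> : `|D|%N = (d + N * #|~: s|)%N.
    apply/eqP; rewrite -eqz_nat DE PoszD h2 /D addrC -addrA -PoszD -mulnDr -hs.
    by rewrite cardsC card_ord.
  by rewrite dhomogM // mon_homog.
have suppA s m : m \in msupp (A s) -> forall i, i \notin s -> (N <= m i)%N.
  rewrite /A mon_compl_mpolyX (perm_mem (msuppMX _ _)) => /mapP[m' _ ->] i hi.
  by rewrite mnmDE mnmE (negbTE hi) leq_addr.
pose Z : S := mon N (finset.setTfor 'I_n.+1).
have ZE s : Z = mon N s * mon N (~: s) by rewrite /Z (mon_subset _ (finset.subsetT s)) finset.setTD.
have cA s : #|s| = q.+2 -> c s = tofrac (A s) / tofrac Z.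
  move=> hs; have [_ _ ->] := ha s hs; rewrite (ZE s) /A !tofracM -mulf_div divff ?mulr1 //.
  exact: tofrac_mon_neq0.
have Z0 : tofrac Z != 0 :> F by apply: tofrac_mon_neq0.
pose sel (m : 'X_{1..n.+1}) : option 'I_n.+1 := [pick i | (N <= m i)%N].
pose pi i : {additive S -> S} := mproj (fun m : 'X_{1..n.+1} => sel m == Some i).
have cocA t : #|t| = q.+3 -> cdiff A t = 0.
  move=> ht; apply/eqP; rewrite -tofrac_eq0 -(mulIr_eq0 _ (mulIf (invr_neq0 Z0))).
  apply/eqP; rewrite -[RHS](cocyc t ht) cech_diffE /cdiff (rmorph_sum (@tofrac S)) mulr_suml.
  apply: eq_bigr => i hi; rewrite cA; last by rewrite (cardsD1 i) hi in ht; case: ht.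
  by rewrite /= tofracM /sg tofracXn tofracN tofrac1 mulrA.
pose B := chom pi A.
have suppPi i f m : m \in msupp (pi i f) -> sel m = Some i /\ m \in msupp f.
  rewrite !mcoeff_msupp /= mcoeff_mproj; case: ifP => [/eqP -> //|_].
  by rewrite eqxx.
have homB s : #|s| = q.+1 -> B s \is `|D|%N.-homog.
  move=> hs; apply: rpred_sum => i hi; rewrite /sg -signr_odd.
  have h : pi i (A (i |: s)) \is `|D|%N.-homog.
    apply/dhomogP => m /suppPi[_ hm]; apply: (dhomog_mf _ hm).
    by apply: homA; rewrite cardsU1 hi hs.
  by case: odd; rewrite ?expr0 ?mul1r // expr1 mulN1r rpredN.
(* B s has no pole outside s: the index removed by the contraction was chosen with exponent at least
   N. *)
have suppB s m : m \in msupp (B s) -> forall i, i \notin s -> (N <= m i)%N.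
  move=> hm; have : (B s)@_m != 0 by rewrite -mcoeff_msupp.
  rewrite /B /chom raddf_sum /= => h.
  have [i hi nz] : exists2 i, i \notin s & (sg S i (i |: s) * pi i (A (i |: s)))@_m != 0.
    apply: contrapT => none; case/eqP: h; apply: big1 => i hi.
    by apply/eqP; apply: contrapT => /negP nz; apply: none; exists i.
  have {nz} : m \in msupp (pi i (A (i |: s))).
    rewrite mcoeff_msupp; apply: contra nz => /eqP e.
    by rewrite /sg -signr_odd; case: odd; rewrite ?expr0 ?mul1r ?expr1 ?mulN1r ?mcoeffN e ?oppr0.
  move=> /suppPi[]; rewrite /sel; case: pickP => // l hl [<-] hmA j hj.
  case: (eqVneq j l) => [->|ne] //.
  by apply: (suppA _ _ hmA); rewrite !inE negb_or ne.
exists (fun s => tofrac (B s) / tofrac Z).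
  move=> s hs; have [g hg ->] := div_mon (homB s hs) (suppB s).
  rewrite (ZE s) !tofracM -mulf_div divff ?mulr1 ?tofrac_mon_neq0 //.
  apply: sectionI hg _ => //.
  have := cardsC s; rewrite card_ord hs => e.
  have h : (N * #|~: s| <= `|D|)%N.
    have : (#|~: s| <= n)%N by lia.
    by move: DE; rewrite /D /N; move: (#|~: s|) => z; move: (`|_|%N) => dd; nia.
  have e2 : (N * n.+1 = N * q.+1 + N * #|~: s|)%N by rewrite -mulnDr e.
  by rewrite -subzn // DE /D e2 PoszD; ring.
move=> s hs; rewrite cA // cech_diffE.
have -> : cdiff (fun s => tofrac (B s) / tofrac Z) s = tofrac (cdiff B s) / tofrac Z.
  rewrite /cdiff (rmorph_sum (@tofrac S)) mulr_suml; apply: eq_bigr => i hi.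
  by rewrite /= tofracM /sg tofracXn tofracN tofrac1 mulrA.
congr (tofrac _ / _); rewrite /B cdiff_chom; last first.
  by move=> i hi; rewrite cocA ?raddf0 // cardsU1 hi hs.
have selS m : m \in msupp (A s) -> exists i, sel m = Some i.
  move=> hm; rewrite /sel; case: pickP => [i _|none]; first by exists i.
  have hd := dhomog_mf (homA s hs) hm; move: hd; rewrite /= mdegE => hd.
  have : (\sum_(i < n.+1) m i <= \sum_(i < n.+1) (N0 + n))%N.
    by apply: leq_sum => i _; rewrite -ltnS ltnNge none.
  rewrite sum_nat_const card_ord hd; move: DE D0; rewrite /D /N.
  by move: (`|_|%N) => dd; nia.
apply/mpolyP => m; rewrite raddf_sum /=; under eq_bigr do rewrite mcoeff_mproj.
case: (boolP (m \in msupp (A s))) => hm; last first.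
  by rewrite (memN_msupp_eq0 hm) big1 // => i _; case: ifP.
have [i e] := selS m hm; rewrite (bigD1 i) //= e eqxx big1 ?addr0 // => j ne.
by case: eqP => // -[h]; rewrite h eqxx in ne.
Qed.

End Sections.

(** * Cech cohomology of the curve *)

Section CurveCohomology.

Context {K : closedFieldType} {n : nat} (G : incidence K n).
Local Notation S := {mpoly K[n.+1]}.
Local Notation V := (vert G).
Local Notation E := (edge G).
Local Notation I := (curve_ideal G).
Local Notation F := {fraction S}.
Local Notation L := {fraction {poly K}}.
Local Notation subset_of := {set 'I_n.+1}.
Implicit Types (v w : V) (x : E) (s t : subset_of) (k : int).

(** The chart of s meets the component of v: no variable in s vanishes identically there. *)
Definition instar v s := [forall i in s, star v i].

Lemma instarP v s : reflect (forall i, i \in s -> star v i) (instar v s).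
Proof. exact: forall_inP. Qed.

Lemma instar_sub v s t : t \subset s -> instar v s -> instar v t.
Proof. by move=> /fintype.subsetP st /instarP h; apply/instarP => i /st /h. Qed.

Lemma instar_setU1 v i s : star v i -> instar v s -> instar v (i |: s).
Proof. by move=> hi /instarP h; apply/instarP => j; rewrite !inE => /orP[/eqP ->|/h]. Qed.

(** Two components have at most one variable in common, the X x of their common edge. *)
Lemma instar_uniq v w s : (1 < #|s|)%N -> instar v s -> instar w s -> v = w.
Proof.
move=> /card_gt1P[i [j [hi hj ne]]] /instarP hv /instarP hw.
apply/eqP; apply: contraNT ne => ne.
have both l : l \in s -> exists x, [/\ l = X x, inc x v & inc x w].
  move=> hl; have := hv _ hl; have := hw _ hl.
  have [[u ->]|[x ->]] := var_cases G l.
    by rewrite !starY => /eqP -> /eqP e; rewrite e eqxx in ne.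
  by rewrite !starX; exists x.
have [x [-> h1 h2]] := both _ hi; have [x' [-> h3 h4]] := both _ hj.
by rewrite (inc_simple ne h1 h2 h3 h4).
Qed.

Definition hv v : {rmorphism S -> L} := @tofrac {poly K} \o phi v.

(** Restriction of a section to the component of v, as a rational function of t. *)
Definition ext v : F -> L := fext (hv v).

Definition zs v s : {poly K} := \prod_(i in s) zeta v i.

Lemma phi_mon v N s : phi v (mon K N s) = zs v s ^+ N.
Proof.
rewrite /mon (rmorph_prod (phi v)) /zs -prodrXl; apply: eq_bigr => i _.
by rewrite /= rmorphXn /= /phi mmapXU.
Qed.

Lemma zs_neq0 v s : instar v s -> zs v s != 0.
Proof. by move=> /instarP h; apply/prodf_neq0 => i /h /zeta_neq0. Qed.

Lemma hv_mon v N s : instar v s -> hv v (mon K N s) != 0.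
Proof. by move=> h; rewrite /= tofrac_eq0 phi_mon expf_neq0 // zs_neq0. Qed.

Lemma ext_frac v N s a : instar v s ->
  ext v (tofrac a / tofrac (mon K N s)) = tofrac (phi v a) / tofrac (zs v s ^+ N).
Proof. by move=> h; rewrite /ext fext_frac ?hv_mon //= phi_mon. Qed.

Lemma iT : is_ideal (setT : set S). Proof. by []. Qed.

Lemma section_dom J k s v z : instar v s -> ideal_sheaf_section J k s z ->
  fdom (hv v) z.
Proof. by move=> h [N [d [a [_ _ _ ->]]]]; apply: fdom_frac; apply: hv_mon. Qed.

Lemma section_setT J k s z : ideal_sheaf_section J k s z ->
  ideal_sheaf_section (setT : set S) k s z.
Proof. by move=> [N [d [a [_ h1 h2 h3]]]]; exists N, d, a. Qed.

Lemma section_curve0 k s v z : instar v s -> ideal_sheaf_section I k s z -> ext v z = 0.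
Proof.
move=> h [N [d [a [Ia ha _ ->]]]]; rewrite -/(mon K N s) ext_frac //.
by rewrite ((curve_idealP G ha).1 Ia v) tofrac0 mul0r.
Qed.

(** On a component that misses the chart some variable in s is zero, so multiplying the numerator by
    the product of the variables in s takes care of it. *)
Lemma section_curve k s z : ideal_sheaf_section (setT : set S) k s z ->
  (forall v, instar v s -> ext v z = 0) -> ideal_sheaf_section I k s z.
Proof.
move=> [N [d [a [_ ha hd ->]]]] h0; rewrite -/(mon K N s) in h0 *.
have homa : a * mon K 1 s \is (d + 1 * #|s|).-homog by rewrite dhomogM // mon_homog.
exists N.+1, (d + 1 * #|s|)%N, (a * mon K 1 s); split=> //.
- apply/(curve_idealP G homa) => v; rewrite rmorphM /= phi_mon expr1.
  have [hs|/forall_inPn[i hi hs]] := boolP (instar v s); last first.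
    by rewrite /zs (bigD1 i) //= zeta0 // mul0r mulr0.
  have := h0 v hs; rewrite ext_frac // => /eqP; rewrite mulf_eq0 invr_eq0 !tofrac_eq0.
  by rewrite (negbTE (expf_neq0 _ (zs_neq0 hs))) orbF => /eqP ->; rewrite mul0r.
- by rewrite PoszD hd mul1n -addrA -PoszD -mulSnr.
- rewrite -/(mon K N.+1 s) (_ : mon K N.+1 s = mon K N s * mon K 1 s).
    by rewrite !tofracM -mulf_div divff ?mulr1 // tofrac_mon_neq0.
  by rewrite -monD addn1.
Qed.

Lemma zeta_dvd_py v i : star v i -> zeta v i %| py v.
Proof.
have [[w ->]|[x ->]] := var_cases G i.
  by rewrite starY => /eqP ->; rewrite zetaY.
by rewrite starX => h; rewrite zetaX // (py_px h) dvdp_mull.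
Qed.

(** Every variable of the star restricts to a divisor of [py v], so its powers serve as denominators
    on all charts. *)
Lemma ext_py v k s z : instar v s -> ideal_sheaf_section (setT : set S) k s z ->
  exists M0, forall M, (M0 <= M)%N -> exists p, ext v z = tofrac p / tofrac (py v ^+ M).
Proof.
move=> hs [N [d [a [_ _ _ ->]]]]; rewrite -/(mon K N s) ext_frac //.
have /dvdpP[c ec] : zs v s %| py v ^+ #|s|.
  rewrite -prodr_const; apply: (big_ind2 (fun a b => a %| b)) => //.
    by move=> *; apply: dvdp_mul.
  by move=> i hi; apply: zeta_dvd_py; apply: (instarP _ _ hs).
exists (#|s| * N)%N => M hM.
exists (phi v a * c ^+ N * py v ^+ (M - #|s| * N)).
have c0 : c != 0 by apply: contraTneq (expf_neq0 #|s| (py_neq0 v)) => c0; rewrite ec c0 mul0r eqxx.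
apply/eqP; rewrite eqr_div ?tofrac_eq0 ?expf_neq0 ?zs_neq0 ?py_neq0 //.
rewrite -!tofracM tofrac_eq -{1}(subnK hM) exprD [py v ^+ (#|s| * N)]exprM ec exprMn.
by apply/eqP; ring.
Qed.

(** Of two variables in the star one is an X x. It lacks only the root pos x of [py v], which the
    other variable supplies; and having degree deg v - 1, it also vanishes at t = infinity. So the
    chart is the affine line without the nodes. *)
Lemma zs_two v s : instar v s -> (1 < #|s|)%N ->
  py v %| zs v s /\ (size (zs v s) <= #|s| * deg v)%N.
Proof.
move=> hs s1.
have other i : i \in s -> exists2 j, j \in s & j != i.
  move=> hi; have : (0 < #|s :\ i|)%N by rewrite (cardsD1 i) hi in s1.
  by move=> /card_gt0P[j]; rewrite !inE => /andP[ne hj]; exists j.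
have [i0 hi0] : exists i, i \in s by apply/card_gt0P; apply: ltnW.
have [x hx hxs] : exists2 x, inc x v & X x \in s.
  have [[w e]|[x e]] := var_cases G i0; last first.
    by exists x; rewrite -?e // -starX -e; apply: (instarP _ _ hs).
  have [j hj ne] := other _ hi0.
  have := instarP _ _ hs j hj; have [[u eu]|[x ex]] := var_cases G j.
    rewrite eu starY => /eqP u1; have := instarP _ _ hs _ hi0; rewrite e starY => /eqP w1.
    by move: ne; rewrite eu e u1 w1 eqxx.
  by rewrite ex starX => h; exists x; rewrite -?ex.
have zE : zs v s = px v x * zs v (s :\ X x).
  by rewrite /zs (big_setD1 (X x)) //= zetaX.
split.
  rewrite zE; have [j hj ne] := other _ hxs.
  rewrite (py_px hx) mulrC dvdp_mul //.
  have hj' : j \in s :\ X x by rewrite !inE ne.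
  rewrite /zs (big_setD1 j) //= dvdp_mulr // dvdp_XsubCl.
  have := instarP _ _ hs j hj; move: ne.
  have [[w ->]|[x' ->]] := var_cases G j.
    by rewrite starY => _ /eqP ->; rewrite zetaY /root py_root.
  rewrite starX (inj_eq (@X_inj _ _ G)) => ne h; rewrite zetaX // /root px_root // eq_sym //.
have szrest : (size (zs v (s :\ X x)) <= ((#|s| - 1) * deg v).+1)%N.
  have := size_phi v (mon_homog K 1 (s :\ X x)); rewrite phi_mon expr1 mul1n.
  by rewrite [in X in (_ <= X -> _)%N](_ : #|s :\ X x| = #|s| - 1)%N // (cardsD1 (X x) s) hxs addKn.
rewrite zE; apply: leq_trans (size_polyMleq _ _) _; rewrite size_px //.
move: szrest; rewrite mulnBl mul1n.
have : (deg v <= #|s| * deg v)%N by rewrite leq_pmull // ltnW.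
by have := deg_gt0 v; move: (_ * _)%N (size _) => A B; lia.
Qed.

(** Poles at the nodes and at t = infinity are allowed on this chart, so a large exponent N makes
    room for any p and any twist k. *)
Lemma section_lift2 k v s p M : instar v s -> (1 < #|s|)%N ->
  exists2 z, ideal_sheaf_section (setT : set S) k s z
    & ext v z = tofrac p / tofrac (py v ^+ M).
Proof.
move=> hs s1; have [/dvdpP[r er] sz] := zs_two hs s1.
pose N := (M + size p + absz k * deg v)%N.
pose d := absz (k + (N * #|s|)%N%:Z).
have dE : d%:Z = k + (N * #|s|)%N%:Z.
  apply: gez0_abs; have : (N <= N * #|s|)%N by rewrite leq_pmulr // ltnW.
  have : (absz k <= absz k * deg v)%N by rewrite leq_pmulr // deg_gt0.
  by rewrite /N; move: (absz k * deg v)%N (_ * #|s|)%N => A B; lia.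
have r0 : r != 0 by apply: contraTneq (zs_neq0 hs) => r0; rewrite er r0 mul0r eqxx.
pose q := p * py v ^+ (N - M) * r ^+ N.
have MN : (M <= N)%N by rewrite /N -addnA leq_addr.
have qE : q * py v ^+ M = p * zs v s ^+ N.
  have eN : py v ^+ N = py v ^+ (N - M) * py v ^+ M by rewrite -exprD subnK.
  by rewrite /q er exprMn eN; ring.
clearbody q.
have [|a ha ea] := @phi_surj _ _ _ v d q.
  have [p0|p0] := eqVneq p 0.
    move/eqP: qE; rewrite p0 mul0r mulf_eq0 (negbTE (expf_neq0 _ (py_neq0 v))) orbF.
    by move/eqP ->; rewrite size_poly0.
  have q0 : q != 0.
    apply/eqP => q0; move/eqP: qE; rewrite q0 mul0r eq_sym mulf_eq0 (negbTE p0).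
    by rewrite expf_eq0 (negbTE (zs_neq0 hs)) andbF.
  have := congr1 (fun a : {poly K} => size a) qE.
  rewrite !size_mul ?expf_neq0 ?py_neq0 ?zs_neq0 //.
  have := size_exp (py v) M; rewrite size_py /= => e1.
  have := size_exp (zs v s) N => e2.
  have n1 : (0 < size (py v ^+ M))%N by rewrite size_poly_gt0 expf_neq0 ?py_neq0.
  have n2 : (0 < size (zs v s ^+ N))%N by rewrite size_poly_gt0 expf_neq0 ?zs_neq0.
  have n3 : (0 < size (zs v s))%N by rewrite size_poly_gt0 zs_neq0.
  have h3 : ((size (zs v s)).-1 * N <= (#|s| * deg v - 1) * N)%N.
    by rewrite leq_mul2r; apply/orP; right; lia.
  have h4 : ((#|s| * deg v - 1) * N = N * #|s| * deg v - N)%N.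
    by rewrite mulnBl mul1n mulnC mulnA.
  have h5 : (N <= N * #|s| * deg v)%N.
    by rewrite -mulnA leq_pmulr // muln_gt0 deg_gt0 ltnW.
  have h6 : (N * #|s| * deg v <= d * deg v + absz k * deg v)%N.
    by rewrite -mulnDl leq_mul2r; apply/orP; right; lia.
  have h7 : (M + size p + absz k * deg v <= N)%N by [].
  move: e1 e2 n1 n2 n3 h3 h4 h5 h6 h7.
  move: (size (py v ^+ M)) (size (zs v s ^+ N)) (size (zs v s)) (size q) (size p) => A B C D P.
  by move: (d * deg v)%N (absz k * deg v)%N (N * #|s| * deg v)%N => A1 A2 A3; lia.
exists (tofrac a / tofrac (mon K N s)); first by apply: (sectionI (d := d)).
rewrite ext_frac // ea; apply/eqP.
rewrite eqr_div ?tofrac_eq0 ?expf_neq0 ?zs_neq0 ?py_neq0 //.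
by rewrite -!tofracM tofrac_eq qE.
Qed.

Lemma ext_cech_diff J k v (b : subset_of -> F) q s : cech_cochain J k q b ->
  #|s| = q.+2 -> instar v s ->
  ext v (cech_diff b s) = cdiff (fun t => ext v (b t)) s.
Proof.
move=> hb hs hsv; have hdom i : i \in s -> fdom (hv v) (b (s :\ i)).
  move=> hi; apply: (@section_dom J k (s :\ i)).
    by apply: (instar_sub _ hsv); apply: finset.subsetDl.
  by apply: hb; rewrite (cardsD1 i) hi in hs; case: hs.
rewrite /ext /cech_diff (fext_sum _ _).2 => [|i /hdom hi]; last exact: (fextMsign _ hi).1.
by apply: eq_bigr => i /hdom hi; have [_ ->] := fextMsign #|[set j in s | (j < i)%N]| hi.
Qed.

End CurveCohomology.

(** * Vanishing of cohomology and regularity of the curve *)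

Section CurveRegularity.

Context {K : closedFieldType} {n : nat} (G : incidence K n).
Local Notation S := {mpoly K[n.+1]}.
Local Notation V := (vert G).
Local Notation E := (edge G).
Local Notation I := (curve_ideal G).
Local Notation F := {fraction S}.
Local Notation L := {fraction {poly K}}.
Local Notation subset_of := {set 'I_n.+1}.
Local Notation sec := (@ideal_sheaf_section K n (setT : set S)).
Implicit Types (v w : V) (x : E) (s t : subset_of) (k : int).

(** All the weight is put on Y v: it belongs to the star of v, so an enlarged index set still meets
    the component. *)
Definition contract v (i : 'I_n.+1) : {additive L -> L} :=
  if i == Y v then (idfun : {additive L -> L}) else (\0 : {additive L -> L}).

Lemma contract_sum v (y : L) : \sum_i contract v i y = y.
Proof.
rewrite (bigD1 (Y v)) //= /contract eqxx big1 ?addr0 // => i ne.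
by rewrite (negbTE ne).
Qed.

Definition chomY v (c : subset_of -> L) := chom (fun i => contract v i) c.

Lemma chomY_in v c s : Y v \in s -> chomY v c s = 0.
Proof.
move=> h; apply: big1 => i hi; rewrite /contract; case: eqP => [e|_].
  by rewrite e h in hi.
by rewrite mulr0.
Qed.

Lemma chomY_notin v c s : Y v \notin s -> chomY v c s = sg L (Y v) (Y v |: s) * c (Y v |: s).
Proof.
move=> h; rewrite /chomY /chom (bigD1 (Y v)) //= /contract eqxx big1 ?addr0 // => i /andP[_ ne].
by rewrite (negbTE ne) mulr0.
Qed.

Lemma cdiff_chomY v (c : subset_of -> L) s :
  (Y v \notin s -> cdiff c (Y v |: s) = 0) -> cdiff (chomY v c) s = c s.
Proof.
move=> h; rewrite /chomY cdiff_chom ?contract_sum // => i hi.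
by rewrite /contract; case: eqP => [e|//]; rewrite e h // -e.
Qed.

(** The contracted cochain lives on index sets with at least two elements. There components do not
    interact, by [instar_uniq], and [section_lift2] lifts it in every twist k. *)
Lemma cech_ge2 k q (b : subset_of -> F) : cech_cochain (setT : set S) k q.+2 b ->
  (forall s, #|s| = q.+4 -> ideal_sheaf_section I k s (cech_diff b s)) ->
  exists2 e, cech_cochain (setT : set S) k q.+1 e &
    forall s, #|s| = q.+3 -> ideal_sheaf_section I k s (b s - cech_diff e s).
Proof.
move=> hb hd.
pose c v s := ext v (b s).
have ex s : exists z, #|s| = q.+2 -> sec k s z /\
    forall v, instar v s -> ext v z = chomY v (c v) s.
  have [hs|ns] := pselect (#|s| = q.+2); last by exists 0.
  have s1 : (1 < #|s|)%N by rewrite hs.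
  have [v hv|none] := pickP (fun v => instar v s); last first.
    exists 0 => _; split; last by move=> v; rewrite none.
    by apply: section0; [exact: iT | rewrite -card_gt0 hs].
  have [p [M ep]] : exists p M, chomY v (c v) s = tofrac p / tofrac (py v ^+ M).
    case: (boolP (Y v \in s)) => hY.
      by exists 0, 0%N; rewrite chomY_in // tofrac0 mul0r.
    have hs' : instar v (Y v |: s) by apply: instar_setU1 hv; rewrite starY.
    have hsec : sec k (Y v |: s) (b (Y v |: s)) by apply: hb; rewrite cardsU1 hY hs.
    have [M0 /(_ M0 (leqnn _)) [p ep]] := ext_py hs' hsec.
    exists ((-1) ^+ #|[set j in Y v |: s | (j < Y v)%N]| * p), M0.
    by rewrite chomY_notin // /c ep /sg (rmorphMsign (@tofrac {poly K})) mulrA.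
  have [z hz ez] := section_lift2 k p M hv s1.
  exists z => _; split=> // w hw; rewrite -(instar_uniq s1 hv hw) ez ep //.
have [e he] := choice ex.
have ce : cech_cochain (setT : set S) k q.+1 e by move=> s /he [].
exists e => // s hs; apply: section_curve.
  apply: (sectionB iT); first exact: hb.
  apply: (section_cdiff iT); first by rewrite -card_gt0 hs.
  by move=> i hi; apply: ce; rewrite (cardsD1 i) hi in hs; case: hs.
move=> v hsv.
have dom1 : fdom (hv v) (b s) by apply: section_dom hsv (hb s hs).
have dom2 : fdom (hv v) (cech_diff e s).
  apply: (section_dom (k := k) (J := setT) hsv); apply: (section_cdiff iT).
    by rewrite -card_gt0 hs.
  by move=> i hi; apply: ce; rewrite (cardsD1 i) hi in hs; case: hs.
rewrite /ext (fextB dom1 dom2).2 -!/(ext v _) (ext_cech_diff ce hs hsv).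
rewrite -[X in X - _]/(c v s) -(@cdiff_chomY v (c v) s) => [|hY].
  apply/eqP; rewrite subr_eq0; apply/eqP; apply: eq_bigr => i hi; congr (_ * _).
  have hs' : #|s :\ i| = q.+2 by rewrite (cardsD1 i) hi in hs; case: hs.
  have [_ ->] := he _ hs'; first by [].
  by apply: (instar_sub _ hsv); apply: finset.subsetDl.
have hs' : #|Y v |: s| = q.+4 by rewrite cardsU1 hY hs.
have hsv' : instar v (Y v |: s) by apply: instar_setU1 hsv; rewrite starY.
by rewrite -(ext_cech_diff hb hs' hsv') (section_curve0 hsv' (hd _ hs')).
Qed.

Lemma coprime_px_pow v x N : inc x v -> coprimep (('X - (pos x)%:P) ^+ N) (px v x ^+ N).
Proof.
move=> hx; apply: coprimep_expl; apply: coprimep_expr.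
by rewrite coprimep_sym coprimep_XsubC /root px_node.
Qed.

(** The Chinese remainder theorem for the coprime moduli (t - pos x)^N; reduction modulo their
    product [py v] ^ N bounds the degree. *)
Lemma chinese_poly v (p : E -> {poly K}) N : exists P : {poly K},
  (size P <= N * deg v)%N /\
  forall x, inc x v -> ('X - (pos x)%:P) ^+ N %| p x - P.
Proof.
have ex x : exists w : {poly K}, inc x v ->
    ('X - (pos x)%:P) ^+ N %| 1 - w /\ px v x ^+ N %| w.
  have [hx|nx] := pselect (inc x v : Prop); last by exists 0.
  have /Bezout_eq1_coprimepP[[u1 u2] /= e] := coprime_px_pow N hx.
  exists (u2 * px v x ^+ N) => _; split; last by rewrite dvdp_mulIr.
  by rewrite -e addrK dvdp_mulIr.
have [w hw] := choice ex.
pose P0 := \sum_(x | inc x v) p x * w x.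
have hP0 x : inc x v -> ('X - (pos x)%:P) ^+ N %| p x - P0.
  move=> hx; have [h1 h2] := hw x hx.
  rewrite /P0 (bigD1 x) //= opprD addrA; apply: dvdp_sub.
    by rewrite -{1}[p x]mulr1 -mulrBr dvdp_mull.
  apply: (big_ind (fun q => ('X - (pos x)%:P) ^+ N %| q)); rewrite ?dvdp0 //.
    by move=> *; apply: dvdp_add.
  move=> x' /andP[hx' ne]; apply: dvdp_mull; have [_ h3] := hw x' hx'.
  apply: dvdp_trans h3; apply: dvdp_exp2r; rewrite dvdp_XsubCl /root.
  by apply/eqP; apply: px_root => //; rewrite eq_sym.
exists (P0 %% py v ^+ N); split.
  rewrite -ltnS; have := ltn_modp P0 (py v ^+ N); rewrite expf_neq0 ?py_neq0 // => h.
  apply: leq_trans h _; have := size_exp (py v) N; rewrite size_py /= => e.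
  have : (0 < size (py v ^+ N))%N by rewrite size_poly_gt0 expf_neq0 ?py_neq0.
  by move: e; rewrite mulnC; move: (size _) => a; lia.
move=> x hx; have := hP0 x hx; rewrite {1}(divp_eq P0 (py v ^+ N)) opprD addrCA => h.
rewrite -(addKr (- (P0 %/ py v ^+ N * py v ^+ N)) (p x - _)); apply: dvdp_add => //.
by rewrite opprK (py_px hx) exprMn mulrCA dvdp_mulIl.
Qed.

(** Contraction with Y v solves the equation with poles at the nodes. Subtracting the constant
    cochain P / py^M, where P approximates all the numerators near the nodes, removes the poles and
    makes the sections vanish there. Such a P has degree below (M + 1) deg v, which the twist 1
    allows on the chart of Y v. *)
Lemma cech_component v (b : subset_of -> F) : cech_cochain (setT : set S) 1 1 b ->
  (forall s, #|s| = 3 -> ideal_sheaf_section I 1 s (cech_diff b s)) ->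
  exists (t : subset_of -> L) (M : nat) (P : {poly K}) (R : E -> {poly K}),
  [/\ forall s, #|s| = 2 -> instar v s -> cdiff t s = ext v (b s),
      t [set Y v]%SET = tofrac P / tofrac (py v ^+ M), (size P <= (M.+1 * deg v).+1)%N
    & forall x, inc x v -> t [set X x]%SET =
        tofrac (('X - (pos x)%:P) * R x) / tofrac (px v x ^+ M)].
Proof.
move=> hb hd; pose c s := ext v (b s).
pose g s := chomY v c s.
have hg s : #|s| = 2 -> instar v s -> cdiff g s = c s.
  move=> hs hsv; apply: cdiff_chomY => hY.
  have hs' : #|Y v |: s| = 3 by rewrite cardsU1 hY hs.
  have hsv' : instar v (Y v |: s) by apply: instar_setU1 hsv; rewrite starY.
  by rewrite -(ext_cech_diff hb hs' hsv') (section_curve0 hsv' (hd _ hs')).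
have form x : exists M0, forall M, (M0 <= M)%N -> exists p, inc x v ->
    g [set X x]%SET = tofrac p / tofrac (py v ^+ M).
  have [hx|nx] := pselect (inc x v : Prop); last by exists 0%N => M _; exists 0.
  have nY : Y v \notin [set X x]%SET by rewrite inE eq_sym XY.
  have hsv : instar v (Y v |: [set X x]%SET).
    apply: instar_setU1; first by rewrite starY.
    by apply/instarP => i; rewrite inE => /eqP ->; rewrite starX.
  have hsec : sec 1 (Y v |: [set X x]%SET) (b (Y v |: [set X x]%SET)).
    by apply: hb; rewrite cardsU1 nY cards1.
  have [M0 hM0] := ext_py hsv hsec; exists M0 => M /hM0[p ep].
  exists ((-1) ^+ #|[set j in Y v |: [set X x]%SET | (j < Y v)%N]| * p) => _.
  by rewrite /g chomY_notin // /c ep /sg (rmorphMsign (@tofrac {poly K})) mulrA.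
have [M0 hM0] := choice form.
pose M := \max_x M0 x.
have form2 x : exists p, inc x v -> g [set X x]%SET = tofrac p / tofrac (py v ^+ M).
  by apply: hM0; apply: (leq_bigmax x).
have [p hp] := choice form2.
(* One order more than the poles, so that the corrected sections vanish at the nodes. *)
have [P [sP hP]] := chinese_poly v p M.+1.
have exR x : exists r, inc x v -> p x - P = r * ('X - (pos x)%:P) ^+ M.+1.
  have [hx|nx] := pselect (inc x v : Prop); last by exists 0.
  by have /dvdpP[r er] := hP x hx; exists r.
have [R hR] := choice exR.
exists (fun s => g s - tofrac P / tofrac (py v ^+ M)), M, (- P), R; split.
- move=> s hs hsv; rewrite -[RHS]/(c s) -(hg s hs hsv) -[RHS]subr0.
  rewrite -{1}(cdiff_const (tofrac P / tofrac (py v ^+ M)) hs) /cdiff -sumrB.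
  by apply: eq_bigr => i _; rewrite mulrBr.
- by rewrite /g chomY_in ?inE // sub0r tofracN mulNr.
- by rewrite size_polyN; apply: leqW.
- move=> x hx; rewrite hp // -mulrBl -tofracB hR //; apply/eqP.
  rewrite eqr_div ?tofrac_eq0 ?expf_neq0 ?py_neq0 ?px_neq0 // -!tofracM tofrac_eq.
  by rewrite (py_px hx) exprMn exprS; apply/eqP; ring.
Qed.

(** The solutions of [cech_component] vanish at the nodes, so on the chart of X x those of the two
    ends of x, with zero on the other components, glue to one section. *)
Lemma cech_1 (b : subset_of -> F) : cech_cochain (setT : set S) 1 1 b ->
  (forall s, #|s| = 3 -> ideal_sheaf_section I 1 s (cech_diff b s)) ->
  exists2 e, cech_cochain (setT : set S) 1 0 e &
    forall s, #|s| = 2 -> ideal_sheaf_section I 1 s (b s - cech_diff e s).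
Proof.
move=> hb hd.
have ex1 v : exists d : (subset_of -> L) * nat * {poly K} * (E -> {poly K}),
  [/\ forall s, #|s| = 2 -> instar v s -> cdiff d.1.1.1 s = ext v (b s),
      d.1.1.1 [set Y v]%SET = tofrac d.1.2 / tofrac (py v ^+ d.1.1.2),
      (size d.1.2 <= (d.1.1.2.+1 * deg v).+1)%N
    & forall x, inc x v -> d.1.1.1 [set X x]%SET =
        tofrac (('X - (pos x)%:P) * d.2 x) / tofrac (px v x ^+ d.1.1.2)].
  by have [t [M [P [R h]]]] := cech_component v hb hd; exists (t, M, P, R).
have [D hD] := choice ex1.
have lift i : exists z, sec 1 [set i]%SET z /\
    forall v, star v i -> ext v z = (D v).1.1.1 [set i]%SET.
  have [[v ->]|[x ->]] := var_cases G i.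
    have [_ e1 sz _] := hD v.
    have [a ha ea] := phi_surj sz.
    exists (tofrac a / tofrac (mon K (D v).1.1.2 [set Y v]%SET)); split.
      by apply: sectionI ha _; rewrite // cards1 muln1.
    move=> w; rewrite starY => /eqP <-; rewrite e1 ext_frac ?ea.
      by rewrite /zs big_set1 zetaY.
    by apply/instarP => i'; rewrite inE => /eqP ->; rewrite starY.
  (* Large enough for the numerators to fit in degree N + 1, and strictly above each pole order, so
     that a power of [px v x] makes them vanish at the other nodes. *)
  pose N := (\max_v ((D v).1.1.2 + size ((D v).2 x)).+1)%N.
  pose num v := (('X - (pos x)%:P) * (D v).2 x * px v x ^+ (N - (D v).1.1.2)).
  have NM v : ((D v).1.1.2 + size ((D v).2 x) < N)%N by apply: (leq_bigmax v).
  have exA v : exists a : S, a \is N.+1.-homog /\ phi v a = if inc x v then num v else 0.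
    case: (boolP (inc x v)) => hx; last by exists 0; rewrite rpred0 rmorph0.
    have [|a ha ea] := @phi_surj _ _ _ v N.+1 (num v); last by exists a.
    rewrite /num; apply: leq_trans (size_polyMleq _ _) _.
    have h1 := size_poly_exp_leq (px v x) (N - (D v).1.1.2).
    have h2 := size_polyMleq ('X - (pos x)%:P) ((D v).2 x).
    rewrite size_px // in h1; rewrite size_XsubC in h2.
    have h3 : ((deg v).-1 * (N - (D v).1.1.2) <= (deg v).-1 * N)%N.
      by rewrite leq_mul2l leq_subr orbT.
    have h4 : (N.+1 * deg v = (deg v).-1 * N + N + deg v)%N.
      by have := deg_gt0 v; case: (deg v) => // dd _ /=; lia.
    have h5 := NM v; have h6 := deg_gt0 v; rewrite h4.
    move: h1 h2 h3 h5 h6.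
    move: (size (px v x ^+ _)) (size (_ * (D v).2 x)) (size ((D v).2 x)) => a1 a2 a3.
    by move: (_ * (N - _))%N ((deg v).-1 * N)%N => a4 a5; lia.
  have [A hA] := choice exA.
  have nodeA v x' : inc x' v -> (A v).@[node x'] = 0.
    move=> hx'; have [h1 h2] := hA v; have := phi_node hx' h1; rewrite h2.
    have -> : (if inc x v then num v else 0).[pos x'] = 0.
      case: ifP => hx; last by rewrite horner0.
      rewrite /num !hornerM horner_exp; case: (eqVneq x' x) => [->|ne].
        by rewrite hornerXsubC subrr !mul0r.
      rewrite (_ : (px v x).[pos x'] = 0) ?px_root // expr0n.
      rewrite (_ : (N - _ == 0)%N = false) ?mulr0 //.
      by apply/negbTE; rewrite -lt0n subn_gt0; apply: leq_ltn_trans (NM v); apply: leq_addr.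
    move/esym/eqP; rewrite mulf_eq0 expf_eq0 (negbTE (px_node v x')) andbF /=.
    by move/eqP.
  have [|u v w h1 h2|a ha ea] := @glue _ _ G N.+1 A; first by move=> v; case: (hA v).
    by rewrite !nodeA.
  exists (tofrac a / tofrac (mon K N [set X x]%SET)); split.
    by apply: sectionI ha _; rewrite // cards1 muln1.
  move=> v; rewrite starX => hx; rewrite ext_frac; last first.
    by apply/instarP => i'; rewrite inE => /eqP ->; rewrite starX.
  have [_ _ _ ->] := hD v => //; have [_] := hA v; rewrite ea hx => ->.
  rewrite /zs big_set1 zetaX //; apply/eqP.
  rewrite eqr_div ?tofrac_eq0 ?expf_neq0 ?px_neq0 // -!tofracM tofrac_eq /num.
  have eN : px v x ^+ N = px v x ^+ (N - (D v).1.1.2) * px v x ^+ (D v).1.1.2.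
    by rewrite -exprD subnK //; apply: ltnW; apply: leq_ltn_trans (NM v); apply: leq_addr.
  by rewrite eN mulrA.
have [z hz] := choice lift.
pose e s : F := if [pick i | i \in s] is Some i then z i else 0.
have eE i : e [set i]%SET = z i.
  rewrite /e; case: pickP => [j|/(_ i)]; first by rewrite inE => /eqP ->.
  by rewrite inE eqxx.
have ce : cech_cochain (setT : set S) 1 0 e.
  by move=> s /eqP/cards1P[i ->]; rewrite eE; case: (hz i).
exists e => // s hs; have s0 : s != finset.set0 by rewrite -card_gt0 hs.
have hi1 i : i \in s -> #|s :\ i| = 1%N by move=> hi; rewrite (cardsD1 i) hi in hs; case: hs.
have sece : sec 1 s (cech_diff e s).
  by apply: (section_cdiff iT) => // i /hi1 h; apply: ce.
apply: section_curve; first by apply: (sectionB iT); [exact: hb | exact: sece].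
move=> v hsv; rewrite /ext (fextB (section_dom hsv (hb s hs)) (section_dom hsv sece)).2.
rewrite -!/(ext v _) (ext_cech_diff ce hs hsv); have [h1 _ _ _] := hD v.
rewrite -h1 //; apply/eqP; rewrite subr_eq0; apply/eqP; apply: eq_bigr => i hi.
congr (_ * _); have /eqP/cards1P[j ej] := hi1 i hi; rewrite ej eE.
have [_ ->] := hz j; first by [].
apply: (instarP _ _ hsv); have : j \in s :\ i by rewrite ej inE.
by rewrite !inE => /andP[].
Qed.

Lemma dvd_prod_pow (r : seq E) N (A : {poly K}) : uniq r ->
  (forall x, x \in r -> ('X - (pos x)%:P) ^+ N %| A) ->
  \prod_(x <- r) ('X - (pos x)%:P) ^+ N %| A.
Proof.
elim: r => [|x r IH]; first by rewrite big_nil dvd1p.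
move=> /= /andP[nx ur] h; rewrite big_cons Gauss_dvdp.
  rewrite h ?mem_head //=; apply: IH => // x' hx'.
  by apply: h; rewrite inE hx' orbT.
rewrite big_seq; apply: (big_ind (fun p => coprimep _ p)).
- exact: coprimep1.
- by move=> p q hp hq; rewrite coprimepMr hp.
- move=> x' hx'; apply: coprimep_expl; apply: coprimep_expr.
  rewrite coprimep_XsubC /root hornerXsubC subr_eq0.
  by apply: contraNneq nx => /(@pos_inj _ _ G) <-.
Qed.

Lemma py_pow_dvd v N (A : {poly K}) :
  (forall x, inc x v -> ('X - (pos x)%:P) ^+ N %| A) -> py v ^+ N %| A.
Proof.
move=> h; rewrite /py -prodrXl.
have -> : \prod_(x | inc x v) ('X - (pos x)%:P) ^+ N =
    \prod_(x <- enum [pred x | inc x v]) ('X - (pos x)%:P) ^+ N by rewrite big_enum.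
by apply: dvd_prod_pow; [exact: enum_uniq | move=> x; rewrite mem_enum => /h].
Qed.

Lemma cdiff_pair0 (c : subset_of -> L) i j : i != j -> cdiff c (i |: [set j]) = 0 ->
  c [set i] = c [set j].
Proof.
move=> ne hc; have hs : #|i |: [set j]%SET| = 2 by rewrite cardsU1 inE ne cards1.
have : cdiff (fun s => c s - c [set i]%SET) (i |: [set j]%SET) = 0.
  rewrite -[RHS](subrr (0 : L)) -{1}hc -(cdiff_const (c [set i]%SET) hs) /cdiff -sumrB.
  by apply: eq_bigr => l _; rewrite mulrBr.
have nij : i \notin [set j] by rewrite inE.
rewrite /cdiff big_setU1 //= big_set1 finset.setU1K //.
have -> : (i |: [set j]%SET) :\ j = [set i]%SET.
  by apply/setP => l; rewrite !inE; case: (eqVneq l j) => [->|]; rewrite ?orbF // eq_sym (negbTE ne).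
rewrite subrr mulr0 addr0 => /(congr1 (fun y => sg L i (i |: [set j]%SET) * y)).
by rewrite mulr0 mulrA sg_sqr mul1r => /eqP; rewrite subr_eq0 => /eqP.
Qed.

Lemma instar1 v i : instar v [set i] = star v i.
Proof.
apply/instarP/idP => [|h j]; last by rewrite inE => /eqP ->.
by apply; rewrite inE.
Qed.

(** On component v the fractions on all charts agree. Comparing the charts of Y v and X x removes
    the pole at each node, which leaves a polynomial, of degree at most k deg v by the chart of Y v.
    The chart of X x prescribes one value at the node for both ends of x, so the lifted forms
    glue. *)
Lemma cech_0 (k : nat) (b : subset_of -> F) : cech_cochain (setT : set S) k 0 b ->
  (forall s, #|s| = 2 -> ideal_sheaf_section I k s (cech_diff b s)) ->
  exists2 f : S, f \is k.-homog &
    forall i, ideal_sheaf_section I k [set i]%SET (b [set i]%SET - tofrac f).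
Proof.
move=> hb hd; have [N /(_ N (leqnn _)) [a0 ha0]] := cochain_uniform iT hb.
pose a i := a0 [set i]%SET.
have ha i : a i \is (k + N).-homog.
  have [|_ [d h e] _] := ha0 [set i]%SET; first by rewrite cards1.
  by have -> : (k + N = d)%N by lia.
have bE i : b [set i]%SET = tofrac (a i) / tofrac (mon K N [set i]%SET).
  by have [|_ _ ->] := ha0 [set i]%SET; first by rewrite cards1.
have extb v i : star v i -> ext v (b [set i]%SET) = tofrac (phi v (a i)) / tofrac (zeta v i ^+ N).
  by move=> hi; rewrite bE ext_frac ?instar1 // /zs big_set1.
have same v i j : star v i -> star v j ->
    phi v (a i) * zeta v j ^+ N = phi v (a j) * zeta v i ^+ N.
  move=> hi hj; have [->//|ne] := eqVneq i j; apply/eqP.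
  rewrite -tofrac_eq !tofracM -eqr_div ?tofrac_eq0 ?expf_neq0 ?zeta_neq0 //.
  rewrite -!extb //; apply/eqP.
  apply: (@cdiff_pair0 (fun s => ext v (b s)) _ _ ne).
  have hs : #|i |: [set j]%SET| = 2 by rewrite cardsU1 inE ne cards1.
  have hsv : instar v (i |: [set j]%SET) by apply: instar_setU1; rewrite ?instar1.
  by rewrite -(ext_cech_diff hb hs hsv) (section_curve0 hsv (hd _ hs)).
have exP v : exists P : {poly K}, (size P <= (k * deg v).+1)%N /\
    forall i, star v i -> phi v (a i) = P * zeta v i ^+ N.
  have sY : star v (Y v) by rewrite starY.
  have dY : py v ^+ N %| phi v (a (Y v)).
    apply: py_pow_dvd => x hx; apply/dvdpP; exists (phi v (a (X x))).
    have h := @same v (Y v) (X x) sY; rewrite starX in h; have := h hx.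
    rewrite zetaY zetaX // (py_px hx) exprMn mulrA => e.
    exact: (mulIf (expf_neq0 N (px_neq0 v x)) e).
  have /dvdpP[P eP] := dY; exists P; split.
    have [P0|P0] := eqVneq P 0; first by rewrite P0 size_poly0.
    have := size_phi v (ha (Y v)); rewrite eP size_mul ?expf_neq0 ?py_neq0 //.
    have := size_exp (py v) N; rewrite size_py /= mulnDl (mulnC (deg v)).
    have : (0 < size (py v ^+ N))%N by rewrite size_poly_gt0 expf_neq0 ?py_neq0.
    by move: (size (py v ^+ _)) (size P) (N * _)%N (k * _)%N => A B C D; lia.
  move=> i hi; apply: (mulIf (expf_neq0 N (py_neq0 v))).
  by rewrite -{1}zetaY (same v i (Y v)) // eP; ring.
have [P hP] := choice exP.
have exf v : exists f, f \is k.-homog /\ phi v f = P v.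
  by have [sP _] := hP v; have [f hf ef] := phi_surj sP; exists f.
have [f hf] := choice exf.
have nodef v x : inc x v -> (f v).@[node x] = (a (X x)).@[node x].
  move=> hx; have [h1 h2] := hf v; have [_ h3] := hP v.
  apply: (@mulfI _ ((px v x).[pos x] ^+ (k + N))); first by rewrite expf_neq0 // px_node.
  rewrite -(phi_node hx (ha _)) h3 ?starX // zetaX // hornerM horner_exp -h2.
  by rewrite (phi_node hx h1) exprD; ring.
have [|x v w hv hw|g hg eg] := @glue _ _ G k f; first by move=> v; case: (hf v).
  by rewrite !nodef.
exists g => // i.
have homX : g * mon K N [set i]%SET \is (k + N).-homog.
  by rewrite dhomogM //; have := mon_homog K N [set i]%SET; rewrite cards1 muln1.
have -> : b [set i]%SET - tofrac g =
    tofrac (a i - g * mon K N [set i]%SET) / tofrac (mon K N [set i]%SET).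
  by rewrite bE tofracB tofracM mulrBl mulfK // tofrac_mon_neq0.
apply: section_curve.
  apply: (sectionI (d := (k + N)%N)) => //; first by rewrite rpredB ?ha.
  by rewrite cards1 muln1.
move=> v; rewrite instar1 => hi; rewrite ext_frac ?instar1 // rmorphB rmorphM /= phi_mon.
have [_ ef] := hf v; have [_ h3] := hP v.
by rewrite eg ef h3 // /zs big_set1 subrr tofrac0 mul0r.
Qed.

Lemma cech_diff_cdiff (e : subset_of -> F) s : cech_diff (cech_diff e) s = 0.
Proof. exact: cdiff_cdiff. Qed.

(** The connecting step from the curve to its ideal sheaf: b is a cocycle on the curve, and
    subtracting a coboundary, or a global form when q = 0, moves it into I without changing its
    differential. *)
Lemma curve_cech q (b : subset_of -> F) :
  cech_cochain (setT : set S) (3 - q.+1%:Z) q b ->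
  (forall s, #|s| = q.+2 -> ideal_sheaf_section I (3 - q.+1%:Z) s (cech_diff b s)) ->
  exists2 b', cech_cochain I (3 - q.+1%:Z) q b' &
    forall s, #|s| = q.+2 -> cech_diff b' s = cech_diff b s.
Proof.
have conclude q' k (e : subset_of -> F) :
    (forall s, #|s| = q'.+2 -> ideal_sheaf_section I k s (b s - cech_diff e s)) ->
    exists2 b', cech_cochain I k q'.+1 b' &
      forall s, #|s| = q'.+3 -> cech_diff b' s = cech_diff b s.
  move=> he; exists (fun s => b s - cech_diff e s) => // s hs.
  rewrite -[RHS]subr0 -(cech_diff_cdiff e s) /cech_diff -sumrB.
  by apply: eq_bigr => i _; rewrite mulrBr.
case: q => [|[|q]] hb hd.
- have [f hf h] := cech_0 (k := 2) hb hd.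
  exists (fun s => b s - tofrac f).
    by move=> s /eqP/cards1P[i ->]; apply: h.
  move=> s hs; rewrite -[RHS]subr0 /cech_diff.
  rewrite -[X in _ = _ - X](cdiff_const (tofrac f) hs) -sumrB.
  by apply: eq_bigr => i _; rewrite mulrBr.
- by have [e _ he] := cech_1 hb hd; apply: conclude he.
- by have [e _ he] := cech_ge2 hb hd; apply: conclude he.
Qed.

Lemma curve_regular3 : is_regular_at I 3.
Proof.
move=> q c hc cocyc; have iI := curve_is_ideal G.
(* For q >= n no index set has q + 2 elements; for q < n the twist is at least -n, as [cech_exact]
   requires. *)
have [hq|hq] := ltnP n q.+1.
  exists (fun=> 0) => s hs; first by apply: section0; rewrite // -card_gt0 hs.
  by have := max_card (mem s); rewrite hs card_ord; lia.
have hcT : cech_cochain (setT : set S) (3 - q.+1%:Z) q.+1 c.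
  by move=> s /hc /section_setT.
have [|b hb eb] := cech_exact _ hcT cocyc; first by lia.
have [|b' hb' eb'] := curve_cech hb; first by move=> s hs; rewrite -eb //; apply: hc.
by exists b' => // s hs; rewrite eb' // eb.
Qed.

(* A Laurent monomial with only negative exponents survives in the top
   cohomology of the ideal sheaf, as a multiple of a product of two vertex
   variables. *)
Lemma curve_regular_ge0 (v0 : V) k : is_regular_at I k -> (0 <= k)%R.
Proof.
move=> hk; rewrite leNgt; apply/negP => k0.
have [x0 _] := inc_pos v0; have [v [w [ne _ _ _]]] := inc_ends x0.
have n0 : (0 < n)%N.
  rewrite lt0n; apply/eqP => n0.
  have hX := ltn_ord (X x0); have hY := ltn_ord (Y v).
  have /eqP : X x0 = Y v by apply: val_inj => /=; lia.
  by rewrite XY.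
have nq : n.-1.+1 = n by rewrite prednK.
pose N := (absz k).+2.
pose r := (absz k).-1.
(* Divided by the N-th power of all variables, m has exponents -1, except -1 - r at X x0; with r =
   -k - 1 its degree is k - n. *)
pose m := [multinom (if i == X x0 then N - 1 - r else N - 1)%N | i < n.+1].
have mlt i : (m i < N)%N by rewrite mnmE; case: ifP => _; rewrite /N; lia.
have degm : (mdeg m)%:Z = (k - n.-1.+1%:Z) + (N * n.+1)%N%:Z.
  have : (mdeg m + r = (N - 1) * n.+1)%N.
    rewrite mdegE (bigD1 (X x0)) //= mnmE eqxx.
    rewrite (eq_bigr (fun=> N - 1)%N); last by move=> i /negbTE ni; rewrite mnmE ni.
    rewrite sum_nat_const (_ : #|_| = n).
      by rewrite /N /r; move: (absz k) => kk; nia.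
    have c1 : #|predC1 (X x0)| = n by rewrite cardC1 card_ord.
    by rewrite -[RHS]c1; apply: eq_card.
  rewrite nq; have -> : (N * n.+1 = (N - 1) * n.+1 + n.+1)%N by rewrite -mulSnr /N subn1.
  by rewrite /r; move: ((N - 1) * n.+1)%N (mdeg m) => A B; lia.
have Im : I 'X_[m].
  have hom : 'X_[m] \is [in K[n.+1], (mdeg m).-homog] by rewrite dhomogX.
  apply/(curve_idealP G hom) => u; rewrite /phi mmapX /mmap1.
  have zero y : y != u -> \prod_(i < n.+1) zeta u i ^+ m i = 0.
    move=> yu; rewrite (bigD1 (Y y)) //= zeta0 ?starY // expr0n mnmE [Y y == _]eq_sym XY.
    by rewrite mul0r.
  by case: (eqVneq v u) => [e|/zero //]; apply: (zero w); rewrite -e eq_sym.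
have full : #|finset.setTfor 'I_n.+1| = n.-1.+2 by rewrite cardsT card_ord nq.
have iI := curve_is_ideal G.
have onlyT s : #|s| = n.-1.+2 -> s = finset.setTfor 'I_n.+1.
  by move=> hs; apply/eqP; rewrite eqEcard finset.subsetT hs full leqnn.
have [||b hb eb] := hk n.-1 (fun s => tofrac 'X_[m] / tofrac (mon K N s)).
- move=> s hs; apply: (sectionI (d := mdeg m)) => //; first by rewrite dhomogX.
  by rewrite hs nq degm nq.
- by move=> t ht; have := max_card (mem t); rewrite ht card_ord; lia.
have [N0 hN0] := cochain_uniform iI hb.
have [a ha] := hN0 (N0 + N)%N (leq_addr _ _).
have := eb _ full; set T := finset.setTfor 'I_n.+1.
pose B (i : 'I_n.+1) : S := (-1) ^+ #|[set j in T | (j < i)%N]| * a (T :\ i).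
have -> : cech_diff b T =
    tofrac (\sum_i B i * 'X_i ^+ (N0 + N)) / tofrac (mon K (N0 + N) T).
  rewrite (rmorph_sum (@tofrac S)) mulr_suml /cech_diff; apply: eq_big => [i|i _].
    by rewrite inE.
  have [|_ _ ->] := ha (T :\ i).
    by have := full; rewrite (cardsD1 i) inE => -[].
  have -> : mon K (N0 + N) T = mon K (N0 + N) (T :\ i) * 'X_i ^+ (N0 + N).
    by rewrite mulrC /mon (big_setD1 i) ?inE.
  rewrite /B /= !tofracM -[X in _ = X * _]mulrA -mulrA -mulf_div -!mulrA mulrA.
  rewrite tofracXn tofracN tofrac1 divff ?mulr1 //.
  by rewrite tofrac_eq0 expf_neq0 // mpolyX_neq0.
move/eqP; rewrite eqr_div ?tofrac_mon_neq0 // -!tofracM tofrac_eq.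
rewrite monD mulrA -subr_eq0 -mulrBl mulf_eq0 (negbTE (mon_neq0 _ _ _)) orbF subr_eq0.
move=> /eqP e.
have monE : mon K N0 T = 'X_[[multinom N0 | i < n.+1]].
  rewrite mpolyXE_id /mon; apply: eq_big => [i|i _]; first by rewrite inE.
  by rewrite mnmE.
(* This coefficient is 1 on the left. On the right each term is a multiple of some x_i^(N0 + N),
   while every m i is below N. *)
have := congr1 (fun f : S => f@_([multinom N0 | i < n.+1] + m)) e.
rewrite monE mcoeffMX mcoeffX eqxx raddf_sum /= big1 => [/eqP|i _].
  by rewrite oner_eq0.
apply: memN_msupp_eq0; rewrite mpolyXn (perm_mem (msuppMX _ _)).
apply/negP => /mapP[m' _ e'].
have := congr1 (fun l : 'X_{1..n.+1} => l i) e'.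
rewrite !mnmDE mulmnE mnm1E eqxx mul1n [[multinom _ | _ < _] _]mnmE; have := mlt i; lia.
Qed.

(** The least value exists because admissible values are nonnegative and 3 is one of them. *)
Lemma curve_regularity (v0 : V) : exists2 r : int, has_regularity I r & (r <= 3)%R.
Proof.
pose P (m : nat) := `[< is_regular_at I m%:Z >].
have ex : exists m, P m by exists 3%N; apply/asboolP; exact: curve_regular3.
have [m /asboolP hm hmin] := ex_minnP ex.
exists m%:Z; last by apply: (hmin 3%N); apply/asboolP; exact: curve_regular3.
split=> // k hk; have := curve_regular_ge0 v0 hk; case: k hk => // k hk _.
by rewrite lez_nat; apply: hmin; apply/asboolP.
Qed.

End CurveRegularity.

(** * Local rings *)

Lemma divf_mulVK (F : fieldType) (a b : F) : a != 0 -> b != 0 -> a / b * (b / a) = 1.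
Proof. by move=> ha hb; rewrite mulrA divfK // divff. Qed.

Lemma fraction_add (A : comNzRingType) (x y a a' b b' : A) : x * b = a -> y * b' = a' ->
  (x + y) * (b * b') = a * b' + a' * b.
Proof. by move=> <- <-; ring. Qed.
Lemma fraction_mul (A : comNzRingType) (x y a a' b b' : A) : x * b = a -> y * b' = a' ->
  x * y * (b * b') = a * a'.
Proof. by move=> <- <-; ring. Qed.

Section LocalRing.

Context {K : closedFieldType} {n : nat}.
Variables (p : 'rV[K]_n.+1) (z : 'I_n.+1) (pz : p 0 z != 0).
Local Notation S := {mpoly K[n.+1]}.
Local Notation F := {fraction S}.
Local Notation R := (local_ring p).
Local Notation "f @p" := (f.@[fun i => p 0 i]) (at level 2, format "f @p").
Implicit Types (f g a b : S) (x y : R).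

Lemma valM x y : val (x * y) = val x * val y.
Proof. exact: (rmorphM (val : {rmorphism R -> F})). Qed.
Lemma valD x y : val (x + y) = val x + val y.
Proof. exact: (rmorphD (val : {rmorphism R -> F})). Qed.
Lemma valB x y : val (x - y) = val x - val y.
Proof. exact: (rmorphB (val : {rmorphism R -> F})). Qed.
Lemma val1 : val (1 : R) = 1.
Proof. exact: (rmorph1 (val : {rmorphism R -> F})). Qed.

Lemma loc_exists d a b : a \is d.-homog -> b \is d.-homog -> b@p != 0 ->
  exists x : R, val x = tofrac a / tofrac b.
Proof.
move=> ha hb pb; have h : tofrac a / tofrac b \in in_local_ring p.
  by apply/asboolP; exists d, a, b.
by exists (Sub (tofrac a / tofrac b) h : R).
Qed.

Lemma peval_neq0 b : b@p != 0 -> tofrac b != 0 :> F.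
Proof. exact: (@hom_neq0 _ _ (meval _)). Qed.

Lemma loc_const_in (c : K) : (tofrac c%:MP : F) \in in_local_ring p.
Proof.
apply/asboolP; exists 0%N, c%:MP, 1; split.
- by rewrite -[_%:MP]mulr1 mul_mpolyC rpredZ // dhomog1.
- exact: dhomog1.
- by rewrite /peval meval1 oner_eq0.
- by rewrite tofrac1 divr1.
Qed.

Definition loc_const (c : K) : R := Sub (tofrac c%:MP) (loc_const_in c).

Lemma loc_const_additive : additive loc_const.
Proof. by move=> c d; apply: val_inj; rewrite valB /= rmorphB tofracB. Qed.
Lemma loc_const_multiplicative : multiplicative loc_const.
Proof.
split=> [c d|]; apply: val_inj; first by rewrite valM /= rmorphM tofracM.
by rewrite val1 /= mpolyC1 tofrac1.
Qed.
HB.instance Definition _ := GRing.isAdditive.Build K R loc_const loc_const_additive.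
HB.instance Definition _ := GRing.isMultiplicative.Build K R loc_const
  loc_const_multiplicative.

Lemma loc_var_in i : (tofrac 'X_i / tofrac 'X_z : F) \in in_local_ring p.
Proof.
apply/asboolP; exists 1%N, 'X_i, 'X_z; split; rewrite ?dhomogXU //.
by rewrite /peval mevalXU.
Qed.

Definition loc_var i : R := Sub (tofrac 'X_i / tofrac 'X_z) (loc_var_in i).

(** Dehomogenization at a coordinate z that is nonzero at p. Up to units, every element of the local
    ring is in the image of a form. *)
Definition dehom : S -> R := mmap loc_const loc_var.
HB.instance Definition _ := GRing.RMorphism.copy dehom (mmap loc_const loc_var).

Definition incF : K -> F := @tofrac S \o @mpolyC n.+1 K.
HB.instance Definition _ := GRing.RMorphism.copy incF (@tofrac S \o @mpolyC n.+1 K).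

Lemma mmap_tofrac f : mmap incF (fun i => tofrac 'X_i) f = tofrac f.
Proof.
apply: (mpoly_hom_ext (h1 := mmap incF (fun i => tofrac 'X_i)) (h2 := @tofrac S)).
  by move=> c; rewrite /= mmapC.
by move=> i; rewrite /= mmapXU.
Qed.

Lemma val_dehom f d : f \is d.-homog -> val (dehom f) = tofrac f / tofrac 'X_z ^+ d.
Proof.
move=> hf; rewrite /dehom (mmap_hom _ _ (val : {rmorphism R -> F})).
rewrite (mmap_ext (f' := incF) (h' := fun i => (tofrac 'X_z)^-1 * tofrac 'X_i)) //.
  by rewrite (mmap_homog_scale _ _ _ hf) mmap_tofrac exprVn mulrC.
by move=> i; rewrite mulrC.
Qed.

Lemma Xz_neq0 : tofrac ('X_z : S) != 0 :> F.
Proof. by apply: peval_neq0; rewrite mevalXU. Qed.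

Lemma dehom_z : dehom 'X_z = 1.
Proof.
by apply: val_inj; rewrite (val_dehom (dhomogXU K z)) expr1 divff ?Xz_neq0 // val1.
Qed.

Definition loc_unit x := exists y, x * y = 1.

Lemma dehom_unit b d : b \is d.-homog -> b@p != 0 -> loc_unit (dehom b).
Proof.
move=> hb pb.
have hz : 'X_z ^+ d \is [in K[n.+1], d.-homog].
  by have := dhomogMn d (dhomogXU K z); rewrite mul1n.
have [y ey] := loc_exists hz hb pb; exists y.
apply: val_inj; rewrite valM (val_dehom hb) ey val1 -tofracXn.
apply: divf_mulVK; first exact: peval_neq0.
by rewrite tofracXn expf_neq0 // Xz_neq0.
Qed.

Lemma dehom_frac d a b x : a \is d.-homog -> b \is d.-homog -> b@p != 0 ->
  val x = tofrac a / tofrac b -> x * dehom b = dehom a.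
Proof.
move=> ha hb pb ex; apply: val_inj.
rewrite valM (val_dehom ha) (val_dehom hb) ex mulrA divfK //.
exact: peval_neq0.
Qed.

Lemma loc_cases x : exists d a b,
  [/\ a \is d.-homog, b \is d.-homog, b@p != 0, val x = tofrac a / tofrac b
    & x * dehom b = dehom a].
Proof.
have /asboolP[d [a [b [ha hb pb ex]]]] := valP x.
by exists d, a, b; split=> //; apply: (dehom_frac ha hb pb ex).
Qed.

Lemma ideal_unit (Q : set R) x u : is_ideal Q -> loc_unit u -> Q (x * u) -> Q x.
Proof.
move=> iQ [y ey] /(idealMr y iQ); by rewrite -mulrA ey mulr1.
Qed.

Definition residue x : K := fext (meval (fun i => p 0 i)) (val x).

Lemma residue_dom x : fdom (meval (fun i => p 0 i)) (val x).
Proof. by have [d [a [b [_ _ pb -> _]]]] := loc_cases x; apply: fdom_frac. Qed.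

Lemma residueD x y : residue (x + y) = residue x + residue y.
Proof. by rewrite /residue valD; have [] := fextD (residue_dom x) (residue_dom y). Qed.
Lemma residueM x y : residue (x * y) = residue x * residue y.
Proof. by rewrite /residue valM; have [] := fextM (residue_dom x) (residue_dom y). Qed.
Lemma residue1 : residue 1 = 1.
Proof. by rewrite /residue val1 -tofrac1 fext_tofrac rmorph1. Qed.

Lemma residue_frac a b x : b@p != 0 -> val x = tofrac a / tofrac b ->
  residue x = a@p / b@p.
Proof. by move=> pb ex; rewrite /residue ex fext_frac. Qed.

Lemma residue_dehom f d : f \is d.-homog -> residue (dehom f) = f@p / p 0 z ^+ d.
Proof.
move=> hf; rewrite -(mevalXU (fun i => p 0 i) z) -rmorphXn /=.
apply: residue_frac; first by rewrite rmorphXn /= mevalXU expf_neq0.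
by rewrite (val_dehom hf) tofracXn.
Qed.

Lemma nonunitsP x : nonunits R x <-> residue x = 0.
Proof.
split=> [h|h [y e]]; last first.
  by have := residueM x y; rewrite e h mul0r residue1 => /eqP; rewrite oner_eq0.
have [d [a [b [ha hb pb ex e]]]] := loc_cases x.
rewrite (residue_frac pb ex); apply: contrapT => /eqP nz; apply: h.
have pa : a@p != 0 by apply: contraNneq nz => ->; rewrite mul0r.
have [y ey] := loc_exists hb ha pa; exists y; apply: val_inj.
by rewrite valM ex ey val1 divf_mulVK // peval_neq0.
Qed.

Lemma nonunits_prime : is_prime (nonunits R).
Proof.
split.
- split=> [|x y /nonunitsP hx /nonunitsP hy|x y /nonunitsP hy]; apply/nonunitsP.
  + by have := residueD 0 0; rewrite addr0 -{1}[residue 0]addr0 => /addrI.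
  + by rewrite residueD hx hy addr0.
  + by rewrite residueM hy mulr0.
- by move=> h; apply: h; exists 1; rewrite mulr1.
- move=> x y /nonunitsP; rewrite residueM => /eqP; rewrite mulf_eq0.
  by case/orP => /eqP h; [left|right]; apply/nonunitsP.
Qed.

Lemma local_idealP (J : set S) x :
  local_ideal J p x <-> exists d a b,
    [/\ J a, a \is d.-homog, b \is d.-homog, b@p != 0 & x * dehom b = dehom a].
Proof.
split=> [[d [a [b [[Ja ha hb pb] ex]]]]|[d [a [b [Ja ha hb pb ex]]]]].
  by exists d, a, b; split=> //; apply: (dehom_frac ha hb pb ex).
exists d, a, b; split=> //.
have := congr1 val ex; rewrite valM (val_dehom ha) (val_dehom hb) mulrA.
move/(mulIf (invr_neq0 (expf_neq0 d Xz_neq0))) => <-.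
by rewrite mulfK // peval_neq0.
Qed.

Lemma dehom_sum f : dehom f = \sum_(d < msize f) dehom (pihomog mdeg d f).
Proof. by rewrite {1}(pihomog_partitionE (leqnn (msize f)) : f = _) (rmorph_sum dehom). Qed.

Lemma local_ideal_ideal (J : set S) : is_homogeneous J -> is_ideal (local_ideal J p).
Proof.
move=> hJ; have [iJ _] := hJ; split.
- apply/(local_idealP _ _); exists 0%N, 0, 1; split.
  + exact: ideal0.
  + exact: rpred0.
  + exact: dhomog1.
  + by rewrite meval1 oner_eq0.
  + by rewrite rmorph0 mul0r.
- move=> x y /(local_idealP _ _)[d [a [b [Ja ha hb pb e]]]].
  move=> /(local_idealP _ _)[d' [a' [b' [Ja' ha' hb' pb' e']]]].
  apply/(local_idealP _ _); exists (d + d')%N, (a * b' + a' * b), (b * b'); split.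
  + by apply: (idealD iJ); apply: (idealMr _ iJ).
  + by apply: rpredD; [exact: dhomogM | rewrite addnC; exact: dhomogM].
  + by rewrite dhomogM.
  + by rewrite mevalM mulf_neq0.
  + by rewrite rmorphD !rmorphM; exact: fraction_add.
- move=> y x /(local_idealP _ _)[d [a [b [Ja ha hb pb e]]]].
  have [d' [a' [b' [ha' hb' pb' _ e']]]] := loc_cases y.
  apply/(local_idealP _ _); exists (d' + d)%N, (a' * a), (b' * b); split.
  + exact: (idealMl _ iJ).
  + by rewrite dhomogM.
  + by rewrite dhomogM.
  + by rewrite mevalM mulf_neq0.
  + by rewrite !rmorphM; exact: fraction_mul.
Qed.

Lemma local_ideal_dehom (J : set S) f : is_homogeneous J -> J f -> local_ideal J p (dehom f).
Proof.
move=> hJ Jf; rewrite dehom_sum; apply: ideal_sum; first exact: local_ideal_ideal.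
move=> d _; apply/(local_idealP _ _).
have hz : 'X_z ^+ d \is [in K[n.+1], d.-homog].
  by have := dhomogMn d (dhomogXU K z); rewrite mul1n.
exists (d : nat), (pihomog mdeg d f), ('X_z ^+ d); split.
- by have [_ h] := hJ; apply: h.
- exact: pihomogP.
- exact: hz.
- by rewrite rmorphXn /= mevalXU expf_neq0.
- by rewrite rmorphXn /= dehom_z expr1n mulr1.
Qed.

Lemma local_ideal_sub (J J' : set S) : (J `<=` J')%classic ->
  (local_ideal J p `<=` local_ideal J' p)%classic.
Proof.
by move=> s x [d [a [b [[Ja ha hb pb] ex]]]]; exists d, a, b; split=> //; split=> //; apply: s.
Qed.

(** Clearing denominators multiplies f by b and by powers of X_z; these do not vanish at p, so they
    lie outside P. *)
Lemma local_prime_dehom (P : set S) f d : is_prime P -> is_homogeneous P ->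
  (P `<=` point_ideal (fun i => p 0 i))%classic ->
  f \is d.-homog -> local_ideal P p (dehom f) -> P f.
Proof.
move=> hP homP sP hf /(local_idealP _ _)[d' [a [b [Pa ha hb pb e]]]].
have [_ _ PM] := hP.
have : P (f * b * 'X_z ^+ d').
  have -> : f * b * 'X_z ^+ d' = a * ('X_z ^+ (d)) * 'X_z ^+ d'.
    have := congr1 val e; rewrite valM (val_dehom ha) (val_dehom hb) (val_dehom hf).
    rewrite mulf_div => /eqP; rewrite eqr_div ?mulf_neq0 ?expf_neq0 ?Xz_neq0 //.
    rewrite -!tofracXn -!tofracM tofrac_eq => /eqP e2.
    apply: (mulIf (x := 'X_z ^+ 0)); first by rewrite expr0 oner_neq0.
    rewrite expr0 !mulr1 e2; ring.
  by apply: (idealMr _ (prime_ideal hP)); apply: (idealMr _ (prime_ideal hP)).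
have nP g : g@p != 0 -> ~ P g by move=> pg /sP; rewrite /point_ideal => e0; rewrite e0 eqxx in pg.
move=> /PM[/PM[//|]|]; first by move/nP; case.
by move/nP; case; rewrite rmorphXn /= mevalXU expf_neq0.
Qed.

Lemma local_ideal_prime (P : set S) : is_prime P -> is_homogeneous P ->
  (P `<=` point_ideal (fun i => p 0 i))%classic -> is_prime (local_ideal P p).
Proof.
move=> hP homP sP; have iP := local_ideal_ideal homP.
have back := local_prime_dehom hP homP sP.
split=> //.
  rewrite -(rmorph1 dehom) => /(back 1 0%N (dhomog1 _ _)) P1.
  by have [_ h _] := hP; apply: h.
move=> x y Pxy; have [d [a [b [ha hb pb _ e]]]] := loc_cases x.
have [d' [a' [b' [ha' hb' pb' _ e']]]] := loc_cases y.
have : local_ideal P p (dehom (a * a')).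
  by rewrite rmorphM /= -e -e' mulrACA; apply: (idealMr _ iP).
move/(back _ _ (dhomogM ha ha')); have [_ _ PM] := hP.
move=> /PM[Pa|Pa].
  left; apply: (ideal_unit iP (dehom_unit hb pb)); rewrite e.
  exact: local_ideal_dehom.
right; apply: (ideal_unit iP (dehom_unit hb' pb')); rewrite e'.
exact: local_ideal_dehom.
Qed.

Lemma local_ideal_nonunits (J : set S) : is_homogeneous J ->
  (J `<=` point_ideal (fun i => p 0 i))%classic ->
  (local_ideal J p `<=` nonunits R)%classic.
Proof.
move=> hJ sJ x [d [a [b [[Ja ha hb pb] ex]]]]; apply/nonunitsP.
by rewrite (residue_frac pb ex) (sJ _ Ja) mul0r.
Qed.

End LocalRing.

(** * Local equations *)

Lemma regular_seq_rcons (R : comNzRingType) (J : set R) s x :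
  regular_seq J s -> ~ ideal_adjoin J (rcons s x) 1 ->
  (forall a, ideal_adjoin J s (x * a) -> ideal_adjoin J s a) ->
  regular_seq J (rcons s x).
Proof.
move=> [_ rs] n1 nz; split=> // i; rewrite size_rcons ltnS leq_eqVlt.
case/orP => [/eqP->|lt] a.
  by rewrite nth_rcons ltnn eqxx -cats1 take_size_cat //; apply: nz.
by rewrite nth_rcons lt -cats1 takel_cat 1?ltnW //; apply: rs.
Qed.

Section OnVars.

Context {K : closedFieldType} {n : nat}.
Local Notation S := {mpoly K[n.+1]}.
Implicit Types (B : pred 'I_n.+1) (f g : S).

Definition kap B : S -> S := mmap (@mpolyC n.+1 K) (fun i => if B i then 'X_i else 0).
HB.instance Definition _ B := GRing.RMorphism.copy (kap B)
  (mmap (@mpolyC n.+1 K) (fun i => if B i then 'X_i else 0)).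

(** Only the variables in B occur in f. *)
Definition on_vars B f : Prop := kap B f = f.

Lemma kapC B c : kap B c%:MP = c%:MP. Proof. by rewrite /kap mmapC. Qed.
Lemma kapX B i : kap B 'X_i = if B i then 'X_i else 0.
Proof. by rewrite /kap mmapXU. Qed.

Lemma on_varsC B c : on_vars B c%:MP. Proof. exact: kapC. Qed.
Lemma on_vars0 B : on_vars B 0. Proof. exact: (rmorph0 (kap B)). Qed.
Lemma on_vars1 B : on_vars B 1. Proof. exact: (rmorph1 (kap B)). Qed.
Lemma on_varsX B i : B i -> on_vars B 'X_i.
Proof. by move=> h; rewrite /on_vars kapX h. Qed.
Lemma on_varsD B f g : on_vars B f -> on_vars B g -> on_vars B (f + g).
Proof. by move=> hf hg; rewrite /on_vars rmorphD /= hf hg. Qed.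
Lemma on_varsM B f g : on_vars B f -> on_vars B g -> on_vars B (f * g).
Proof. by move=> hf hg; rewrite /on_vars rmorphM /= hf hg. Qed.
Lemma on_varsZ B c f : on_vars B f -> on_vars B (c *: f).
Proof. by move=> hf; rewrite -mul_mpolyC; apply: on_varsM => //; apply: on_varsC. Qed.

Lemma mmap_kap (A : comNzRingType) (iota : {rmorphism K -> A}) (h : 'I_n.+1 -> A) B f :
  mmap iota h (kap B f) = mmap iota (fun i => if B i then h i else 0) f.
Proof.
rewrite /kap (mmap_hom _ _ (mmap iota h)); apply: mmap_ext => [c|i] /=.
  by rewrite mmapC.
by case: (B i); rewrite ?mmapXU ?rmorph0.
Qed.

Lemma mmap_on_vars (A : comNzRingType) (iota : {rmorphism K -> A})
    (h h' : 'I_n.+1 -> A) B f :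
  on_vars B f -> (forall i, B i -> h i = h' i) -> mmap iota h f = mmap iota h' f.
Proof.
move=> hf eh; rewrite -hf !mmap_kap; apply: mmap_ext => // i.
by case: ifP => // /eh.
Qed.

Lemma kap_tofrac B f :
  tofrac (kap B f) = mmap incF (fun i => if B i then tofrac 'X_i else 0) f.
Proof. by rewrite -mmap_tofrac mmap_kap. Qed.

Lemma sub_kap1 j f : exists f1, f - kap (predC1 j) f = f1 * 'X_j.
Proof.
elim/mpoly_ring_ind: f => [c|i|f g [f1 ef] [g1 eg]|f g [f1 ef] [g1 eg]].
- by exists 0; rewrite kapC subrr mul0r.
- rewrite kapX /=; case: eqVneq => [->|_]; first by exists 1; rewrite mul1r subr0.
  by exists 0; rewrite mul0r subrr.
- by exists (f1 + g1); rewrite rmorphD mulrDl -ef -eg; ring.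
- exists (f1 * g + kap (predC1 j) f * g1); rewrite rmorphM /=.
  have -> : f * g - kap (predC1 j) f * kap (predC1 j) g
    = (f - kap (predC1 j) f) * g + kap (predC1 j) f * (g - kap (predC1 j) g) by ring.
  by rewrite ef eg; ring.
Qed.

End OnVars.

Lemma linear_residue (A : comNzRingType) (x c u u' h : A) :
  (x - c) * u' = (u * x - h) - (u - u') * x + (h - u' * c).
Proof. by ring. Qed.

(** * Equations that can be solved near p for the variables outside B *)

Section LocalEquations.

Context {K : closedFieldType} {n : nat}.
Variables (p : 'rV[K]_n.+1) (z : 'I_n.+1) (pz : p 0 z != 0).
Local Notation S := {mpoly K[n.+1]}.
Local Notation F := {fraction S}.
Local Notation R := (local_ring p).
Local Notation "f @p" := (f.@[fun i => p 0 i]) (at level 2, format "f @p").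
Local Notation pt := (fun i => p 0 i).
Variables (B : pred 'I_n.+1) (u h : 'I_n.+1 -> S).
Hypotheses
  (hu : forall k, ~~ B k -> [/\ u k \is 1.-homog, on_vars B (u k) & (u k)@p != 0])
  (hh : forall k, ~~ B k ->
     [/\ h k \is 2.-homog, on_vars B (h k) & (h k)@p = (u k)@p * p 0 k]).
Implicit Types (f a b : S) (x y : R).

(** Near p, where u k is invertible, this equation gives X_k in terms of the variables in B. *)
Let g k : S := u k * 'X_k - h k.

Lemma local_eq_homog k : ~~ B k -> g k \is 2.-homog.
Proof.
move=> Bk; have [h1 _ _] := hu Bk; have [h2 _ _] := hh Bk.
by apply: rpredB => //; apply: (dhomogM h1 (dhomogXU K k)).
Qed.

Lemma local_eq_at k : ~~ B k -> (g k)@p = 0.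
Proof. by move=> /hh[_ _ e]; rewrite rmorphB rmorphM /= mevalXU e subrr. Qed.

Section Solve.

Variable T : seq 'I_n.+1.
Hypothesis TB : forall k, k \in T -> ~~ B k.

(* Solving the equations g k = 0, for k in T, for the variables X_k. *)
Definition solve i : F := if i \in T then tofrac (h i) / tofrac (u i) else tofrac 'X_i.

Lemma solve_on_vars f : on_vars [pred i | i \notin T] f -> mmap incF solve f = tofrac f.
Proof.
move=> hf; rewrite -mmap_tofrac; apply: (mmap_on_vars _ hf) => i /= /negbTE iT.
by rewrite /solve iT.
Qed.

Lemma on_vars_base f : on_vars B f -> on_vars [pred i | i \notin T] f.
Proof.
move=> hf; rewrite /on_vars -hf; apply: (mpoly_hom_ext
  (h1 := kap [pred i | i \notin T] \o kap B) (h2 := kap B)) => [c|i] /=.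
  by rewrite !kapC.
rewrite !kapX; case: ifP => Bi; last by rewrite rmorph0.
by rewrite kapX /=; case: ifP => // /negbFE /TB; rewrite Bi.
Qed.

Lemma solve_base f : on_vars B f -> mmap incF solve f = tofrac f.
Proof. by move=> hf; apply/solve_on_vars/on_vars_base. Qed.

Lemma solve_eq k : k \in T -> mmap incF solve (g k) = 0.
Proof.
move=> kT; have [_ h1 h2] := hu (TB kT); have [_ h3 _] := hh (TB kT).
rewrite rmorphB rmorphM /= (solve_base h1) (solve_base h3) mmapXU /solve kT mulrCA divff ?mulr1 ?subrr //.
exact: peval_neq0 h2.
Qed.

(** Multiplication by u k replaces X_k by h k, so after a multiplier U that is invertible at p, the
    variables in T are eliminated. The ideal Q is arbitrary so that this applies to kernels and to
    preimages of local ideals as well. *)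
Lemma eq_reduce f : exists U r d,
  [/\ U \is d.-homog, U@p != 0, on_vars [pred i | i \notin T] U,
      on_vars [pred i | i \notin T] r
    & forall Q : set S, is_ideal Q -> (forall k, k \in T -> Q (g k)) -> Q (U * f - r)].
Proof.
elim/mpoly_ring_ind: f => [c|i|f f' [U [r [d [hU pU oU or hQ]]]]
    [U' [r' [d' [hU' pU' oU' or' hQ']]]]|f f' [U [r [d [hU pU oU or hQ]]]]
    [U' [r' [d' [hU' pU' oU' or' hQ']]]]].
- exists 1, c%:MP, 0%N; split; [exact: dhomog1|by rewrite meval1 oner_eq0|exact: on_vars1
    |exact: on_varsC|by move=> Q iQ _; rewrite mul1r subrr; apply: ideal0].
- case: (boolP (i \in T)) => iT.
    have [h1 h2 h3] := hu (TB iT); have [_ h4 _] := hh (TB iT).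
    exists (u i), (h i), 1%N; split=> //; [exact: on_vars_base|exact: on_vars_base|].
    by move=> Q _; apply.
  exists 1, 'X_i, 0%N; split; [exact: dhomog1|by rewrite meval1 oner_eq0|exact: on_vars1
    |exact: on_varsX|by move=> Q iQ _; rewrite mul1r subrr; apply: ideal0].
- exists (U * U'), (r * U' + r' * U), (d + d')%N; split; [exact: dhomogM
   |by rewrite mevalM mulf_neq0|exact: on_varsM|by apply: on_varsD; apply: on_varsM|].
  move=> Q iQ hg; have -> : U * U' * (f + f') - (r * U' + r' * U)
    = (U * f - r) * U' + (U' * f' - r') * U by ring.
  by apply: idealD => //; apply: idealMr => //; [apply: hQ|apply: hQ'].
- exists (U * U'), (r * r'), (d + d')%N; split; [exact: dhomogM
   |by rewrite mevalM mulf_neq0|exact: on_varsM|exact: on_varsM|].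
  move=> Q iQ hg; have -> : U * U' * (f * f') - r * r'
    = (U * f - r) * (U' * f') + (U' * f' - r') * r by ring.
  by apply: idealD => //; apply: idealMr => //; [apply: hQ|apply: hQ'].
Qed.

(** The reduction r of f does not involve the variables in T, so [solve] fixes it, and it is
    zero. *)
Lemma solve_kernel f : mmap incF solve f = 0 -> exists U d,
  [/\ U \is d.-homog, U@p != 0
    & forall Q : set S, is_ideal Q -> (forall k, k \in T -> Q (g k)) -> Q (U * f)].
Proof.
move=> ef; have [U [r [d [hU pU oU or hQ]]]] := eq_reduce f.
exists U, d; split=> // Q iQ hg; have : r = 0.
  apply/eqP; rewrite -tofrac_eq0 -(solve_on_vars or).
  have := hQ _ (kernel_ideal (mmap incF solve)) solve_eq.
  by rewrite rmorphB rmorphM /= ef mulr0 sub0r => /eqP; rewrite oppr_eq0.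
by move=> r0; have := hQ Q iQ hg; rewrite r0 subr0.
Qed.

Lemma solve_kernel_at f : mmap incF solve f = 0 -> f@p = 0.
Proof.
move=> /solve_kernel[U [d [_ pU]]] /(_ _ (kernel_ideal (meval pt))).
have hg k : k \in T -> (g k)@p = 0 by move/TB; apply: local_eq_at.
by move/(_ hg)/eqP; rewrite rmorphM mulf_eq0 (negbTE pU) => /eqP.
Qed.

Definition solve_ideal : set S := cone_ideal incF solve.

Lemma solve_ideal_point : (solve_ideal `<=` point_ideal pt)%classic.
Proof.
apply: homogeneous_sub; first exact: cone_homogeneous.
  exact: (kernel_ideal (meval pt)).
by move=> f d hf /(cone_ideal_homog _ _ hf)/solve_kernel_at.
Qed.

Lemma local_solve_prime : is_prime (local_ideal solve_ideal p).
Proof.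
by apply: (local_ideal_prime pz); [exact: cone_prime|exact: cone_homogeneous
  |exact: solve_ideal_point].
Qed.

Lemma local_solve_ideal :
  local_ideal solve_ideal p =
  ideal_adjoin [set 0]%classic [seq dehom pz (g k) | k <- T].
Proof.
have hS : is_homogeneous solve_ideal by exact: cone_homogeneous.
have iA := ideal_adjoin_ideal [set 0]%classic [seq dehom pz (g k) | k <- T].
apply/seteqP; split=> [x /(local_idealP pz _ _)[d [a [b [Sa ha hb pb ex]]]]|].
  have [U [d' [hU pU hQ]]] := solve_kernel (proj1 (cone_ideal_homog _ _ ha) Sa).
  apply: (ideal_unit iA (dehom_unit pz hb pb)); rewrite ex.
  apply: (ideal_unit iA (dehom_unit pz hU pU)); rewrite -rmorphM mulrC.
  apply: (hQ (fun f => ideal_adjoin _ _ (dehom pz f))).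
    split; first by rewrite rmorph0; apply: ideal0.
      by move=> f f' h1 h2; rewrite rmorphD; apply: (idealD iA).
    by move=> f f' h1; rewrite rmorphM; apply: (idealMl _ iA).
  by move=> k kT; apply: ideal_adjoin_mem; apply/mapP; exists k.
apply: ideal_adjoin_min => [|x ->|x /mapP[k kT ->]].
- exact: (local_ideal_ideal pz).
- exact: (ideal0 (local_ideal_ideal pz hS)).
- apply: local_ideal_dehom => //; apply/(cone_ideal_homog _ _ (local_eq_homog (TB kT))).
  exact: solve_eq.
Qed.

Lemma solve_regular f d x : f \is d.-homog -> mmap incF solve f != 0 ->
  ideal_adjoin [set 0]%classic [seq dehom pz (g k) | k <- T] (dehom pz f * x) ->
  ideal_adjoin [set 0]%classic [seq dehom pz (g k) | k <- T] x.
Proof.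
move=> hf nz; rewrite -local_solve_ideal; have [_ _ PM] := local_solve_prime.
case/PM => //; have back := local_prime_dehom (pz := pz) (cone_prime incF solve) (cone_homogeneous incF solve).
move/(back _ _ solve_ideal_point hf)/(cone_ideal_homog _ _ hf)/eqP.
by rewrite (negbTE nz).
Qed.

End Solve.

Lemma local_eq_neq0 k : ~~ B k -> g k != 0.
Proof.
move=> Bk; have [_ ou pu] := hu Bk; have [_ oh _] := hh Bk.
apply/eqP => gk0; have hk0 : h k = 0.
  rewrite -oh; have /(congr1 (kap B)) := gk0.
  rewrite rmorphB rmorphM /= kapX (negbTE Bk) mulr0 sub0r rmorph0 => /eqP.
  by rewrite oppr_eq0 => /eqP.
move/eqP: gk0; rewrite /g hk0 subr0 mulf_eq0 (negbTE (mpolyX_neq0 _ _)) orbF => /eqP u0.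
by rewrite u0 meval0 eqxx in pu.
Qed.

Lemma point_not1 s : (forall x, x \in s -> nonunits R x) ->
  ~ ideal_adjoin [set 0]%classic s 1.
Proof.
have [iN n1 _] := nonunits_prime pz; move=> sN h1; apply: n1; move: h1.
by apply: ideal_adjoin_min => // x ->; apply: ideal0.
Qed.

Lemma nonunits_dehom f d : f \is d.-homog -> f@p = 0 -> nonunits R (dehom pz f).
Proof. by move=> hf e; apply/(nonunitsP pz); rewrite (residue_dehom pz hf) e mul0r. Qed.

(** An initial segment generates a prime ideal, by [local_solve_ideal]. The next equation is not in
    it, because its variable has not been solved for. *)
Lemma local_eq_regular (T : seq 'I_n.+1) : uniq T -> (forall k, k \in T -> ~~ B k) ->
  regular_seq [set 0]%classic [seq dehom pz (g k) | k <- T].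
Proof.
elim/last_ind: T => [|T k IH].
  by split=> //; apply: point_not1.
rewrite rcons_uniq => /andP[kT uT] TB; rewrite map_rcons.
have TB' j : j \in T -> ~~ B j by move=> jT; apply: TB; rewrite mem_rcons inE jT orbT.
have Bk : ~~ B k by apply: TB; rewrite mem_rcons mem_head.
apply: regular_seq_rcons; first exact: IH.
  rewrite -map_rcons; apply: point_not1 => x /mapP[j jT ->].
  by apply: (nonunits_dehom (local_eq_homog (TB j jT))); apply/local_eq_at/TB.
move=> x; apply: (solve_regular TB' (local_eq_homog Bk)).
have [_ h1 _] := hu Bk; have [_ h2 _] := hh Bk.
rewrite rmorphB rmorphM /= (solve_base TB' h1) (solve_base TB' h2) mmapXU /solve (negbTE kT).
by rewrite -tofracM -tofracB tofrac_eq0 local_eq_neq0.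
Qed.

Definition local_eqs : seq R := [seq dehom pz (g k) | k <- enum (predC B)].

Lemma enum_predC k : k \in enum (predC B) -> ~~ B k.
Proof. by rewrite mem_enum. Qed.

(** Up to units and modulo the equations, each element of I becomes one that involves only the
    variables in B; the extra generators t have to account for these alone. *)
Lemma local_ideal_gen (I : set S) (t : seq S) : is_homogeneous I ->
  (forall k, ~~ B k -> I (g k)) -> (forall f, f \in t -> I f) ->
  (forall r, I r -> on_vars B r -> ideal_adjoin [set 0]%classic t r) ->
  local_ideal I p = ideal_adjoin [set 0]%classic (local_eqs ++ map (dehom pz) t).
Proof.
move=> hI Ig It Ir; have [iI _] := hI.
have iA := ideal_adjoin_ideal [set 0]%classic (local_eqs ++ map (dehom pz) t).
have iL := local_ideal_ideal pz hI.
apply/seteqP; split=> [x /(local_idealP pz _ _)[d [a [b [Ia ha hb pb ex]]]]|].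
  apply: (ideal_unit iA (dehom_unit pz hb pb)); rewrite ex.
  have [U [r [d' [hU pU _ or hQ]]]] := eq_reduce enum_predC a.
  apply: (ideal_unit iA (dehom_unit pz hU pU)); rewrite -rmorphM mulrC.
  have Jr : ideal_adjoin [set 0]%classic t r.
    apply: Ir; last first.
      rewrite /on_vars -[RHS]or; apply: mmap_ext => // i.
      by rewrite /= mem_enum inE /= negbK.
    have -> : r = U * a - (U * a - r) by ring.
    apply: idealB => //; first exact: idealMl.
    by apply: hQ => // k /enum_predC; apply: Ig.
  pose Q f := ideal_adjoin [set 0]%classic (local_eqs ++ map (dehom pz) t) (dehom pz f).
  have iQ : is_ideal Q.
    split; first by rewrite /Q rmorph0; apply: ideal0.
      by move=> f f' h1 h2; rewrite /Q rmorphD; apply: (idealD iA).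
    by move=> f f' h1; rewrite /Q rmorphM; apply: (idealMl _ iA).
  rewrite -[U * a](subrK r); apply: (idealD iQ).
    apply: hQ => // k kB; apply: ideal_adjoin_mem; rewrite mem_cat; apply/orP; left.
    by apply/mapP; exists k.
  move: Jr; apply: ideal_adjoin_min => // [f ->|f ft]; first exact: ideal0.
  apply: ideal_adjoin_mem; rewrite mem_cat; apply/orP; right.
  by apply/mapP; exists f.
apply: ideal_adjoin_min => // [x ->|x]; first exact: ideal0.
rewrite mem_cat => /orP[/mapP[k /enum_predC kB ->]|/mapP[f ft ->]].
  by apply: local_ideal_dehom => //; apply: Ig.
by apply: local_ideal_dehom => //; apply: It.
Qed.

Lemma local_lci0 (I : set S) : is_homogeneous I -> (forall k, ~~ B k -> I (g k)) ->
  (forall r, I r -> on_vars B r -> r = 0) -> complete_intersection_ideal (local_ideal I p).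
Proof.
move=> hI Ig Ir; exists local_eqs; split.
  by apply: local_eq_regular; [exact: enum_uniq | exact: enum_predC].
rewrite (local_ideal_gen (t := [::]) hI Ig) ?cats0 // => r h1 h2.
rewrite (Ir r h1 h2); exact: (ideal0 (ideal_adjoin_ideal _ _)).
Qed.

Lemma local_lci1 (I : set S) e d : is_homogeneous I -> (forall k, ~~ B k -> I (g k)) ->
  I e -> e != 0 -> e \is d.-homog -> on_vars B e -> e@p = 0 ->
  (forall r, I r -> on_vars B r -> exists c, r = c * e) ->
  complete_intersection_ideal (local_ideal I p).
Proof.
move=> hI Ig Ie nz he oe pe Ir; exists (rcons local_eqs (dehom pz e)); split.
  apply: regular_seq_rcons.
  - by apply: local_eq_regular; [exact: enum_uniq | exact: enum_predC].
  - apply: point_not1 => x; rewrite mem_rcons inE => /orP[/eqP->|].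
      exact: nonunits_dehom he pe.
    by move=> /mapP[k /enum_predC kB ->]; apply: (nonunits_dehom (local_eq_homog kB));
       apply: local_eq_at.
  - move=> x; apply: (solve_regular enum_predC he).
    by rewrite (solve_base enum_predC oe) tofrac_eq0.
rewrite (local_ideal_gen (t := [:: e]) hI Ig) -?cats1 // => [f|r Ir1 Ir2].
  by rewrite inE => /eqP->.
have [c ->] := Ir r Ir1 Ir2; apply: (idealMl _ (ideal_adjoin_ideal _ _)).
by apply: ideal_adjoin_mem; rewrite mem_head.
Qed.

(** Modulo Q the variables in B equal their values at p, hence so do the u k and h k, and the
    equations then force the other variables to their values too. *)
Lemma nonunits_sub (Q : set R) : is_ideal Q ->
  (forall k, ~~ B k -> Q (dehom pz (g k))) ->
  (forall i, B i -> Q (loc_var pz i - loc_const p (p 0 i / p 0 z))) ->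
  (nonunits R `<=` Q)%classic.
Proof.
move=> iQ Qg QB; pose c i := p 0 i / p 0 z.
have onB f : on_vars B f -> Q (dehom pz f - loc_const p f.@[c]).
  move=> hf; rewrite /meval (mmap_hom _ _ (loc_const p)) /dehom -{1 2}hf !mmap_kap.
  apply: mmap_congr_mod => // i; case: ifP => Bi; last by rewrite subrr; apply: ideal0.
  exact: QB.
have evc f d : f \is d.-homog -> f.@[c] = (p 0 z)^-1 ^+ d * f@p.
  by move=> hf; rewrite -(mmap_homog_scale _ _ _ hf); apply: mmap_ext => // i; rewrite mulrC.
have Qvar k : Q (loc_var pz k - loc_const p (c k)).
  case: (boolP (B k)) => [/QB //|Bk].
  have [h1 o1 p1] := hu Bk; have [h2 o2 p2] := hh Bk.
  have uc : (u k).@[c] != 0 by rewrite (evc _ _ h1) mulf_neq0 ?expf_neq0 ?invr_eq0.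
  apply: (ideal_unit (u := loc_const p (u k).@[c]) iQ).
    exists (loc_const p ((u k).@[c])^-1); by rewrite -rmorphM divff // rmorph1.
  have e1 : (h k).@[c] = (u k).@[c] * c k.
    by rewrite (evc _ _ h1) (evc _ _ h2) p2 /c; field.
  have e2 : dehom pz (g k) = dehom pz (u k) * loc_var pz k - dehom pz (h k).
    by rewrite rmorphB rmorphM /= [dehom pz 'X_k]mmapXU.
  have -> : (loc_var pz k - loc_const p (c k)) * loc_const p (u k).@[c]
    = dehom pz (g k) - (dehom pz (u k) - loc_const p (u k).@[c]) * loc_var pz k
      + (dehom pz (h k) - loc_const p (h k).@[c]).
    rewrite e2 e1 (rmorphM (loc_const p) (u k).@[c] (c k)); exact: linear_residue.
  apply: idealD => //; last exact: onB.
  by apply: idealB => //; [exact: Qg | apply: idealMr => //; apply: onB].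
move=> x /(nonunitsP pz); have [d [a [b [ha hb pb ex e]]]] := loc_cases pz x.
rewrite (residue_frac pb ex) => /eqP; rewrite mulf_eq0 invr_eq0 (negbTE pb) orbF => /eqP pa.
apply: (ideal_unit iQ (dehom_unit pz hb pb)); rewrite e.
have : Q (dehom pz a - loc_const p a.@[c]).
  rewrite /meval (mmap_hom _ _ (loc_const p)) /dehom.
  by apply: mmap_congr_mod => // i; apply: Qvar.
by rewrite (evc _ _ ha) pa mulr0 rmorph0 subr0.
Qed.

End LocalEquations.

(** * Lengths *)

(* As for Jordan-Holder: an ideal N containing C 0 is determined, among the ideals
   containing it, by the set of the steps of C at which it grows. *)
Section Length.

Context {R : comNzRingType}.
Variables (L : nat) (C : nat -> set R) (g : nat -> R).
Hypotheses (iC : forall i, is_ideal (C i)) (C_top : C L 1)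
  (C_sub : forall i, (i < L)%N -> (C i `<=` C i.+1)%classic)
  (C_gen : forall i x, (i < L)%N -> C i.+1 x -> exists r, C i (x - r * g i))
  (C_g : forall i, (i < L)%N -> C i.+1 (g i))
  (C_new : forall i, (i < L)%N -> ~ C i (g i))
  (C_simple : forall i u, (i < L)%N -> nonunits R u -> C i (u * g i)).

Definition jumps (N : set R) : {set 'I_L} :=
  [set i : 'I_L | `[< exists y, [/\ N y, C i.+1 y & ~ C i y] >]]%SET.

Lemma jumps_sub N N' : (N `<=` N')%classic -> jumps N \subset jumps N'.
Proof.
move=> s; apply/fintype.subsetP => i; rewrite !finset.inE => /asboolP[y [Ny h1 h2]].
by apply/asboolP; exists y; split=> //; apply: s.
Qed.

Lemma jumps_eq N N' : is_ideal N -> is_ideal N' -> (C 0 `<=` N)%classic ->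
  (N `<=` N')%classic -> jumps N = jumps N' -> (N' `<=` N)%classic.
Proof.
move=> iN iN' sN s e.
suff H i x : (i <= L)%N -> N' x -> C i x -> N x.
  by move=> x N'x; apply: (H L) => //; rewrite -[x]mulr1; apply: (idealMl _ (iC L)).
elim: i x => [|i IH] x iL N'x Cx; first exact: sN.
case: (pselect (C i x)) => Cix; first by apply: IH => //; apply: ltnW.
have : Ordinal iL \in jumps N'.
  by rewrite finset.inE; apply/asboolP; exists x.
rewrite -e finset.inE => /asboolP[y [Ny Cy nCy]] /=.
have [r hr] := C_gen iL Cx; have [r' hr'] := C_gen iL Cy.
(* If r' were a non-unit, [C_simple] would put y in C i. With r' invertible, x is a multiple of y
   modulo C i. *)
have [r'' er] : exists r'', r' * r'' = 1.
  apply: contrapT => nu; apply: nCy; rewrite -[y](subrK (r' * g i)).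
  by apply: (idealD (iC i)) => //; apply: C_simple.
rewrite -[x](subrK (r * r'' * y)); apply: (idealD iN); last exact: (idealMl _ iN).
apply: IH => //; [exact: ltnW| |].
  by apply: (idealB iN') => //; apply: (idealMl _ iN'); apply: s.
have -> : x - r * r'' * y = (x - r * g i) - r * r'' * (y - r' * g i).
  have e2 : r * r'' * (r' * g i) = r * g i.
    by transitivity (r * (r' * r'') * g i); [ring | rewrite er mulr1].
  by rewrite mulrBr e2; ring.
by apply: (idealB (iC i)) => //; apply: (idealMl _ (iC i)).
Qed.

Lemma chain_length : module_length (C 0) L.
Proof.
split.
  exists C; split=> i iL.
    split=> [|x C0x]; first exact: iC.
    elim: i iL => // i IH iL.
    by apply: C_sub => //; apply: IH => //; apply: ltnW.
  by split; [exact: C_sub | move=> /(_ _ (C_g iL)); apply: C_new].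
move=> k [N [hN ltN]].
have card i : (i <= k)%N -> (i <= #|jumps (N i)|)%N.
  elim: i => // i IH ik; apply: leq_ltn_trans (IH (ltnW ik)) _.
  have [iN sN] := hN i (ltnW ik); have [iN' _] := hN i.+1 ik; have [s ns] := ltN i ik.
  apply: proper_card; rewrite finset.properEneq (jumps_sub s) andbT.
  by apply/eqP => e; apply: ns; apply: jumps_eq.
by apply: leq_trans (card k (leqnn k)) _; rewrite -[L in (_ <= L)%N]card_ord max_card.
Qed.

End Length.

(** * The length of truncations of an ordinary node *)

Section NodeLength.

Context {R : comNzRingType}.
Variables (J Pa Pb : set R) (a b : R).
Hypotheses (iJ : is_ideal J) (hPa : is_prime Pa) (hPb : is_prime Pb)
  (sPa : (J `<=` Pa)%classic) (sPb : (J `<=` Pb)%classic)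
  (Paa : ~ Pa a) (Pab : Pa b) (Pba : Pb a) (Pbb : ~ Pb b) (Jab : J (a * b))
  (im : is_ideal (nonunits R)) (em : nonunits R = ideal_adjoin J [:: a; b]).

Local Notation E i j := (ideal_adjoin J [:: a ^+ i; b ^+ j]).

Lemma ideal_adjoin2 s t x : ideal_adjoin J [:: s; t] x <->
  exists r r', J (x - r * s - r' * t).
Proof.
have -> : [:: s; t] = rcons [:: s] t by [].
rewrite ideal_adjoin_rcons; split=> [[r']|[r [r' h]]].
  rewrite -[[:: s]]/(rcons [::] s) ideal_adjoin_rcons ideal_adjoin_nil //.
  by move=> [r h]; exists r, r'; rewrite addrAC.
exists r'; rewrite -[[:: s]]/(rcons [::] s) ideal_adjoin_rcons ideal_adjoin_nil //.
by exists r; rewrite addrAC.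
Qed.

(** As a b lies in J, mixed products disappear and only pure powers of a and b remain. *)
Lemma node_pow k : ideal_add J (ideal_pow (nonunits R) k.+1) = E k.+1 k.+1.
Proof.
have iE i j := ideal_adjoin_ideal J [:: a ^+ i; b ^+ j].
have Ea i j : E i j (a ^+ i) by apply: ideal_adjoin_mem; rewrite mem_head.
have Eb i j : E i j (b ^+ j) by apply: ideal_adjoin_mem; rewrite !inE eqxx orbT.
have ma : nonunits R a by rewrite em; apply: ideal_adjoin_mem; rewrite mem_head.
have mb : nonunits R b by rewrite em; apply: ideal_adjoin_mem; rewrite !inE eqxx orbT.
have ip i : is_ideal (ideal_pow (nonunits R) i).
  by case: i => [|i]; [split | exact: ideal_gen_ideal].
have pw c i : nonunits R c -> ideal_pow (nonunits R) i (c ^+ i).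
  move=> mc; elim: i => [|i IH] //=; apply: ideal_gen_sub.
  by exists c, (c ^+ i); split=> //; rewrite exprS.
have iA := ideal_add_ideal J (ideal_pow (nonunits R) k.+1).
apply/seteqP; split; last first.
  apply: ideal_adjoin_min => // x; first by move=> Jx; apply: ideal_gen_sub; left.
  by rewrite !inE => /orP[/eqP->|/eqP->]; apply: ideal_gen_sub; right; apply: pw.
apply: ideal_gen_min => // x []; first exact: ideal_adjoin_sub.
elim: k x {iA} => [|k IH] x.
  apply: ideal_gen_min => // {}x [c [d [mc _ ->]]]; apply: (idealMr _ (iE _ _)).
  by rewrite !expr1 -em.
apply: ideal_gen_min => // {}x [c [d [mc /IH Ed ->]]].
move: mc; rewrite em => /ideal_adjoin2[r [r' hc]].
move: Ed => /ideal_adjoin2[s [s' hd]].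
have JE y : J y -> E k.+2 k.+2 y by exact: ideal_adjoin_sub.
have -> : c * d = (c - r * a - r' * b) * d + (r * a + r' * b) * (d - s * a ^+ k.+1 - s' * b ^+ k.+1)
   + (r * s' * b ^+ k + r' * s * a ^+ k) * (a * b) + r * s * a ^+ k.+2 + r' * s' * b ^+ k.+2.
  rewrite (exprS a k.+1) (exprS b k.+1) (exprS a k) (exprS b k).
  by move: (a ^+ k) (b ^+ k) => ak bk; ring.
by repeat apply: (idealD (iE _ _)); do ?[exact: (idealMl _ (iE _ _) (Ea _ _))
  | exact: (idealMl _ (iE _ _) (Eb _ _)) | apply: JE; exact: (idealMr _ iJ)
  | apply: JE; exact: (idealMl _ iJ)].
Qed.

Lemma unit_one_sub (P : set R) c r : is_prime P -> nonunits R c -> ~ P (1 - r * c).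
Proof.
move=> [iP P1 _] mc h; have nu : ~ nonunits R (1 - r * c).
  move=> h'; have : nonunits R 1.
    by rewrite -[1](subrK (r * c)); apply: (idealD im) => //; apply: (idealMl _ im).
  by apply; exists 1; rewrite mulr1.
by move: nu => /contrapT[y e]; apply: P1; rewrite -e; apply: (idealMr _ iP).
Qed.

(** Otherwise c^i (1 - r c) would lie in P, although 1 - r c is a unit and c is outside P. *)
Lemma prime_pow_new (P : set R) c i r x : is_prime P -> nonunits R c -> ~ P c ->
  P (c ^+ i - x - r * c ^+ i.+1) -> ~ P x.
Proof.
move=> hP mc nPc h Px; have [iP _ PM] := hP.
have : P (c ^+ i * (1 - r * c)).
  have -> : c ^+ i * (1 - r * c) = (c ^+ i - x - r * c ^+ i.+1) + x.
    by rewrite exprS; move: (c ^+ i) => ci; ring.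
  exact: (idealD iP).
by case/PM => [/(prime_exp hP)|]; last exact: unit_one_sub.
Qed.

(** The 2 k + 1 steps of a composition series are given by 1, a, ..., a^k, b, ..., b^k. Strictness
    is seen modulo Pa, where b vanishes, for the powers of a, and modulo Pb for those of b. *)
Lemma node_length k :
  module_length (ideal_add J (ideal_pow (nonunits R) k.+1)) (k.+1 + k).
Proof.
have iE i j := ideal_adjoin_ideal J [:: a ^+ i; b ^+ j].
have ma : nonunits R a by rewrite em; apply: ideal_adjoin_mem; rewrite mem_head.
have mb : nonunits R b by rewrite em; apply: ideal_adjoin_mem; rewrite !inE eqxx orbT.
have Ea i j l : (i <= l)%N -> E i j (a ^+ l).
  move=> il; rewrite -(subnK il) exprD; apply: (idealMl _ (iE _ _)).
  by apply: ideal_adjoin_mem; rewrite mem_head.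
have Eb i j l : (j <= l)%N -> E i j (b ^+ l).
  move=> il; rewrite -(subnK il) exprD; apply: (idealMl _ (iE _ _)).
  by apply: ideal_adjoin_mem; rewrite !inE eqxx orbT.
have Emono i j i' j' : (i' <= i)%N -> (j' <= j)%N -> (E i j `<=` E i' j')%classic.
  move=> hi hj; apply: ideal_adjoin_min => // x; first exact: ideal_adjoin_sub.
  by rewrite !inE => /orP[/eqP->|/eqP->]; [apply: Ea | apply: Eb].
(* (a^(k+1), b^(k+1)) < ... < (a, b^(k+1)) < (a, b^k) < ... < (a, b) < (1) *)
pose C i := E (maxn 1 (k.+1 - i)) (minn k.+1 (k.+1 + k - i)).
pose g i := if (i < k)%N then a ^+ (k - i) else b ^+ (k + k - i).
have -> : ideal_add J (ideal_pow (nonunits R) k.+1) = C 0%N.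
  rewrite node_pow /C; congr (ideal_adjoin J [:: a ^+ _; b ^+ _]); lia.
have Clt i : (i < k)%N -> C i = E (k - i).+1 k.+1 /\ C i.+1 = E (k - i) k.+1.
  by move=> ik; split; rewrite /C; congr (ideal_adjoin J [:: a ^+ _; b ^+ _]); lia.
have Cge i : (i < k.+1 + k)%N -> (k <= i)%N ->
    C i = E 1 (k + k - i).+1 /\ C i.+1 = E 1 (k + k - i).
  by move=> ik ki; split; rewrite /C; congr (ideal_adjoin J [:: a ^+ _; b ^+ _]); lia.
apply: (chain_length (g := g)).
- by move=> i; apply: iE.
- have -> : C (k.+1 + k)%N = E 1 0 by rewrite /C; congr (ideal_adjoin J [:: a ^+ _; b ^+ _]); lia.
  by rewrite -(expr0 b); apply: Eb.
- by move=> i iL; apply: Emono; lia.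
- move=> i x iL; case: (ltnP i k) => ik.
    have [-> ->] := Clt i ik; rewrite /g ik => /ideal_adjoin2[r [r' h]]; exists r.
    rewrite -[x - _](subrK (r' * b ^+ k.+1)); apply: (idealD (iE _ _)).
      exact: ideal_adjoin_sub.
    by apply: (idealMl _ (iE _ _)); apply: Eb.
  have [-> ->] := Cge i iL ik; rewrite /g ltnNge ik /= => /ideal_adjoin2[r [r' h]].
  exists r'; rewrite -[x - _](subrK (r * a ^+ 1)); apply: (idealD (iE _ _)).
    by apply: ideal_adjoin_sub; rewrite addrAC.
  by apply: (idealMl _ (iE _ _)); apply: Ea.
- move=> i iL; case: (ltnP i k) => ik.
    by have [_ ->] := Clt i ik; rewrite /g ik; apply: Ea.
  by have [_ ->] := Cge i iL ik; rewrite /g ltnNge ik /=; apply: Eb.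
- move=> i iL; case: (ltnP i k) => ik.
    have [-> _] := Clt i ik; rewrite /g ik => /ideal_adjoin2[r [r' /sPa]].
    rewrite addrAC => /(prime_pow_new hPa ma Paa); apply.
    by apply: (idealMl _ (prime_ideal hPa)); rewrite exprS; apply: (idealMr _ (prime_ideal hPa)).
  have [-> _] := Cge i iL ik; rewrite /g ltnNge ik /= => /ideal_adjoin2[r [r' /sPb]].
  move=> /(prime_pow_new hPb mb Pbb); apply.
  by apply: (idealMl _ (prime_ideal hPb)); rewrite expr1.
- move=> i u iL; rewrite em => /ideal_adjoin2[r [r' hu]].
  have gJ l : (0 < l)%N -> J (b * a ^+ l) /\ J (a * b ^+ l).
    case: l => // l _; rewrite !exprS !mulrA [b * a]mulrC.
    by split; apply: (idealMr _ iJ).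
  have -> : u * g i = (u - r * a - r' * b) * g i + r * (a * g i) + r' * (b * g i) by ring.
  have sJ x : J x -> C i x by exact: ideal_adjoin_sub.
  apply: (idealD (iE _ _)); [apply: (idealD (iE _ _)) |].
  + by apply: sJ; apply: (idealMr _ iJ).
  + apply: (idealMl _ (iE _ _)); rewrite -/(C i); case: (ltnP i k) => ik.
      by have [-> _] := Clt i ik; rewrite /g ik -exprS; apply: Ea.
    have [-> _] := Cge i iL ik; apply: (idealMr _ (iE _ _)).
    by rewrite -[a]expr1; apply: Ea.
  + apply: (idealMl _ (iE _ _)); rewrite -/(C i); case: (ltnP i k) => ik.
      by apply: sJ; rewrite /g ik; apply: (proj1 (gJ _ _)); rewrite subn_gt0.
    by have [-> _] := Cge i iL ik; rewrite /g ltnNge ik /= -exprS; apply: Eb.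
Qed.

End NodeLength.

(** * Smooth points and nodes *)

Lemma field_param0 (F : fieldType) (d z : F) : d != 0 -> z != 0 -> d / z != 0.
Proof. by move=> d0 z0; rewrite mulf_neq0 ?invr_eq0. Qed.
Lemma field_param1 (F : fieldType) (a b w z : F) : z != 0 ->
  a + w / z - b = ((a - b) * z + w) / z.
Proof. by move=> z0; field. Qed.
Lemma field_param2 (F : fieldType) (w z q : F) : z != 0 -> q != 0 -> w / z * q * (z / q) = w.
Proof. by move=> z0 q0; field; rewrite z0 q0. Qed.
Lemma field_param3 (F : fieldType) (d q r z : F) : d != 0 -> q != 0 -> z != 0 ->
  r * (z / q) = d / z * r * (z / q) * z / d.
Proof. by move=> d0 q0 z0; field; rewrite ?d0 ?q0 ?z0. Qed.

Section Points.

Context {K : closedFieldType} {n : nat} {G : incidence K n}.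
Local Notation S := {mpoly K[n.+1]}.
Local Notation F := {fraction S}.
Local Notation V := (vert G).
Local Notation E := (edge G).
Local Notation I := (curve_ideal G).
Implicit Types (v w : V) (x : E) (f g : S).

(** In terms of the parameter t = pos x0 + Y v / X x0 this is (t - pos x) X x0. *)
Definition den v x0 x : S := (pos x0 - pos x) *: 'X_(X x0) + 'X_(Y v).

Lemma den_neq0 v x0 x : tofrac (den v x0 x) != 0 :> F.
Proof.
apply: (@hom_neq0 _ _ (meval (fun i => (i == Y v)%:R))).
by rewrite /= /den mevalD mevalZ !mevalXU XY eqxx mulr0 add0r oner_eq0.
Qed.

Lemma den_homog v x0 x : den v x0 x \is 1.-homog.
Proof. by rewrite rpredD ?rpredZ ?dhomogXU. Qed.

Lemma den_diag v x : den v x x = 'X_(Y v).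
Proof. by rewrite /den subrr scale0r add0r. Qed.

(** The generic point of the component with Y v and X x0 as free coordinates, the relations
    [rel_comp] being solved for the other X x. *)
Definition chi v x0 (i : 'I_n.+1) : F :=
  match kind G i with
  | inl w => if w == v then tofrac 'X_(Y v) else 0
  | inr x => if inc x v then tofrac 'X_(Y v) * tofrac 'X_(X x0) / tofrac (den v x0 x) else 0
  end.

Lemma chiY v x0 : chi v x0 (Y v) = tofrac 'X_(Y v).
Proof. by rewrite /chi idxK eqxx. Qed.

Lemma tofracX_neq0 i : tofrac ('X_i : S) != 0 :> F.
Proof. by rewrite tofrac_eq0 mpolyX_neq0. Qed.

Lemma chiX v x0 : inc x0 v -> chi v x0 (X x0) = tofrac 'X_(X x0).
Proof.
by move=> hx; rewrite /chi idxK hx den_diag mulrAC divff ?mul1r // tofracX_neq0.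
Qed.

Lemma chi0 v x0 i : ~~ star v i -> chi v x0 i = 0.
Proof. by rewrite /star /chi; case: (kind G i) => [w|x] /negbTE->. Qed.

(* The rational parametrization of the component v, with affine parameter
   [pos x0 + Y v / X x0]. *)
Lemma chi_param v x0 : inc x0 v -> exists t m : F,
  forall i, (map_poly incF (zeta v i)).[t] * m = chi v x0 i.
Proof.
move=> hx0.
have [Z eZ] : exists Z : F, Z = tofrac 'X_(X x0) by eexists.
have [W eW] : exists W : F, W = tofrac 'X_(Y v) by eexists.
have [D eD] : exists D : E -> F, forall x, D x = tofrac (den v x0 x) by exists (fun x => tofrac (den v x0 x)).
have Z0 : Z != 0 by rewrite eZ; exact: tofracX_neq0.
have W0 : W != 0 by rewrite eW; exact: tofracX_neq0.
have D0 x : D x != 0 by rewrite eD; exact: den_neq0.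
have DW : D x0 = W by rewrite eD den_diag eW.
have DZ x : D x = (incF (pos x0) - incF (pos x)) * Z + W.
  rewrite eD eZ eW /den tofracD -mul_mpolyC tofracM; congr (_ * _ + _).
  by rewrite -(rmorphB incF).
pose t : F := incF (pos x0) + W / Z; pose ev (q : {poly K}) := (map_poly incF q).[t].
have evM a b : ev (a * b) = ev a * ev b by rewrite /ev rmorphM hornerM.
have ev0 : ev 0 = 0 by rewrite /ev rmorph0 horner0.
have ev1 : ev 1 = 1 by rewrite /ev rmorph1 hornerC.
have evL x : ev ('X - (pos x)%:P) = D x / Z.
  rewrite /ev map_polyXsubC hornerXsubC DZ.
  have := field_param1 (incF (pos x0)) (incF (pos x)) W Z0.
  by move->.
have evpy x : inc x v -> ev (py v) = D x / Z * ev (px v x).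
  by move=> hx; rewrite (py_px hx) evM evL.
have evpy0 : ev (py v) != 0.
  have -> : ev (py v) = \prod_(x | inc x v) ev ('X - (pos x)%:P).
    exact: (big_morph ev).
  apply: (big_ind (fun y : F => y != 0)); first exact: oner_neq0.
    by move=> ? ?; apply: mulf_neq0.
  by move=> x _; rewrite evL; exact: (field_param0 (D0 x) Z0).
have evx0 : ev (px v x0) != 0.
  by move: evpy0; rewrite (evpy x0 hx0) mulf_eq0 => /norP[].
exists t, (Z / ev (px v x0)) => i; rewrite -/(ev _) /zeta /chi.
have eY : ev (py v) * (Z / ev (px v x0)) = W.
  by rewrite (evpy x0 hx0) DW (field_param2 W Z0 evx0).
have e0 : ev 0 * (Z / ev (px v x0)) = 0 by rewrite ev0 mul0r.
case: (kind G i) => [w|x]; case: ifP => hx; last exact: e0.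
- by rewrite eY eW.
- exact: e0.
- rewrite -eZ -eD -eW -eY (evpy x hx); exact: (field_param3 _ (D0 x) evx0 Z0).
Qed.

Lemma chi_vanish v x0 f : inc x0 v -> comp_ideal v f -> mmap incF (chi v x0) f = 0.
Proof.
move=> hx0 hf; have [t [m hm]] := chi_param hx0.
have hf' : cone_map polyC (zeta v) f = 0 by [].
have := congr1 (horner_eval m \o map_poly (horner_eval t \o map_poly (@incF K n))) hf'.
rewrite rmorph0 /cone_map mmap_hom => <-; apply: mmap_ext => [c|i] /=.
  rewrite map_polyC /= /horner_eval hornerC map_polyC /= hornerC //.
by rewrite -hm -mul_polyC rmorphM /= map_polyX map_polyC /= /horner_eval hornerM hornerX hornerC.
Qed.

Lemma node_incident x v w u : v != w -> inc x v -> inc x w -> inc x u -> u = v \/ u = w.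
Proof.
move=> ne hv1 hw; have [a [b [_ _ _ hu]]] := inc_ends x.
move: ne (hu _ hv1) (hu _ hw) => ne e1 e2 /hu e3.
by case: e1 e2 e3 ne => -> [] -> [] ->; rewrite ?eqxx //; auto.
Qed.

(** Both (t - pos x) [px v x] and (t - pos x0) [px v x0] equal [py v]. *)
Lemma rel_comp v x0 x : inc x0 v -> inc x v ->
  comp_ideal v (den v x0 x * 'X_(X x) - 'X_(Y v) * 'X_(X x0)).
Proof.
move=> h0 h1; have hh : den v x0 x * 'X_(X x) - 'X_(Y v) * 'X_(X x0) \is 2.-homog.
  apply: rpredB; first exact: (dhomogM (den_homog v x0 x) (dhomogXU _ _)).
  exact: (dhomogM (dhomogXU _ _) (dhomogXU _ _)).
apply/(comp_idealP v hh); rewrite rmorphB !rmorphM /= /den rmorphD /=.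
rewrite -mul_mpolyC rmorphM /= {1}/phi mmapC /= /phi !mmapXU zetaY !zetaX //.
rewrite (py_px h0) polyCB; have := py_px h1; rewrite (py_px h0) => e.
transitivity (px v x0 * (('X - (pos x)%:P) * px v x - ('X - (pos x0)%:P) * px v x0)); last first.
  by rewrite -e subrr mulr0.
by ring.
Qed.

(** On another component u the variable Y v vanishes, and so does X x0 or X x, since by simplicity u
    is not an end of both edges. *)
Lemma rel_curve v x0 x : inc x0 v -> inc x v -> x != x0 ->
  I (den v x0 x * 'X_(X x) - 'X_(Y v) * 'X_(X x0)).
Proof.
move=> h0 h1 ne u; have iu := prime_ideal (comp_prime u).
case: (eqVneq u v) => [->|nu]; first exact: rel_comp.
have Yu : comp_ideal u 'X_(Y v) by apply/comp_idealX; rewrite starY eq_sym.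
apply: (idealB iu); last exact: (idealMr _ iu).
rewrite /den mulrDl; apply: (idealD iu); last exact: (idealMr _ iu).
rewrite -scalerAl -mul_mpolyC; apply: (idealMl _ iu).
case: (boolP (inc x0 u)) => hu0.
  apply: (idealMl _ iu); apply/comp_idealX; rewrite starX; apply: contra ne => hu1.
  by apply/eqP/(inc_simple (v := v) (w := u)); rewrite // eq_sym.
by apply: (idealMr _ iu); apply/comp_idealX; rewrite starX.
Qed.

Lemma curve_mulX i j : (forall u : V, star u i -> ~~ star u j) -> I ('X_i * 'X_j).
Proof.
move=> h u; have iu := prime_ideal (comp_prime u).
case: (boolP (star u i)) => [/h hj|hi]; first by apply: (idealMl _ iu); apply/comp_idealX.
by apply: (idealMr _ iu); apply/comp_idealX.
Qed.

Section AtPoint.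

Variable p : 'rV[K]_n.+1.
Hypothesis pI : on_scheme I p.
Local Notation R := (local_ring p).
Local Notation pt := (fun i => p 0 i).
Local Notation "f @p" := (f.@[fun i => p 0 i]) (at level 2, format "f @p").
Local Notation J := (local_ideal I p).

Lemma curve_at f : I f -> f@p = 0.
Proof. by have [_] := pI; apply. Qed.

Lemma curve_at_comp : exists v, (comp_ideal v `<=` point_ideal pt)%classic.
Proof. by apply: prime_over_curve (point_prime _) _ => f /curve_at. Qed.

(** Where Y v vanishes on its component, t is some pos x, and the point is the node of x. *)
Lemma point_cases :
  (exists v, p 0 (Y v) != 0) \/
  (exists x v w, [/\ v != w, inc x v, inc x w, p 0 (X x) != 0
     & forall i, i != X x -> p 0 i = 0]).
Proof.
have [v sv] := curve_at_comp; have [p0 _] := pI.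
have nz (c : K) q : pt = (fun i => c * q i) -> c != 0.
  move=> e; apply: contraNneq p0 => c0; apply/eqP/rowP => i; rewrite mxE.
  by have /(congr1 (fun h => h i)) := e; rewrite c0 mul0r.
have := proj1 (comp_pointP v pt) sv; case=> [[t [l e]]|[b e]]; last first.
  left; exists v; have /(congr1 (fun h => h (Y v))) := e; rewrite eqxx mulr1 => ->.
  exact: nz e.
have l0 := nz _ _ e; have ei i : p 0 i = l * (zeta v i).[t] by rewrite -[LHS]/(pt i) e.
case: (eqVneq (py v).[t] 0) => [r|r]; last first.
  by left; exists v; rewrite ei zetaY mulf_neq0.
right; have : \prod_(x | inc x v) (t - pos x) = 0.
  by rewrite -r /py horner_prod; apply: eq_bigr => x _; rewrite hornerXsubC.
move/eqP/prodf_eq0 => [x hx]; rewrite subr_eq0 => /eqP et.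
have [w wv hw] := other_end hx; exists x, v, w.
have := hw w; rewrite wv eqxx /= => hxw; rewrite eq_sym in wv; split=> //.
  by rewrite ei et zeta_node // /node eqxx mulr1 mulf_neq0 // px_node.
by move=> i /negbTE ne; rewrite ei et zeta_node // /node ne !mulr0.
Qed.

Section Krull.

Variables (z : 'I_n.+1) (pz : p 0 z != 0).

Lemma comp_lt_nonunits v : (comp_ideal v `<=` point_ideal pt)%classic ->
  (local_ideal (comp_ideal v) p `<` nonunits R)%classic.
Proof.
move=> sv; split; first exact: (local_ideal_nonunits pz (comp_homog v) sv).
have [_ ns] := comp_lt_line (proj1 (comp_pointP v pt) sv) => s; apply: ns.
apply: (homogeneous_sub (line_homog pt)) => [|f d hf /line_sub_point pf].
  exact: prime_ideal (comp_prime v).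
by apply: (local_prime_dehom (pz := pz) (comp_prime v) (comp_homog v) sv hf); apply: s;
   apply: nonunits_dehom hf pf.
Qed.

(** A chain in the local ring pulls back along [dehom] to primes of S. The smallest contains a
    component ideal strictly, as it contains X_z - 1, so the chain can be prolonged below, and
    [prime_chain_bound] leaves length 1. *)
Lemma local_krull_dim1 : krull_dim J 1.
Proof.
have [v sv] := curve_at_comp; split.
  exists (fun i => if i is 0%N then local_ideal (comp_ideal v) p else nonunits R).
  have sJv : (J `<=` local_ideal (comp_ideal v) p)%classic.
    exact: local_ideal_sub (@curve_sub _ _ _ v).
  split; last by case=> // _; apply: comp_lt_nonunits.
  case=> [|[|//]] _.
    by split=> //; apply: (local_ideal_prime pz (comp_prime v) (comp_homog v) sv).
  split; first exact: (nonunits_prime pz).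
  apply: subset_trans sJv _; exact: (local_ideal_nonunits pz (comp_homog v) sv).
move=> k [c [hc lt]]; pose D i : set S := fun f => c i (dehom pz f).
have hD i : (i <= k)%N -> is_prime (D i) /\ (I `<=` D i)%classic.
  move=> ik; have [[ic c1 cM] sc] := hc i ik; split; last first.
    by move=> f If; apply: sc; exact: local_ideal_dehom (curve_homog G) If.
  split; [split|by rewrite /D rmorph1|by move=> a b; rewrite /D rmorphM; apply: cM].
  - by rewrite /D rmorph0; apply: ideal0.
  - by move=> a b; rewrite /D rmorphD; apply: (idealD ic).
  - by move=> a b; rewrite /D rmorphM; apply: (idealMl _ ic).
have [u su] := prime_over_curve (proj1 (hD 0%N isT)) (proj2 (hD 0%N isT)).
pose D' i := if i is i'.+1 then D i' else comp_ideal u.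
suff : (k.+1 <= 2)%N by [].
apply: (prime_chain_bound (curve_growth G) (c := D')).
  by case=> [_|i ik]; [split; [exact: comp_prime | exact: curve_sub] | exact: hD].
case=> [_|i ik]; split=> //=.
- move=> s; have : comp_ideal u ('X_z - 1).
    by apply: s; rewrite /D rmorphB rmorph1 /= dehom_z subrr; apply: ideal0; case: (hc 0%N isT) => [[]].
  move/(homog_prime_irrelevant (comp_prime u) (comp_homog u)).
  by rewrite /point_ideal mevalB mevalXU meval1 sub0r => /eqP; rewrite oppr_eq0 oner_eq0.
- by have [s _] := lt i ik => f; apply: s.
- have [s ns] := lt i ik => s'; apply: ns => x cx.
  have [d [a [b [ha hb pb ex e]]]] := loc_cases pz x.
  have [[[ic _ _] _] [[ic' _ _] _]] := (hc i (ltnW ik), hc i.+1 ik).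
  apply: (ideal_unit ic (dehom_unit pz hb pb)); rewrite e; apply: s'.
  by rewrite /D -e; apply: (idealMr _ ic').
Qed.

End Krull.

End AtPoint.

End Points.

(** * Local equations at smooth points and at nodes *)

Section LocalStructure.

Context {K : closedFieldType} {n : nat} {G : incidence K n}.
Local Notation S := {mpoly K[n.+1]}.
Local Notation F := {fraction S}.
Local Notation V := (vert G).
Local Notation E := (edge G).
Local Notation I := (curve_ideal G).

Lemma mulXX_homog i j : ('X_i * 'X_j : S) \is 2.-homog.
Proof. exact: (dhomogM (dhomogXU _ _) (dhomogXU _ _)). Qed.

Lemma den_on_vars (B : pred 'I_n.+1) (v : V) (x0 x : E) :
  B (Y v) -> B (X x0) -> on_vars B (den v x0 x).
Proof.
by move=> h1 h2; apply: on_varsD; [apply: on_varsZ; apply: on_varsX | apply: on_varsX].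
Qed.

Variable p : 'rV[K]_n.+1.
Hypothesis pI : on_scheme I p.
Local Notation R := (local_ring p).
Local Notation pt := (fun i => p 0 i).
Local Notation "f @p" := (f.@[fun i => p 0 i]) (at level 2, format "f @p").
Local Notation J := (local_ideal I p).

Lemma curve_sub_point : (I `<=` point_ideal pt)%classic.
Proof. by move=> f /(curve_at pI). Qed.

Lemma loc_var_self z (pz : p 0 z != 0) : loc_var pz z - loc_const p (p 0 z / p 0 z) = 0.
Proof. by rewrite divff // rmorph1 -(dehom_z pz) /dehom mmapXU subrr. Qed.

Section Smooth.

Variables (v : V) (pz : p 0 (Y v) != 0) (x0 : E) (hx0 : inc x0 v).

Let B : pred 'I_n.+1 := [pred i | (i == Y v) || (i == X x0)].
Let u (k : 'I_n.+1) : S :=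
  match kind G k with
  | inl _ => 'X_(Y v)
  | inr x => if inc x v then den v x0 x else 'X_(Y v)
  end.
Let h (k : 'I_n.+1) : S :=
  match kind G k with
  | inl _ => 0
  | inr x => if inc x v then 'X_(Y v) * 'X_(X x0) else 0
  end.

Lemma smooth_eq k : ~~ B k -> I (u k * 'X_k - h k).
Proof.
rewrite negb_or /u /h => /andP[]; have [[w ->]|[x ->]] := var_cases G k; rewrite idxK.
  rewrite subr0 (inj_eq (@Y_inj K n G)) => ne _; apply: curve_mulX => v'.
  by rewrite !starY => /eqP <-.
rewrite (inj_eq (@X_inj K n G)) => _ ne; case: ifP => hx; first exact: rel_curve.
by rewrite subr0; apply: curve_mulX => v'; rewrite starY starX => /eqP<-; rewrite hx.
Qed.

Lemma smooth_u k : ~~ B k -> [/\ u k \is 1.-homog, on_vars B (u k) & (u k)@p != 0].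
Proof.
move=> Bk; have Yp : [/\ 'X_(Y v) \is [in K[n.+1], 1.-homog], on_vars B 'X_(Y v) & ('X_(Y v))@p != 0].
  by split; [exact: dhomogXU | apply: on_varsX; rewrite /B /= eqxx | rewrite mevalXU].
have := curve_at pI (smooth_eq Bk); rewrite /u /h; case: (kind G k) => [w|x] //.
case: ifP => // hx e; split; first exact: den_homog.
  by apply: den_on_vars; rewrite /B /= eqxx ?orbT.
apply: contraNneq pz => d0; move: e.
rewrite mevalB !mevalM d0 mul0r sub0r !mevalXU => /eqP; rewrite oppr_eq0 mulf_eq0.
case/orP => // /eqP px0; move: d0; rewrite /den mevalD mevalZ !mevalXU px0 mulr0 add0r.
by move->.
Qed.

Lemma smooth_h k : ~~ B k ->
  [/\ h k \is 2.-homog, on_vars B (h k) & (h k)@p = (u k)@p * p 0 k].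
Proof.
move=> Bk; split; last first.
- have := curve_at pI (smooth_eq Bk); rewrite mevalB mevalM mevalXU => /eqP.
  by rewrite subr_eq0 => /eqP->.
- rewrite /h; case: (kind G k) => [w|x]; first exact: on_vars0.
  case: ifP => _; last exact: on_vars0.
  by apply: on_varsM; apply: on_varsX; rewrite /B /= eqxx ?orbT.
- rewrite /h; case: (kind G k) => [w|x]; first exact: rpred0.
  by case: ifP => _; [exact: mulXX_homog | exact: rpred0].
Qed.

(** As [chi] fixes Y v and X x0, no nonzero polynomial in these two variables vanishes on the
    curve. *)
Lemma smooth_lci : complete_intersection_ideal J.
Proof.
apply: (local_lci0 pz smooth_u smooth_h (curve_homog G) smooth_eq) => r Ir hr.
apply/eqP; rewrite -tofrac_eq0 -mmap_tofrac -(chi_vanish hx0 (Ir v)); apply/eqP.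
apply: (mmap_on_vars _ hr) => i /orP[/eqP->|/eqP->]; first by rewrite chiY.
by rewrite chiX.
Qed.

Lemma smooth_regular : regular_local J.
Proof.
(* The local parameter: its dehomogenization is X x0 / Y v minus the value at p. *)
pose l := 'X_(X x0) - (p 0 (X x0) / p 0 (Y v)) *: 'X_(Y v) : S.
have hl : l \is 1.-homog by rewrite rpredB ?rpredZ ?dhomogXU.
have lp : l@p = 0 by rewrite mevalB mevalZ !mevalXU divfK // subrr.
exists 1%N, [:: dehom pz l]; split=> //; first exact: (local_krull_dim1 pI pz).
have [iN _ _] := nonunits_prime pz; have iA := ideal_adjoin_ideal J [:: dehom pz l].
apply/seteqP; split.
  apply: ideal_adjoin_min => // [|x].
    exact: (local_ideal_nonunits pz (curve_homog G) curve_sub_point).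
  by rewrite inE => /eqP->; apply: nonunits_dehom hl lp.
apply: (nonunits_sub (pz := pz) smooth_u smooth_h iA) => [k /smooth_eq Ik|i].
  by apply: ideal_adjoin_sub; exact: local_ideal_dehom (curve_homog G) Ik.
case/orP => /eqP->; first by rewrite loc_var_self; apply: ideal0.
have <- : dehom pz l = loc_var pz (X x0) - loc_const p (p 0 (X x0) / p 0 (Y v)).
  rewrite /l -mul_mpolyC rmorphB rmorphM /= dehom_z mulr1.
  by rewrite {1}/dehom mmapXU /dehom mmapC.
by apply: ideal_adjoin_mem; rewrite inE.
Qed.

End Smooth.

Section Node.

Variables (x0 : E) (v w : V) (ne : v != w) (hv0 : inc x0 v) (hw0 : inc x0 w).
Variables (pz : p 0 (X x0) != 0) (p0 : forall i, i != X x0 -> p 0 i = 0).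

Let B : pred 'I_n.+1 := [pred i | [|| i == X x0, i == Y v | i == Y w]].
Let u (k : 'I_n.+1) : S :=
  match kind G k with
  | inl _ => 'X_(X x0)
  | inr x => if inc x v then den v x0 x else if inc x w then den w x0 x else 'X_(X x0)
  end.
Let h (k : 'I_n.+1) : S :=
  match kind G k with
  | inl _ => 0
  | inr x => if inc x v then 'X_(Y v) * 'X_(X x0)
             else if inc x w then 'X_(Y w) * 'X_(X x0) else 0
  end.

Lemma node_eq k : ~~ B k -> I (u k * 'X_k - h k).
Proof.
rewrite !negb_or /u /h => /and3P[]; have [[v' ->]|[x ->]] := var_cases G k; rewrite idxK.
  rewrite subr0 !(inj_eq (@Y_inj K n G)) => _ nv nw; apply: curve_mulX => v''.
  rewrite starX starY => /(node_incident ne hv0 hw0)[->|->] //.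
rewrite (inj_eq (@X_inj K n G)) => nx _ _; case: ifP => hx; first exact: rel_curve.
case: ifP => hx'; first exact: rel_curve.
rewrite subr0; apply: curve_mulX => v'; rewrite !starX.
by move/(node_incident ne hv0 hw0) => [->|->]; rewrite ?hx ?hx'.
Qed.

Lemma node_u k : ~~ B k -> [/\ u k \is 1.-homog, on_vars B (u k) & (u k)@p != 0].
Proof.
rewrite !negb_or => /and3P[nk _ _].
have Xp : [/\ 'X_(X x0) \is [in K[n.+1], 1.-homog], on_vars B 'X_(X x0) & ('X_(X x0))@p != 0].
  by split; [exact: dhomogXU | apply: on_varsX; rewrite /B /= eqxx | rewrite mevalXU].
have dp v' x : B (Y v') -> X x != X x0 ->
  [/\ den v' x0 x \is 1.-homog, on_vars B (den v' x0 x) & (den v' x0 x)@p != 0].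
  move=> Bv nx; split; first exact: den_homog.
    by apply: den_on_vars => //; rewrite /B /= eqxx.
  rewrite /den mevalD mevalZ !mevalXU [p 0 (Y _)]p0 ?(eq_sym (Y _)) ?XY // addr0 mulf_neq0 //.
  by rewrite subr_eq0; apply: contra nx => /eqP /pos_inj->.
move: nk; rewrite /u; have [[v' ->]|[x ->]] := var_cases G k; rewrite idxK // => nx.
by case: ifP => _; [|case: ifP => _ //]; apply: dp; rewrite // /B /= eqxx ?orbT.
Qed.

Lemma node_h k : ~~ B k ->
  [/\ h k \is 2.-homog, on_vars B (h k) & (h k)@p = (u k)@p * p 0 k].
Proof.
move=> Bk; split; last first.
- have := curve_at pI (node_eq Bk); rewrite mevalB mevalM mevalXU => /eqP.
  by rewrite subr_eq0 => /eqP->.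
- rewrite /h; case: (kind G k) => [v'|x]; first exact: on_vars0.
  by case: ifP => _; [|case: ifP => _; last exact: on_vars0];
     apply: on_varsM; apply: on_varsX; rewrite /B /= eqxx ?orbT.
- rewrite /h; case: (kind G k) => [v'|x]; first exact: rpred0.
  by case: ifP => _; [exact: mulXX_homog |case: ifP => _; [exact: mulXX_homog | exact: rpred0]].
Qed.

(** With Y w1 set to zero, r involves only X x0 and Y v1, which are free on the component of v1,
    where r vanishes. *)
Lemma node_kap v1 w1 r : v1 != w1 -> inc x0 v1 ->
  (forall i, B i -> [|| i == X x0, i == Y v1 | i == Y w1]) ->
  I r -> on_vars B r -> kap (predC1 (Y w1)) r = 0.
Proof.
move=> ne1 h1 hB Ir hr; apply/eqP; rewrite -tofrac_eq0 kap_tofrac; apply/eqP.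
rewrite -[RHS](chi_vanish h1 (Ir v1)); apply: (mmap_on_vars _ hr) => i /hB /or3P[/eqP->|/eqP->|/eqP->] /=.
- by rewrite XY /= chiX.
- by rewrite (inj_eq (@Y_inj K n G)) ne1 chiY.
- by rewrite eqxx /= chi0 // starY eq_sym.
Qed.

(** By [node_kap] for both ends, r vanishes when Y v or Y w is set to zero, so it is divisible by
    each, hence by their product. *)
Lemma node_base r : I r -> on_vars B r -> exists c, r = c * ('X_(Y w) * 'X_(Y v)).
Proof.
move=> Ir hr.
have kw : kap (predC1 (Y w)) r = 0 by apply: (node_kap ne hv0 _ Ir hr) => i.
have kv : kap (predC1 (Y v)) r = 0.
  apply: (node_kap _ hw0 _ Ir hr) => [|i]; first by rewrite eq_sym.
  by case/or3P => ->; rewrite ?orbT.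
have [f ef] := sub_kap1 (Y v) r; rewrite kv subr0 in ef.
have kf : kap (predC1 (Y w)) f = 0.
  move: kw; rewrite ef rmorphM /= kapX /= (inj_eq (@Y_inj K n G)) ne => /eqP.
  by rewrite mulf_eq0 (negbTE (mpolyX_neq0 _ _)) orbF => /eqP.
have [c ec] := sub_kap1 (Y w) f; rewrite kf subr0 in ec.
by exists c; rewrite ef ec mulrA.
Qed.

Let e : S := 'X_(Y w) * 'X_(Y v).

Lemma node_mul : I e.
Proof.
apply: curve_mulX => v'; rewrite !starY => /eqP<-; exact: ne.
Qed.

Lemma pY (v' : V) : p 0 (Y v') = 0.
Proof. by apply: p0; rewrite eq_sym XY. Qed.

Lemma node_lci : complete_intersection_ideal J.
Proof.
apply: (local_lci1 pz node_u node_h (curve_homog G) node_eq node_mul (d := 2)).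
- by rewrite mulf_neq0 ?mpolyX_neq0.
- exact: mulXX_homog.
- by apply: on_varsM; apply: on_varsX; rewrite /B /= eqxx ?orbT.
- by rewrite mevalM !mevalXU pY mul0r.
- exact: node_base.
Qed.

Lemma node_maximal :
  nonunits R = ideal_adjoin J [:: dehom pz 'X_(Y v); dehom pz 'X_(Y w)].
Proof.
have [iN _ _] := nonunits_prime pz.
have iA := ideal_adjoin_ideal J [:: dehom pz 'X_(Y v); dehom pz 'X_(Y w)].
apply/seteqP; split; last first.
  apply: ideal_adjoin_min => // [|x].
    exact: (local_ideal_nonunits pz (curve_homog G) curve_sub_point).
  rewrite !inE => /orP[/eqP->|/eqP->]; apply: (nonunits_dehom (dhomogXU _ _));
    by rewrite mevalXU pY.
apply: (nonunits_sub (pz := pz) node_u node_h iA) => [k /node_eq Ik|i].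
  by apply: ideal_adjoin_sub; exact: local_ideal_dehom (curve_homog G) Ik.
have eY (v' : V) : loc_var pz (Y v') - loc_const p (p 0 (Y v') / p 0 (X x0)) = dehom pz 'X_(Y v').
  by rewrite pY mul0r rmorph0 subr0 /dehom mmapXU.
case/or3P => /eqP->; first by rewrite loc_var_self; apply: ideal0.
  by rewrite eY; apply: ideal_adjoin_mem; rewrite mem_head.
by rewrite eY; apply: ideal_adjoin_mem; rewrite !inE eqxx orbT.
Qed.

Lemma node_comp_point v' : inc x0 v' -> (comp_ideal v' `<=` point_ideal pt)%classic.
Proof.
move=> h'; apply/comp_pointP; left.
exists (pos x0), (p 0 (X x0) / (px v' x0).[pos x0]); apply/funext => i.
rewrite zeta_node // mulrA divfK ?px_node // /node.
by case: eqVneq => [->|/p0->]; rewrite ?mulr1 ?mulr0.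
Qed.

Lemma node_multiplicity : has_multiplicity J 2.
Proof.
(* By [node_length] the length modulo the k-th power is 2 k - 1 for k >= 1. *)
exists 1%N, (2%:R *: 'X - 1); split.
- exact: (local_krull_dim1 pI pz).
- apply: leq_trans (size_polyD _ _) _; rewrite size_polyN size_poly1 geq_max andbT.
  by rewrite (leq_trans (size_scale_leq _ _)) // size_polyX.
- by have f1 : (1`!)%N%:R = 1 :> rat by []; rewrite f1 divr1 coefB coefZ coefX coef1 subr0 mulr1.
exists 1%N => -[|k] // _; exists (k.+1 + k)%N; last first.
  by rewrite hornerD hornerN hornerZ hornerX hornerC natrD -[in RHS]addn1 natrD; ring.
have hP (v' : V) := local_ideal_prime pz (comp_prime v') (comp_homog v').
have sP (v' : V) : (J `<=` local_ideal (comp_ideal v') p)%classic.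
  exact: local_ideal_sub (@curve_sub _ _ _ v').
have Pin (v1 v2 : V) : v1 != v2 -> local_ideal (comp_ideal v1) p (dehom pz 'X_(Y v2)).
  move=> n12; apply: local_ideal_dehom; first exact: comp_homog.
  by apply/comp_idealX; rewrite starY eq_sym.
have Pnin (v' : V) : inc x0 v' -> ~ local_ideal (comp_ideal v') p (dehom pz 'X_(Y v')).
  move=> h' /(local_prime_dehom (comp_prime v') (comp_homog v') (node_comp_point h')
    (dhomogXU _ _)) /comp_idealX.
  by rewrite starY eqxx.
have [iN _ _] := nonunits_prime pz.
apply: (node_length (local_ideal_ideal pz (curve_homog G))
  (hP v (node_comp_point hv0)) (hP w (node_comp_point hw0)) (sP v) (sP w)
  (Pnin v hv0) (Pin v w ne) _ (Pnin w hw0) _ iN node_maximal).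
- by apply: Pin; rewrite eq_sym.
- by rewrite -rmorphM mulrC; apply: local_ideal_dehom; [exact: curve_homog | exact: node_mul].
Qed.

End Node.

End LocalStructure.

Section LocalTheorems.

Context {K : closedFieldType} {n : nat} (G : incidence K n).
Local Notation I := (curve_ideal G).

Lemma curve_lci : locally_complete_intersection I.
Proof.
move=> p pI; case: (point_cases pI) => [[v pv]|[x [v [w [ne hv1 hw1 px p0]]]]].
  by have [x hx] := inc_pos v; apply: (smooth_lci pI pv hx).
exact: (node_lci pI ne hv1 hw1 px p0).
Qed.

Lemma curve_multiplicity p : singular_point I p -> has_multiplicity (local_ideal I p) 2.
Proof.
move=> [pI sing]; case: (point_cases pI) => [[v pv]|[x [v [w [ne hv1 hw1 px p0]]]]].
  by case: sing; have [x hx] := inc_pos v; apply: (smooth_regular pI pv hx).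
exact: (node_multiplicity pI ne hv1 hw1 px p0).
Qed.

End LocalTheorems.

(** * Graphs *)

(** A non-root of the product of the X - a extends the list; this provides the positions of the
    edges in every characteristic. *)
Lemma exists_uniq_seq (K : closedFieldType) m : exists2 s : seq K, uniq s & size s = m.
Proof.
elim: m => [|m [s us ss]]; first by exists [::].
have [|t ht] := @exists_nonroot K (\prod_(a <- s) ('X - a%:P)).
  by apply/monic_neq0/monic_prod => a _; exact: monicXsubC.
exists (t :: s); last by rewrite /= ss.
rewrite /= us andbT; apply: contra ht => ts.
by have := root_prod_XsubC s t; rewrite ts => /rootP ->.
Qed.

Section GraphCurve.

Variables (K : closedFieldType) (V : finType) (e : rel V).
Hypotheses (e_sym : ssrbool.symmetric e) (e_irr : irreflexive e)
  (V_ge2 : (2 <= #|V|)%N) (e_conn : forall v w : V, connect e v w).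

(** Unordered pairs, so that the two orientations of an edge share one variable. *)
Definition is_edge (A : {set V}) : bool :=
  [exists v, exists w, e v w && (A == [set v; w]%SET)].

Definition graph_edge := {A : {set V} | is_edge A}.

Definition graph_inc (x : graph_edge) (v : V) : bool := v \in val x.

Lemma graph_edgeP (x : graph_edge) : exists v w, e v w /\ val x = [set v; w]%SET.
Proof.
have /existsP[v /existsP[w /andP[h /eqP ex]]] := valP x.
by exists v, w.
Qed.

Lemma graph_adj_neq v w : e v w -> v != w.
Proof. by apply: contraTneq => ->; rewrite e_irr. Qed.

Lemma graph_ends (x : graph_edge) : exists v w,
  [/\ v != w, graph_inc x v, graph_inc x w & forall u, graph_inc x u -> u = v \/ u = w].
Proof.
have [v [w [h ex]]] := graph_edgeP x; exists v, w; rewrite /graph_inc ex.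
split; rewrite ?finset.inE ?eqxx ?orbT ?graph_adj_neq // => u.
by rewrite !finset.inE => /orP[/eqP->|/eqP->]; [left | right].
Qed.

Lemma graph_inc2 (x : graph_edge) v w : v != w -> graph_inc x v -> graph_inc x w ->
  val x = [set v; w]%SET.
Proof.
rewrite /graph_inc; have [a [b [h ex]]] := graph_edgeP x; rewrite ex => ne hv0 hw0.
apply/esym/eqP; rewrite eqEcard !cards2 ne (graph_adj_neq h) andbT.
by apply/fintype.subsetP => u; rewrite [u \in [set v; w]%SET]finset.inE !finset.in_set1 => /orP[/eqP->|/eqP->].
Qed.

Lemma graph_simple (x x' : graph_edge) v w : v != w ->
  graph_inc x v -> graph_inc x w -> graph_inc x' v -> graph_inc x' w -> x = x'.
Proof. by move=> ne h1 h2 h3 h4; apply: val_inj; rewrite !(graph_inc2 ne). Qed.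

Lemma graph_adj v w : e v w -> exists2 x : graph_edge, graph_inc x v & graph_inc x w.
Proof.
move=> h; have hA : is_edge [set v; w]%SET.
  by apply/existsP; exists v; apply/existsP; exists w; rewrite h eqxx.
by exists (Sub [set v; w]%SET hA); rewrite /graph_inc !finset.inE eqxx ?orbT.
Qed.

Lemma graph_inc_adj (x : graph_edge) v w : v != w -> graph_inc x v -> graph_inc x w -> e v w.
Proof.
move=> ne hv0 hw0; have [a [b [h ex]]] := graph_edgeP x; move: ne hv0 hw0.
rewrite /graph_inc ex !finset.inE => ne /orP[/eqP ev|/eqP ev] /orP[/eqP ew|/eqP ew];
  by move: ne; rewrite ev ew ?eqxx // e_sym.
Qed.

(** A path from v to a second vertex begins with an edge at v. *)
Lemma graph_inc_pos v : exists x : graph_edge, graph_inc x v.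
Proof.
have [w nw] : exists w, w != v.
  apply: contrapT => none; move: V_ge2; rewrite ltnNge => /negP; apply.
  rewrite -cardsT -(cards1 v); apply: subset_leq_card; apply/fintype.subsetP => w _.
  by rewrite finset.inE; apply/negPn/negP => h; apply: none; exists w.
have /connectP[[|u s]] := e_conn v w; first by move=> _ ev; rewrite ev eqxx in nw.
by move=> /= /andP[/graph_adj[x hx _] _] _; exists x.
Qed.

Lemma graph_inc_conn (T : Type) (c : V -> T) :
  (forall (x : graph_edge) v w, graph_inc x v -> graph_inc x w -> c v = c w) ->
  forall v w, c v = c w.
Proof.
move=> hc v w; have /connectP[s] := e_conn v w.
elim: s v => [|u s IH] v /=; first by move=> _ ->.
by move=> /andP[/graph_adj[x h1 h2] hs] ew; rewrite (hc x v u) // (IH u).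
Qed.

Let N := #|{: V + graph_edge}|.

Lemma graph_card : N = N.-1.+1.
Proof.
rewrite prednK // /N; have /card_gt0P[v _] : (0 < #|V|)%N by apply: ltnW.
by apply/card_gt0P; exists (inl v).
Qed.

Definition graph_idx (i : V + graph_edge) : 'I_N.-1.+1 := cast_ord graph_card (enum_rank i).
Definition graph_kind (j : 'I_N.-1.+1) : V + graph_edge :=
  enum_val (cast_ord (esym graph_card) j).

Lemma graph_idxK : cancel graph_idx graph_kind.
Proof. by move=> i; rewrite /graph_idx /graph_kind cast_ordK enum_rankK. Qed.
Lemma graph_kindK : cancel graph_kind graph_idx.
Proof. by move=> i; rewrite /graph_idx /graph_kind enum_valK cast_ordKV. Qed.

Lemma graph_curve_exists : exists G : incidence K N.-1,
  exists2 f : V -> vert G, bijective f &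
    forall v w, v != w -> e v w <-> exists x, inc x (f v) && inc x (f w).
Proof.
have [s us ss] := exists_uniq_seq K #|{: graph_edge}|.
have posI : injective (fun x : graph_edge => nth 0 s (enum_rank x)).
  move=> x x' /eqP; rewrite nth_uniq ?ss ?ltn_ord // => /eqP h.
  exact/enum_rank_inj/val_inj.
exists (Incidence graph_idxK graph_kindK posI graph_ends graph_simple graph_inc_pos
  graph_inc_conn), id; first by exists id.
move=> v w ne; split=> [/graph_adj[x h1 h2]|[x /andP[h1 h2]]].
  by exists x; rewrite /= h1 h2.
exact: (graph_inc_adj ne h1 h2).
Qed.

End GraphCurve.

Section Scheme.

Context {K : closedFieldType} {n : nat} (G : incidence K n).

Lemma curve_radical : is_radical (curve_ideal G).
Proof. by move=> f k h v; apply: (prime_exp (comp_prime v)) (h v). Qed.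

(** Saturation is tested for each v on the powers of Y v, which lie outside the prime ideal of its
    component. *)
Lemma curve_projective : projective_scheme (curve_ideal G).
Proof.
split; first exact: curve_homog.
move=> f [N hN] v; have [_ _ PM] := comp_prime v.
have := hN (U_(Y v) *+ N)%MM _ v; rewrite mdegMn mdeg1 mul1n -mpolyXn => /(_ erefl)/PM[|//].
by move/(prime_exp (comp_prime v))/comp_idealX; rewrite starY eqxx.
Qed.

End Scheme.

Theorem mainTheorem1 (K : closedFieldType) (V : finType) (e : rel V)
    (e_sym : ssrbool.symmetric e) (e_irr : irreflexive e) (V_ge2 : (2 <= #|V|)%N)
    (e_conn : forall v w : V, connect e v w) :
  exists (n : nat) (I : set {mpoly K[n.+1]}),
    [/\ projective_scheme I, is_curve I, is_radical I & cohen_macaulay I] /\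
    [/\ dual_graph_is I e,
        exists2 r : int, has_regularity I r & r <= 3,
        forall P, irreducible_component I P -> rational_normal_in_span P,
        forall p, singular_point I p -> has_multiplicity (local_ideal I p) 2
      & locally_complete_intersection I].
Proof.
have [G [f bf hf]] := graph_curve_exists K e_sym e_irr V_ge2 e_conn.
have [g fg gf] := bf.
have [v0 _] : exists v : V, v \in V by apply/card_gt0P; apply: ltnW.
exists _, (curve_ideal G); split; split.
- exact: curve_projective.
- exact: curve_is_curve (f v0).
- exact: curve_radical.
- exact: curve_cohen_macaulay.
- exists (fun v => comp_ideal (f v)); split.
  + by move=> v w ew; apply: (can_inj fg); apply: comp_incl; rewrite ew.
  + move=> P; rewrite curve_componentP; split=> [[v <-]|[v <-]].
      by exists (g v); rewrite gf.
    by exists (f v).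
  + move=> v w ne; rewrite hf //; apply: curve_meet.
    by rewrite (inj_eq (can_inj fg)).
- exact: curve_regularity (f v0).
- by move=> P /curve_componentP[v <-]; apply: comp_rational_normal.
- exact: curve_multiplicity.
- exact: curve_lci.
Qed.
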